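(* Let $\Omega$ be a convex domain in $\mathbb C^2$ containing no affine complex lines, with $\mathcal C^{1,\alpha}$-smooth boundary. Suppose that $\Omega$ fails the weak visibility property. Then there exists a complex tangential line segment $S\subset\partial\Omega$ consisting of non-Goldilocks points.
   Context: For a domain $\Omega\subset\mathbb C^n$, $\Delta$ is the unit disc, $k_\Omega$ is the Kobayashi pseudodistance and $\kappa_\Omega(z;v)=\inf\{1/r: r>0,\ \exists \varphi\in\mathcal O(r\Delta,\Omega),\ \varphi(0)=z,\ \varphi'(0)=v\}$ is the Kobayashi-Royden pseudometric. $\Omega$ is hyperbolic if $k_\Omega$ is a distance (convex domains containing no affine complex lines are hyperbolic). $\delta_\Omega(z)$ is the Euclidean distance from $z$ to $\partial\Omega$. $\mathcal C^{1,\alpha}$ is the usual Hölder class, for some exponent $\alpha>0$. For an absolutely continuous curve $\gamma:I\to\Omega$, $l^\kappa_\Omega(\gamma)=\int_I\kappa_\Omega(\gamma(t);\gamma'(t))\,dt$. For $\lambda\ge1,\epsilon\ge0$, an absolutely continuous $\gamma:[0,1]\to\Omega$ is a $(\lambda,\epsilon)$-geodesic if $l^\kappa_\Omega(\gamma|_{[t_1,t_2]})\le\lambda k_\Omega(\gamma(t_1),\gamma(t_2))+\epsilon$ for all $t_1\le t_2$ in $[0,1]$. For $\Omega$ hyperbolic and distinct $p,q\in\partial\Omega$, $\{p,q\}$ is a $(\lambda,\epsilon)$-visible pair if there are neighbourhoods $U_p,U_q$ of $p,q$ and $K\subset\subset\Omega$ such that every $(\lambda,\epsilon)$-geodesic joining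 a point of $\Omega\cap U_p$ to a point of $\Omega\cap U_q$ meets $K$. $\Omega$ satisfies the weak visibility property if every pair of distinct boundary points is a $(1,\epsilon)$-visible pair for every $\epsilon\ge0$. A point $p\in\partial\Omega$ is a local Goldilocks point if there is a neighbourhood $U$ of $p$ such that (1) $\int_0^\epsilon \frac{M_{\Omega,U}(r)}{r}dr<\infty$ for some (hence any) $\epsilon>0$, where $M_{\Omega,U}(r):=\sup\{\kappa_\Omega^{-1}(z;v): z\in\Omega\cap U,\ \delta_\Omega(z)\le r,\ v\in\mathbb C^n,\ \|v\|=1\}$; and (2) for some (hence any) $z_0\in\Omega$ there exist $\alpha,C>0$ with $k_\Omega(z,z_0)\le C+\alpha|\log\delta_\Omega(z)|$ (this second condition always holds for convex domains). A point of $\partial\Omega$ is a non-Goldilocks point if it is not a local Goldilocks point. The affine complex tangent space at $p\in\partial\Omega$ is $T^{\mathbb C}_p\partial\Omega=p+(F^{\mathbb R}_p\partial\Omega\cap iF^{\mathbb R}_p\partial\Omega)$, where $F^{\mathbb R}_p\partial\Omega$ is the (linear) real tangent space. A complex tangential line segment in $\partial\Omega$ is a nondegenerate real line segment $S\subset\partial\Omega$ with $S\subset T^{\mathbb C}_s\partial\Omega$ for $s\in S$. *)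

(* Defs.v *)
(* MathComp-Analysis; C is R[i] for R : realType, and C^n is 'rV[R[i]]_n with
   its topology of normed R[i]-module. *)
From HB Require Import structures.
From mathcomp Require Import all_boot all_order all_algebra.
From mathcomp Require Import complex.
From mathcomp Require Import all_classical all_reals all_analysis.

Set Implicit Arguments.
Unset Strict Implicit.
Unset Printing Implicit Defensive.

Import Order.TTheory GRing.Theory Num.Theory.
Import numFieldNormedType.Exports.

Local Open Scope classical_set_scope.
Local Open Scope ring_scope.
Local Open Scope complex_scope.

(* The library equips every numFieldType variable with its norm topology, but
   not the concrete type R[i]. *)
Section ComplexTopology.
Variable R : realType.
#[non_forgetful_inheritance]
HB.instance Definition _ := PseudoPointedMetric.copy R[i] R[i]^o.
#[non_forgetful_inheritance]
HB.instance Definition _ := GRing.ComAlgebra.copy R[i] R[i]^o.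
#[non_forgetful_inheritance]
HB.instance Definition _ := Vector.copy R[i] R[i]^o.
#[non_forgetful_inheritance]
HB.instance Definition _ := NormedModule.copy R[i] R[i]^o.
End ComplexTopology.

Section ComplexSpace.
Context {R : realType} {n : nat}.
Local Notation C := R[i].
Local Notation Cn := 'rV[R[i]]_n.

(* C^n = R^{2n}, z = x + iy |-> (x, y): the library differentiates over R only
   between normed R-modules. *)
Definition realify (z : Cn) : 'rV[R]_(n + n) :=
  row_mx (map_mx (@complex.Re R) z) (map_mx (@complex.Im R) z).

Definition complexify (x : 'rV[R]_(n + n)) : Cn :=
  \row_j (x 0 (lshift n j) +i* x 0 (rshift n j)).

(* The Euclidean norm; the library norm `|z| on C^n is the sup norm. *)
Definition enorm (z : Cn) : R :=
  Num.sqrt (\sum_j (complex.Re (z 0 j) ^+ 2 + complex.Im (z 0 j) ^+ 2)).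

Definition domain (Omega : set Cn) : Prop :=
  [/\ Omega !=set0, open Omega & connected Omega].

Definition boundary (Omega : set Cn) : set Cn := closure Omega `\` Omega°.

Definition bdist (Omega : set Cn) (z : Cn) : R :=
  inf [set enorm (z - w) | w in boundary Omega].

Definition contains_complex_line (Omega : set Cn) : Prop :=
  exists a v : Cn, v != 0 /\ forall zeta : C, Omega (a + zeta *: v).

Definition segment (a b : Cn) : set Cn :=
  [set (1 - t)%:C *: a + t%:C *: b | t in `[0, 1] ].

(* [phi] restricts to an element of O(r Delta, Omega). *)
Definition holomorphic_disc (Omega : set Cn) (r : R) (phi : C -> Cn) : Prop :=
  forall z : C, `|z| < r%:C -> derivable phi z 1 /\ Omega (phi z).

Definition kobayashi_royden (Omega : set Cn) (z v : Cn) : R :=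
  inf [set r^-1 | r in [set r : R | 0 < r /\
    exists phi : C -> Cn,
      [/\ holomorphic_disc Omega r phi, phi 0 = z & 'D_1 phi 0 = v]]].

(* The Poincare distance from 0 to [a] in the unit disc, normalised so that its
   infinitesimal form at 0 is the Euclidean metric, as for [kobayashi_royden]. *)
Definition poincare0 (a : C) : R :=
  2^-1 * ln ((1 + complex.Re `|a|) / (1 - complex.Re `|a|)).

(* [disc_chain Omega z w s]: a chain of analytic discs in Omega joins z to w
   with total Poincare length s.  As the disc is homogeneous, each disc may be
   taken to start at its centre. *)
Inductive disc_chain (Omega : set Cn) : Cn -> Cn -> R -> Prop :=
| disc_chain_nil z : Omega z -> disc_chain Omega z z 0
| disc_chain_cons phi a w s :
    holomorphic_disc Omega 1 phi -> `|a| < 1 ->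
    disc_chain Omega (phi a) w s ->
    disc_chain Omega (phi 0) w (poincare0 a + s).

Definition kobayashi (Omega : set Cn) (z w : Cn) : R :=
  inf [set s | disc_chain Omega z w s].

Definition absolutely_continuous (a b : R) (gamma : R -> Cn) : Prop :=
  forall eps : R, 0 < eps -> exists2 delta : R, 0 < delta &
    forall (m : nat) (s t : 'I_m -> R),
      (forall i, [/\ a <= s i, s i <= t i & t i <= b]) ->
      (forall i j, i != j -> t i <= s j \/ t j <= s i) ->
      \sum_i (t i - s i) < delta ->
      \sum_i enorm (gamma (t i) - gamma (s i)) < eps.

(* gamma'(t), meaningful where gamma is differentiable at t: for gamma
   absolutely continuous on [a, b], at almost every t in [a, b]. *)
Definition velocity (gamma : R -> Cn) (t : R) : Cn :=
  complexify (derive1 (realify \o gamma) t).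

Definition kappa_length (Omega : set Cn) (gamma : R -> Cn) (t1 t2 : R) : \bar R :=
  (\int[lebesgue_measure]_(t in `[t1, t2])
     (kobayashi_royden Omega (gamma t) (velocity gamma t))%:E)%E.

(* Curves are total functions; only their restriction to [0, 1] is relevant. *)
Definition geodesic (Omega : set Cn) (lambda eps : R) (gamma : R -> Cn) : Prop :=
  [/\ forall t, 0 <= t <= 1 -> Omega (gamma t),
      absolutely_continuous 0 1 gamma
    & forall t1 t2, 0 <= t1 -> t1 <= t2 -> t2 <= 1 ->
        (kappa_length Omega gamma t1 t2 <=
         (lambda * kobayashi Omega (gamma t1) (gamma t2) + eps)%:E)%E].

Definition visible_pair (Omega : set Cn) (lambda eps : R) (p q : Cn) : Prop :=
  exists Up Uq K : set Cn,
    [/\ nbhs p Up, nbhs q Uq, compact (closure K), closure K `<=` Omega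
      & forall gamma, geodesic Omega lambda eps gamma ->
          (Omega `&` Up) (gamma 0) -> (Omega `&` Uq) (gamma 1) ->
          exists2 t, 0 <= t <= 1 & K (gamma t)].

Definition weak_visibility (Omega : set Cn) : Prop :=
  forall p q, boundary Omega p -> boundary Omega q -> p != q ->
  forall eps : R, 0 <= eps -> visible_pair Omega 1 eps p q.

(* M_{Omega,U}(r).  The inverse is that of \bar R, for which 0^-1 = +oo. *)
Definition goldilocks_M (Omega U : set Cn) (r : R) : \bar R :=
  ereal_sup [set y : \bar R | exists z v : Cn,
    [/\ (Omega `&` U) z, bdist Omega z <= r, enorm v = 1
      & y = ((kobayashi_royden Omega z v)%:E^-1)%E]].

Definition local_goldilocks (Omega : set Cn) (p : Cn) : Prop :=
  boundary Omega p /\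
  exists U : set Cn, [/\ nbhs p U,
    (exists2 eps : R, 0 < eps &
      (\int[lebesgue_measure]_(r in `]0%R, eps])
         (goldilocks_M Omega U r * (r^-1)%:E) < +oo)%E)
  & (exists z0 : Cn, Omega z0 /\
      exists alpha C0 : R, [/\ 0 < alpha, 0 < C0 &
        forall z, (Omega `&` U) z ->
          kobayashi Omega z z0 <= C0 + alpha * `|ln (bdist Omega z)|])].

Definition non_goldilocks (Omega : set Cn) (p : Cn) : Prop :=
  boundary Omega p /\ ~ local_goldilocks Omega p.

(* [rho] is a C^1 local defining function of Omega near p. *)
Definition defining_function (Omega : set Cn) (p : Cn)
    (rho : 'rV[R]_(n + n) -> R) : Prop :=
  \forall x \near realify p,
    [/\ differentiable rho x,
        forall v, {for x, continuous (fun y => 'd rho y v)},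
        exists v, 'd rho x v != 0
      & Omega (complexify x) <-> rho x < 0].

Definition holder_differential (alpha : R) (p : Cn)
    (rho : 'rV[R]_(n + n) -> R) : Prop :=
  exists2 U, nbhs (realify p) U & exists L : R, forall x y v, U x -> U y ->
    `|'d rho x v - 'd rho y v| <= L * `|x - y| `^ alpha * `|v|.

Definition C1alpha_boundary (Omega : set Cn) (alpha : R) : Prop :=
  forall p, boundary Omega p -> exists rho,
    defining_function Omega p rho /\ holder_differential alpha p rho.

(* For a C^1 boundary the kernel of d rho(p) does not depend on the local
   defining function rho. *)
Definition real_tangent (Omega : set Cn) (p : Cn) : set Cn :=
  [set v | exists rho,
    defining_function Omega p rho /\ 'd rho (realify p) (realify v) = 0].

Definition affine_complex_tangent (Omega : set Cn) (p : Cn) : set Cn :=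
  [set p + v | v in real_tangent Omega p `&`
                    [set 'i *: v | v in real_tangent Omega p]].

Definition complex_tangential_segment (Omega S : set Cn) : Prop :=
  [/\ exists a b : Cn, a != b /\ S = segment a b,
      S `<=` boundary Omega
    & forall s, S s -> S `<=` affine_complex_tangent Omega s].

End ComplexSpace.

(* Main.v *)
(* If visibility fails for the pair p, q, there are (1, eps)-geodesics starting
   arbitrarily near p, leaving a fixed small ball around p, and staying arbitrarily
   close to the boundary on the way.  By convexity kappa (z; v) is at least
   |c(v)| / (4 Re c(z - x)) for every complex functional c supporting Omega at a boundary
   point x, whereas the Kobayashi distance is at most
   C + A |ln (bdist z)| + A |ln (bdist w)|; hence the boundary distance decays
   exponentially in the length travelled from the point of the geodesic farthest from
   the boundary.  Together with the Hoelder continuity of the normals this prevents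
   the normal coordinate from moving, so the geodesics accumulate on the face of
   closure Omega cut out by the complex tangent line at p, and this face contains
   a point other than p.

   If the face has interior in that complex line, small affine discs in it
   bound kappa from above near the boundary, so the Goldilocks integral diverges at its
   interior points.  Otherwise the face lies on a real line, and the geodesics
   must cross near each of its interior points; near a Goldilocks point the same
   exponential decay would bound the total displacement by a tail of the convergent
   Goldilocks integral, which is absurd. *)

(* The usual argument parametrises geodesics by [kappa]-length. Here the metric is not known to be
   measurable along a curve, so length is handled as a superadditive lower integral; instead of
   being reparametrised, the curve is cut at the successive times at which some functional has moved
   by a prescribed threshold. Every such exit costs length at least 1/8, and since the boundary
   distance decays geometrically in the length already spent, the thresholds can be taken summable.
   The same scheme [exit_chain] serves twice: for the normal coordinate together with the normals,
   and for the displacement near a Goldilocks point. Hoelder continuity of the normals makes the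
   first series converge: with mere continuity, a geometric decay of the distance would not give
   summable changes of the normal. The constant 4 in the lower bound on [kappa] is not sharp; it
   comes from an elementary proof through a minimum principle on circles, which rests on Goursat's
   bisection because discs are only assumed complex differentiable. *)
Require Import Defs.
From HB Require Import structures.
From mathcomp Require Import all_boot all_order all_algebra.
From mathcomp Require Import complex.
From mathcomp Require Import all_classical all_reals all_analysis.
From mathcomp Require Import measurable_realfun ring lra.
Set Implicit Arguments.
Unset Strict Implicit.
Unset Printing Implicit Defensive.
Import Order.TTheory GRing.Theory Num.Theory.
Import numFieldNormedType.Exports.
Local Open Scope classical_set_scope.
Local Open Scope ring_scope.

(** * Lengths of absolutely continuous curves *)

(* The integral of a nonnegative function which is not known to be measurable, such
   as the kappa-speed of a curve, is by definition its lower integral. *)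
Section LowerIntegral.
Import HBNNSimple.
Context d (T : measurableType d) (R : realType).
Variable mu : {measure set T -> \bar R}.
Local Open Scope ereal_scope.

Lemma ge0_le_lower_integral (D : set T) (f g : T -> \bar R) :
  (forall x, D x -> 0 <= g x) -> (forall x, D x -> g x <= f x) ->
  \int[mu]_(x in D) g x <= \int[mu]_(x in D) f x.
Proof.
move=> g0 gf.
have f0 x : D x -> 0 <= f x by move=> Dx; exact: (le_trans (g0 x Dx) (gf x Dx)).
rewrite !ge0_integralE//.
apply: le_ereal_sup => _ [h hg <-]; exists h => // x.
apply: (le_trans (hg x)); rewrite /patch; case: ifPn => // /set_mem; exact: gf.
Qed.

(** If h and k are simple minorants of f on A and on B, then h + k is one on D because A and B are
    disjoint. The two suprema are taken one after the other; when the right-hand side is finite, one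
    term can be moved across. *)
Lemma lower_integral_setU (A B D : set T) (f : T -> \bar R) :
  measurable A -> measurable B -> A `&` B = set0 -> A `|` B `<=` D ->
  (forall x, D x -> 0 <= f x) ->
  \int[mu]_(x in A) f x + \int[mu]_(x in B) f x <= \int[mu]_(x in D) f x.
Proof.
move=> mA mB AB ABD f0.
have fA x : A x -> 0 <= f x by move=> Ax; apply/f0/ABD; left.
have fB x : B x -> 0 <= f x by move=> Ax; apply/f0/ABD; right.
rewrite [X in X + _]ge0_integralE// [X in _ + X]ge0_integralE//.
set SA := ereal_sup _; set SB := ereal_sup _.
have step (h k : {nnsfun T >-> R}) : (forall x, (h x)%:E <= (f \_ A) x) ->
    (forall x, (k x)%:E <= (f \_ B) x) ->
  sintegral mu h + sintegral mu k <= \int[mu]_(x in D) f x.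
  move=> hA kB; rewrite -sintegralD.
  rewrite ge0_integralE//; apply: ereal_sup_ubound => /=.
  exists (add_nnsfun h k); last by [].
  move=> x /=; rewrite EFinD.
  have [xA|xA] := pselect (A x).
    have xB : ~ B x by move=> xB; have : (A `&` B) x by []; rewrite AB.
    apply: (@le_trans _ _ ((f \_ A) x + (f \_ B) x)); first exact: leeD.
    rewrite /patch mem_set// memNset// mem_set ?adde0//.
    by apply: ABD; left.
  apply: (@le_trans _ _ ((f \_ A) x + (f \_ B) x)); first exact: leeD.
  rewrite {1}/patch memNset// add0e.
  rewrite /patch; case: ifPn => xB.
    rewrite mem_set//; apply: ABD; right; exact: set_mem.
  by case: ifPn => // /set_mem; exact: f0.
have D0 : 0 <= \int[mu]_(x in D) f x by exact: integral_ge0.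
have step2 (h : {nnsfun T >-> R}) : (forall x, (h x)%:E <= (f \_ A) x) ->
    sintegral mu h + SB <= \int[mu]_(x in D) f x.
  move=> hA.
  have := leey (\int[mu]_(x in D) f x).
  rewrite le_eqVlt => /predU1P[->|Dfin]; first exact: leey.
  have hfin : sintegral mu h \is a fin_num.
    have h0 := sintegral_ge0 mu h.
    rewrite ge0_fin_numE//; apply: le_lt_trans Dfin.
    have := step h nnsfun0 hA; rewrite sintegral0 adde0; apply.
    by move=> x; rewrite /= /patch; case: ifPn => // /set_mem /fB.
  rewrite addeC -leeBrDr//; apply: ge_ereal_sup => _ [k kB <-].
  by rewrite leeBrDr// addeC; exact: step.
have := leey (\int[mu]_(x in D) f x).
rewrite le_eqVlt => /predU1P[->|Dfin]; first exact: leey.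
have SBfin : SB \is a fin_num.
  have SB0 : 0 <= SB.
    apply: ereal_sup_ubound; exists nnsfun0; last exact: sintegral0.
    by move=> x; rewrite /= /patch; case: ifPn => // /set_mem /fB.
  rewrite ge0_fin_numE//; apply: le_lt_trans Dfin.
  have := step2 nnsfun0; rewrite sintegral0 add0e; apply.
  by move=> x; rewrite /= /patch; case: ifPn => // /set_mem /fA.
rewrite -leeBrDr//; apply: ge_ereal_sup => _ [h hA <-].
by rewrite leeBrDr//; exact: step2.
Qed.

End LowerIntegral.

Section AcSeq.
Variable R : realType.
Implicit Types (a b s t x y : R) (F : R -> R) (l : seq (R * R)).

Definition separated (p q : R * R) := (p.2 <= q.1) || (q.2 <= p.1).

Definition subintervals a b l :=
  all (fun p => [&& a <= p.1, p.1 <= p.2 & p.2 <= b]) l && pairwise separated l.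

Definition total_length l := \sum_(p <- l) (p.2 - p.1).

Definition oscillation F l := \sum_(p <- l) `|F p.2 - F p.1|.

(** Lists replace the indexed families of [absolutely_continuous], so that refining an interval into
    a partition is list concatenation. The weak inequality survives the passage to suprema over
    partitions. *)
Definition ac_seq a b F := forall eps, 0 < eps -> exists2 delta, 0 < delta &
  forall l, subintervals a b l -> total_length l < delta ->
    oscillation F l <= eps.

Lemma subintervals_pairs s t (pi : seq R) : path <%R s pi -> last s pi = t ->
  subintervals s t (zip (s :: pi) pi) /\
  total_length (zip (s :: pi) pi) = t - s.
Proof.
rewrite /subintervals /total_length.
elim: pi s => [s _ <-|x pi IH s /= /andP[sx px] lt]; first by rewrite big_nil subrr.
have [/andP[H1 H2] H3] := IH x px lt.
split; last by rewrite big_cons /= H3; ring.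
have xt : x <= t.
  move: px lt; elim: (pi) x {IH sx H1 H2 H3} => [x _ <-//|y r IH x /= /andP[xy py] yt].
  by rewrite (le_trans (ltW xy))// IH.
rewrite lexx (ltW sx) xt H2 /= andbT; apply/andP; split.
  apply: sub_all H1 => p /and3P[h1 -> ->]; by rewrite (le_trans (ltW sx))// h1.
by apply: sub_all H1 => p /and3P[h1 _ _]; rewrite /separated h1.
Qed.

Lemma subintervals_cat a b l1 l2 : subintervals a b (l1 ++ l2) =
  [&& subintervals a b l1, subintervals a b l2 & allrel separated l1 l2].
Proof.
rewrite /subintervals all_cat pairwise_cat.
case: (all _ l1); case: (all _ l2); case: (allrel _ _ _) => //=;
  by rewrite ?andbT ?andbF.
Qed.

Lemma subintervals_consE a b s t l : subintervals a b ((s, t) :: l) =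
  [&& a <= s, s <= t, t <= b, subintervals a b l & all (separated (s, t)) l].
Proof.
rewrite /subintervals /=.
case: (a <= s); case: (s <= t); case: (t <= b); case: (all _ l) => //=;
  by rewrite ?andbT ?andbF // andbC.
Qed.

Lemma subintervals_refine a b s t l pi : subintervals a b ((s, t) :: l) ->
  path <%R s pi -> last s pi = t -> subintervals a b (zip (s :: pi) pi ++ l).
Proof.
rewrite subintervals_consE => /and5P[as_ st tb Hl sepl] ppi lpi.
have [/andP[H1 H2] H3] := subintervals_pairs ppi lpi.
rewrite subintervals_cat Hl /subintervals H2 andbT/=; apply/andP; split.
  apply: sub_all H1 => p /and3P[h1 -> h2].
  by rewrite (le_trans as_)// (le_trans h2).
apply/allrelP => p q pz ql.
move/allP: H1 => /(_ _ pz) /and3P[h1 _ h2].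
move/allP: sepl => /(_ _ ql); rewrite /separated /= => /orP[h|h].
  by rewrite (le_trans h2).
by rewrite (le_trans h) ?orbT.
Qed.

Lemma subintervals_catCA a b l1 l2 l3 :
  subintervals a b (l1 ++ l2 ++ l3) = subintervals a b (l2 ++ l1 ++ l3).
Proof.
rewrite !subintervals_cat !allrel_catr (allrelC separated l2 l1).
have -> : allrel (fun p q => separated q p) l1 l2 = allrel separated l1 l2.
  by apply: eq_allrel => p q; rewrite /separated orbC.
case: (subintervals a b l1); case: (subintervals a b l2);
  case: (subintervals a b l3); case: (allrel _ l1 l2); case: (allrel _ l1 l3);
  by case: (allrel _ l2 l3).
Qed.

Lemma total_length_cat l1 l2 :
  total_length (l1 ++ l2) = total_length l1 + total_length l2.
Proof. by rewrite /total_length big_cat. Qed.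

Lemma oscillation_cat F l1 l2 :
  oscillation F (l1 ++ l2) = oscillation F l1 + oscillation F l2.
Proof. by rewrite /oscillation big_cat. Qed.

Lemma oscillation_ge0 F l : 0 <= oscillation F l.
Proof. by apply: sumr_ge0. Qed.

Lemma oscillation_pairs F s t pi : itv_partition s t pi ->
  variation s t F pi = oscillation F (zip (s :: pi) pi).
Proof.
move=> H; rewrite variation_zip// /oscillation {H}.
elim: pi s => [s|x pi IH s /=]; first by rewrite !big_nil.
by rewrite !big_cons /= IH.
Qed.

(** Replacing the intervals of [l1] one at a time by partitions changes neither the total length nor
    separation, so the bound on oscillations passes to the supremum over the partitions of each
    interval in turn; [l2] collects the intervals already partitioned. *)
Lemma total_variation_small a b F eps delta :
  (forall l, subintervals a b l -> total_length l < delta ->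
    oscillation F l <= eps) ->
  forall l1 l2, subintervals a b (l1 ++ l2) ->
    total_length (l1 ++ l2) < delta ->
  (\sum_(p <- l1) total_variation p.1 p.2 F + (oscillation F l2)%:E <= eps%:E)%E.
Proof.
move=> H; elim=> [l2 h1 h2|[s t] l1 IH l2].
  by rewrite big_nil add0e lee_fin; exact: H.
rewrite cat_cons => h1 h2; rewrite big_cons /=.
set rest := (\sum_(p <- l1) _)%E.
have rest0 : (0 <= rest)%E.
  rewrite /rest big_seq; apply: sume_ge0 => -[u v] uv /=.
  apply: total_variation_ge0.
  move: h1; rewrite subintervals_consE => /and5P[_ _ _ /andP[+ _] _].
  by move=> /allP /(_ (u, v)); rewrite mem_cat uv => /(_ isT) /and3P[].
have key pi : itv_partition s t pi ->
    ((variation s t F pi)%:E + (rest + (oscillation F l2)%:E) <= eps%:E)%E.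
  move=> Hpi; have [p1 /eqP p2] := Hpi.
  have -> : ((variation s t F pi)%:E + (rest + (oscillation F l2)%:E) =
    rest + (oscillation F (zip (s :: pi) pi ++ l2))%:E)%E.
    by rewrite oscillation_cat EFinD oscillation_pairs// addeCA.
  apply: IH.
    rewrite subintervals_catCA catA -catA; exact: subintervals_refine h1 p1 p2.
  have -> : total_length (l1 ++ zip (s :: pi) pi ++ l2) =
      total_length ((s, t) :: l1 ++ l2); last by [].
    rewrite !total_length_cat (subintervals_pairs p1 p2).2.
    by rewrite [RHS]/total_length big_cons -/(total_length _) total_length_cat /=; ring.
have restfin : (rest + (oscillation F l2)%:E)%E \is a fin_num.
  have O0 : (0 <= (oscillation F l2)%:E)%E by rewrite lee_fin oscillation_ge0.
  rewrite ge0_fin_numE; last exact: adde_ge0.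
  apply: le_lt_trans (ltry eps).
  apply: IH.
    by move: h1; rewrite subintervals_consE => /and5P[].
  apply: le_lt_trans h2; rewrite /total_length big_cons /=.
  move: h1; rewrite subintervals_consE => /and5P[_ st _ _ _].
  by rewrite lerDr subr_ge0.
rewrite -addeA -leeBrDr//; apply: ge_ereal_sup => _ [_ [pi Hpi <-] <-].
by rewrite leeBrDr//; exact: key.
Qed.

End AcSeq.

Section AcVariation.
Variable R : realType.
Implicit Types (F : R -> R) (l : seq (R * R)).
Variables (a b : R) (F : R -> R).
Hypotheses (ab : a <= b) (acF : ac_seq a b F).

Lemma ac_total_variation_fin x y : a <= x -> x <= y -> y <= b ->
  total_variation x y F \is a fin_num.
Proof.
move=> ax xy yb.
suff : bounded_variation a b F.
  move=> H; apply/bounded_variationP => //.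
  apply: (@bounded_variationr _ a x) => //.
  exact: (@bounded_variationl _ a y b F (le_trans ax xy) yb).
apply/bounded_variationP => //.
(* With tolerance 1, each of the [N.+1] equal pieces, being shorter than [delta], has variation at
   most 1, and variations add up. *)
have [delta d0 H] := acF ltr01.
have [N HN] : exists N : nat, (b - a) / N.+1%:R < delta.
  exists (Num.bound ((b - a) / delta)).
  rewrite ltr_pdivrMr ?ltr0n// mulrC -ltr_pdivrMr//.
  apply: (lt_le_trans (archi_boundP _)); first by rewrite divr_ge0 ?subr_ge0// ltW.
  by rewrite ler_nat.
set h := (b - a) / N.+1%:R in HN.
have h0 : 0 <= h by rewrite divr_ge0 ?subr_ge0.
have bE : b = a + N.+1%:R * h by rewrite /h mulrC divfK ?pnatr_eq0// subrKC.
have mono k : (k <= N.+1)%N -> a + k%:R * h <= b.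
  by move=> kN; rewrite bE lerD2l ler_wpM2r// ler_nat.
suff key k : (k <= N.+1)%N -> total_variation a (a + k%:R * h) F \is a fin_num.
  by rewrite bE; exact: key.
elim: k => [_|k IH kN]; first by rewrite mul0r addr0 total_variationxx.
have st : a + k%:R * h <= a + k.+1%:R * h by rewrite lerD2l ler_wpM2r// ler_nat.
rewrite (@total_variationD _ a (a + k.+1%:R * h) (a + k%:R * h))//; last first.
  by rewrite lerDl mulr_ge0.
rewrite fin_numD IH ?(ltnW kN)//=.
have := @total_variation_small _ a b F _ _ H
  [:: (a + k%:R * h, a + k.+1%:R * h)] [::].
rewrite /= big_seq1 /oscillation big_nil adde0 /= => HH.
rewrite ge0_fin_numE ?total_variation_ge0//; apply: le_lt_trans (ltry 1).
apply: HH.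
  rewrite /subintervals /= st lerDl mulr_ge0// mono//.
rewrite /total_length big_seq1 /=.
apply: le_lt_trans HN; rewrite -natr1; lra.
Qed.

Definition variation_fun (x : R) := fine (total_variation a x F).

Lemma variation_funB x y : a <= x -> x <= y -> y <= b ->
  variation_fun y - variation_fun x = fine (total_variation x y F).
Proof.
move=> ax xy yb; rewrite /variation_fun.
rewrite (@total_variationD _ a y x)// fineD ?ac_total_variation_fin//; first by ring.
exact: le_trans yb.
Qed.

Lemma le_variation_funB x y : a <= x -> x <= y -> y <= b ->
  `|F y - F x| <= variation_fun y - variation_fun x.
Proof.
move=> ax xy yb; rewrite variation_funB// -lee_fin fineK ?ac_total_variation_fin//.
exact: total_variation_ge.
Qed.

Lemma ac_variation_fun : ac_seq a b variation_fun.
Proof.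
move=> eps e0; have [delta d0 H] := acF e0; exists delta => // l lab ld.
have := @total_variation_small _ a b F _ _ H l [::].
rewrite cats0 => /(_ lab ld); rewrite {1}/oscillation big_nil adde0.
suff -> : (\sum_(p <- l) total_variation p.1 p.2 F)%E =
    (oscillation variation_fun l)%:E by rewrite lee_fin.
rewrite /oscillation -sumEFin big_seq [RHS]big_seq; apply: eq_bigr => p pl.
move: lab => /andP[/allP /(_ _ pl) /and3P[ap pp pb] _].
rewrite ger0_norm variation_funB// ?fineK ?ac_total_variation_fin//.
exact/fine_ge0/total_variation_ge0.
Qed.

End AcVariation.

Lemma ac_seqB (R : realType) (a b : R) (F G : R -> R) :
  ac_seq a b F -> ac_seq a b G -> ac_seq a b (fun x => F x - G x).
Proof.
move=> acF acG eps e0; have e20 : 0 < eps / 2 by rewrite divr_gt0.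
have [d1 d10 H1] := acF _ e20; have [d2 d20 H2] := acG _ e20.
exists (Num.min d1 d2); first by rewrite lt_min d10.
move=> l lab; rewrite lt_min => /andP[l1 l2].
rewrite [eps]splitr; apply: le_trans (lerD (H1 _ lab l1) (H2 _ lab l2)).
rewrite /oscillation -big_split /=; apply: ler_sum => p _.
have -> : F p.2 - G p.2 - (F p.1 - G p.1) = (F p.2 - F p.1) - (G p.2 - G p.1).
  by ring.
exact: ler_normB.
Qed.

Section AcDensity.
Variable R : realType.
Notation mu := (@lebesgue_measure R).
Implicit Types (G : R -> R).

(** Projection onto [a, b]; composing with it extends a function controlled only on [a, b] to the
    whole line, keeping monotonicity and continuity. *)
Definition clamp (a b : R) (x : R) := Num.max a (Num.min b x).

Lemma clamp_ge (a b x : R) : a <= clamp a b x.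
Proof. by rewrite le_max lexx. Qed.

Lemma clamp_le (a b x : R) : a <= b -> clamp a b x <= b.
Proof. by move=> ab; rewrite ge_max ab ge_min lexx. Qed.

Lemma clamp_id (a b x : R) : a <= x -> x <= b -> clamp a b x = x.
Proof. by move=> ax xb; rewrite /clamp (min_idPr xb) (max_idPr ax). Qed.

Lemma clamp_homo (a b x y : R) : x <= y -> clamp a b x <= clamp a b y.
Proof.
move=> xy; rewrite /clamp ge_max !le_max lexx /=; apply/orP; right.
by rewrite le_min !ge_min lexx /= xy orbT.
Qed.

Lemma clamp_lip (a b x y : R) : a <= b -> x <= y ->
  clamp a b y - clamp a b x <= y - x.
Proof.
move=> ab xy; rewrite /clamp /Num.max /Num.min.
by case: ifP; case: ifP; case: ifP; case: ifP; lra.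
Qed.

Lemma ac_seq_cont a b G eps : ac_seq a b G -> 0 < eps ->
  exists2 delta, 0 < delta & forall x y, a <= x -> x <= y -> y <= b ->
    y - x < delta -> `|G y - G x| <= eps.
Proof.
move=> acG e0; have [d d0 H] := acG _ e0; exists d => // x y ax xy yb yx.
have := H [:: (x, y)]; rewrite /oscillation /total_length !big_seq1 /=; apply=> //.
by rewrite /subintervals /= ax xy yb.
Qed.

Variables (a b : R) (G : R -> R).
Hypotheses (ab : a < b) (ndG : forall x y, a <= x -> x <= y -> y <= b -> G x <= G y)
  (acG : ac_seq a b G).

Let Gc x := G (clamp a b x).

Let Gc_nd : {homo Gc : x y / x <= y}.
Proof.
by move=> x y xy; apply: ndG; rewrite ?clamp_ge ?clamp_le ?clamp_homo// ltW.
Qed.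

Let Gc_cont : continuous Gc.
Proof.
move=> x; apply/cvgrPdist_le => eps e0.
have [d d0 H] := ac_seq_cont acG e0.
near=> y.
have yx : `|x - y| < d by near: y; apply: cvgr_dist_lt.
have [xy|xy] := leP x y.
  rewrite distrC; apply: H; rewrite ?clamp_ge ?clamp_le ?clamp_homo// ?(ltW ab)//.
  apply: (le_lt_trans (clamp_lip (ltW ab) xy)); apply: le_lt_trans yx.
  by rewrite distrC ler_norm.
apply: H; rewrite ?clamp_ge ?clamp_le ?clamp_homo// ?(ltW ab) ?(ltW xy)//.
apply: (le_lt_trans (clamp_lip (ltW ab) (ltW xy))); apply: le_lt_trans yx.
by rewrite ler_norm.
Unshelve. all: by end_near. Qed.

Let Gcum : cumulative R R :=
  HB.pack Gc (isCumulative.Build R _ R Gc Gc_nd (right_continuousW Gc_cont)).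

Let nu0 : {measure set (measurableTypeR R) -> \bar R} := lebesgue_stieltjes_measure Gcum.

Let nu0_itv x y : x <= y -> nu0 `]x, y]%classic = (Gc y - Gc x)%:E.
Proof.
move=> xy; rewrite /nu0 /= /lebesgue_stieltjes_measure /measure_extension.
by rewrite measurable_mu_extE/= ?wlength_itv_bnd//; exact: is_ocitv.
Qed.

Let nu0_fin : (nu0 `]a, b]%classic < +oo)%E.
Proof. by rewrite nu0_itv ?ltry// ltW. Qed.

Let mab : measurable (`]a, b]%classic : set (measurableTypeR R)).
Proof. exact: measurable_itv. Qed.

Let nu : {finite_measure set (measurableTypeR R) -> \bar R} := mfrestr mab nu0_fin.

(** On a union of grid cells the Stieltjes and the Lebesgue measure are the oscillation and the
    total length of a list of subintervals, so [ac_seq] applies directly. *)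
Let cell_bound eps : 0 < eps -> exists2 delta, 0 < delta &
  forall N (P : pred 'I_N.+1), let h := (b - a) / N.+1%:R in
    let C (i : 'I_N.+1) := `]a + i%:R * h, a + i.+1%:R * h]%classic in
    (mu (\big[setU/set0]_(i < N.+1 | P i) C i) < delta%:E)%E ->
    (nu0 (\big[setU/set0]_(i < N.+1 | P i) C i) <= eps%:E)%E.
Proof.
move=> e0; have [d d0 H] := acG e0; exists d => // N P h C.
have h0 : 0 < h by rewrite divr_gt0 ?subr_gt0.
have Ch i j : (i <= j)%N -> a + i%:R * h <= a + j%:R * h.
  by move=> ij; rewrite lerD2l ler_wpM2r ?(ltW h0)// ler_nat.
have tC : trivIset P C.
  move=> i j _ _ [x []]; rewrite /C /= !in_itv/= => /andP[h1 h2] /andP[h3 h4].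
  apply: val_inj; apply/eqP; rewrite /= eqn_leq; apply/andP; split; rewrite leqNgt;
    apply/negP => /Ch hh; lra.
have mC i : measurable (C i : set (measurableTypeR R)) by exact: measurable_itv.
have muE : mu (\big[setU/set0]_(i < N.+1 | P i) C i) = (\sum_(i < N.+1 | P i) mu (C i))%E.
  by apply: measure_bigsetU_ord_cond.
rewrite muE.
rewrite (@measure_bigsetU_ord_cond _ _ _ nu0)//.
pose l := [seq (a + i%:R * h, a + i.+1%:R * h) | i : 'I_N.+1 <- enum P].
have -> : (\sum_(i < N.+1 | P i) mu (C i) = (total_length l)%:E)%E.
  rewrite /total_length big_map big_enum /= -sumEFin; apply: eq_bigr => i _.
  rewrite lebesgue_measure_itv/= lte_fin ltrD2l ltr_pM2r// ltr_nat ltnSn.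
  by rewrite EFinB.
have bE : b = a + N.+1%:R * h by rewrite /h mulrC divfK ?pnatr_eq0// subrKC.
have Ca (i : nat) : a <= a + i%:R * h by rewrite lerDl mulr_ge0// ltW.
have Cb i : (i <= N.+1)%N -> a + i%:R * h <= b by rewrite [X in _ <= X]bE; exact: Ch.
have -> : (\sum_(i < N.+1 | P i) nu0 (C i) = (oscillation G l)%:E)%E.
  rewrite /oscillation big_map big_enum /= -sumEFin; apply: eq_bigr => i _.
  rewrite nu0_itv ?Ch// /Gc !clamp_id ?Ca ?Cb//; last by rewrite ltnW.
  rewrite ger0_norm// subr_ge0 ndG ?Ca ?Cb ?Ch//.
rewrite lte_fin lee_fin; apply: H.
rewrite /subintervals; apply/andP; split.
  by apply/allP => _ /mapP[i _ ->] /=; rewrite Ca Ch// Cb.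
rewrite pairwise_map.
have := enum_uniq P; rewrite uniq_pairwise.
apply: sub_pairwise => i j /=; rewrite /separated /= -val_eqE /= neq_ltn.
by case/orP => /Ch ->; rewrite ?orbT.
Qed.

Let ac_open eps : 0 < eps -> exists2 delta, 0 < delta &
  forall U : set R, open U -> (mu U < delta%:E)%E -> (nu U <= eps%:E)%E.
Proof.
move=> e0; have [d d0 H] := cell_bound e0; exists d => // U oU Ud.
have mU : measurable (U : set (measurableTypeR R)) by exact: open_measurable.
pose hh N : R := (b - a) / N.+1%:R.
have h0 N : 0 < hh N by rewrite divr_gt0 ?subr_gt0.
(* Points of [U] not within one mesh size of the complement: the grid cell of such a point lies in
   [U]. So [W N] is covered by cells inside [U], and these sets exhaust the part of [U] in ]a,
   b]. *)
pose W N : set R := U `&` `]a, b]%classic `&` ~` (\bigcup_(y in ~` U) ball y (hh N)).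
have mW N : measurable (W N : set (measurableTypeR R)).
  apply: measurableI; first exact: measurableI.
  apply: measurableC; apply: open_measurable; apply: bigcup_open => y _.
  exact: ball_open.
have -> : nu U = nu0 (U `&` `]a, b]%classic) by [].
have WU : \bigcup_N W N = U `&` `]a, b]%classic.
  apply/seteqP; split => [x [N _ []]//|x [Ux xab]].
  have /nbhs_ballP[e /= e00 He] : nbhs x U by exact: open_nbhs_nbhs.
  exists (Num.bound ((b - a) / e)) => //; split => // -[y nUy xy].
  apply: nUy; apply: He; apply: ball_sym; apply: le_ball xy.
  rewrite /hh ler_pdivrMr ?ltr0n// mulrC -ler_pdivrMr// ltW//.
  apply: (lt_le_trans (archi_boundP _)); first by rewrite divr_ge0 ?subr_ge0// ltW.
  by rewrite ler_nat.
have cvgW : nu0 \o W @ \oo --> nu0 (\bigcup_N W N).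
  apply: nondecreasing_cvg_mu => //.
    by rewrite WU; exact: measurableI.
  apply/nondecreasing_seqP => N; apply/subsetPset => x [Ux xn]; split => // -[y nUy xy].
  apply: xn; exists y => //; apply: le_ball xy.
  by rewrite /hh ler_pM2l ?subr_gt0// lef_pV2 ?posrE ?ltr0n// ler_nat.
rewrite -WU -(cvg_lim _ cvgW)//; apply: lime_le; first by apply: cvgP cvgW.
near=> N => /=.
pose C (i : 'I_N.+1) := `]a + i%:R * hh N, a + i.+1%:R * hh N]%classic.
pose P (i : 'I_N.+1) := `[< C i `<=` U >].
have PU : \big[setU/set0]_(i < N.+1 | P i) C i `<=` U.
  apply: (big_ind (fun A => A `<=` U)) => //.
    by move=> A B AU BU x [/AU|/BU].
  by move=> i /asboolP.
have mP : measurable (\big[setU/set0]_(i < N.+1 | P i) C i : set (measurableTypeR R)).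
  by apply: bigsetU_measurable => i _; exact: measurable_itv.
have HN := H N P.
have /HN {}HN : (mu (\big[setU/set0]_(i < N.+1 | P i) C i) < d%:E)%E.
  by apply: le_lt_trans Ud; apply: le_measure; rewrite ?inE.
apply: le_trans HN; apply: le_measure; rewrite ?inE//.
move=> x [[Ux]]; rewrite /= in_itv/= => /andP[ax xb] xn.
have zN : (x - a) / hh N <= N.+1%:R.
  by rewrite ler_pdivrMr// /hh mulrC divfK ?pnatr_eq0// lerB.
have exm : exists m : nat, (x - a) / hh N <= m%:R by exists N.+1.
case: (ex_minnP exm) => -[|i] hi mini.
  by move: hi; rewrite ler_pdivrMr// mul0r subr_le0 leNgt ax.
have iN : (i < N.+1)%N by exact: mini.
have hi2 : i%:R < (x - a) / hh N.
  by rewrite ltNge; apply/negP => /mini; rewrite ltnn.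
have xCi : C (Ordinal iN) x.
  rewrite /C /= in_itv/=; move: hi hi2; rewrite ler_pdivrMr// ltr_pdivlMr//; lra.
rewrite (bigD1 (Ordinal iN))/=; first by left.
apply/asboolP => y; rewrite /C /= in_itv/= => /andP[y1 y2].
apply: contrapT => nUy; apply: xn; exists y => //.
move: xCi; rewrite /ball /= /C /= in_itv /= => /andP[x1 x2].
have : i.+1%:R * hh N = i%:R * hh N + hh N by rewrite -natr1; ring.
by move=> hE; rewrite ltr_norml; apply/andP; split; lra.
Unshelve. all: by end_near. Qed.

(** Outer regularity puts a null set inside open sets of arbitrarily small Lebesgue measure, where
    [ac_open] bounds [nu]. *)
Let nu_dom : nu `<< mu.
Proof.
apply/null_content_dominatesP => A mA muA; apply/eqP; rewrite eq_le measure_ge0 andbT.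
apply/lee_addgt0Pr => e e0; rewrite add0e.
have [d d0 H] := ac_open e0.
have [|U [oU AU UA]] := lebesgue_regularity_outer mA _ d0; first by rewrite muA.
apply: le_trans (H U oU _).
  by apply: le_measure => //; rewrite ?inE//; exact: open_measurable.
have mU := open_measurable oU.
have -> : U = A `|` (U `\` A) by rewrite setDUK.
apply: le_lt_trans UA.
rewrite -[leRHS]add0e -muA; apply: measureU2 => //; exact: measurableD.
Qed.

(** The density is the Radon-Nikodym derivative of the Stieltjes measure of [G] restricted to ]a,
    b]. *)
Lemma ac_nondecreasing_density : exists g : R -> R,
  [/\ forall x, 0 <= g x, mu.-integrable setT (EFin \o g) &
   forall x, a <= x -> x <= b -> G x - G a = \int[mu]_(t in `[a, x]) g t].
Proof.
have [f [f0 ffin fint fE]] := radon_nikodym_sigma_finite nu_dom.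
have fE' : f = EFin \o (fine \o f) by apply/funext => x /=; rewrite fineK.
exists (fine \o f); split.
- by move=> x /=; exact: fine_ge0.
- by rewrite -fE'.
move=> x ax xb.
rewrite /Rintegral -[LHS]/(fine (G x - G a)%:E); congr fine.
have -> : ((G x - G a)%:E = nu `]a, x]%classic)%E.
  rewrite /nu /= /mfrestr /mrestr setIidl; last first.
    by apply: subset_itvl; rewrite bnd_simp.
  by rewrite nu0_itv// /Gc !clamp_id// ltW.
rewrite fE// fE' integral_itv_obnd_cbnd//.
have /integrableP[mf _] := fint.
apply/measurable_EFinP/measurableT_comp => //.
by apply: measurable_funS mf => //.
Qed.

End AcDensity.

Section AcDerivative.
Variable R : realType.
Notation mu := (@lebesgue_measure R).

Lemma derivable_cstD (P : R -> R) (c x : R) : derivable P x 1 ->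
  derivable (fun y => c + P y) x 1 /\ derive1 (fun y => c + P y) x = derive1 P x.
Proof.
move=> dP.
have H : is_derive x (1:R) (cst c + P) (0 + 'D_1 P x).
  have h1 := @is_derive_cst R R R c x 1.
  have h2 := @derivableP R R R P x 1 dP.
  exact: (@is_deriveD R R R (cst c) P x 1 0 _ h1 h2).
rewrite !derive1E; split; first by case: H.
by rewrite -[fun y => _]/(cst c + P) (@derive_val _ _ _ _ _ _ _ H) add0r.
Qed.

(** [F] is the difference of its variation function [V] and of [V - F], both nondecreasing and
    absolutely continuous. The two densities subtract, and Lebesgue differentiation identifies the
    result with the derivative almost everywhere. *)
Lemma ac_density (a b : R) (F : R -> R) : a < b -> ac_seq a b F ->
  exists g : R -> R, [/\ mu.-integrable setT (EFin \o g),
   forall x, a <= x -> x <= b -> F x - F a = \int[mu]_(t in `[a, x]) g t &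
   {ae mu, forall x, a < x -> x < b -> derivable F x 1 /\ derive1 F x = g x}].
Proof.
move=> ab acF; set V := variation_fun a F.
have acV : ac_seq a b V by exact: ac_variation_fun (ltW ab) acF.
have VF x y (ax : a <= x) (xy : x <= y) (yb : y <= b) :=
  le_variation_funB (ltW ab) acF ax xy yb.
have [|g1 [g10 ig1 g1E]] := ac_nondecreasing_density ab _ acV.
  move=> x y ax xy yb; rewrite -subr_ge0; apply: le_trans (VF x y ax xy yb).
  exact: normr_ge0.
have [|g2 [g20 ig2 g2E]] := ac_nondecreasing_density ab _ (ac_seqB acV acF).
  move=> x y ax xy yb; have := VF x y ax xy yb; have := ler_norm (F y - F x).
  rewrite -/V; lra.
have iB : mu.-integrable setT (EFin \o (fun x => g1 x - g2 x)).
  have -> : EFin \o (fun x => g1 x - g2 x) = ((EFin \o g1) \- (EFin \o g2))%E by [].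
  exact: integrableB.
exists (fun x => g1 x - g2 x); split => //.
  move=> x ax xb; rewrite RintegralB//.
  - by rewrite -g1E// -g2E//; ring.
  - exact: integrableS ig1.
  - exact: integrableS ig2.
set g := fun x => g1 x - g2 x in iB *.
have FE x : a <= x -> x <= b -> F x = F a + \int[mu]_(t in `[a, x]) g t.
  move=> ax xb; rewrite RintegralB//; last 2 first.
  - exact: integrableS ig1.
  - exact: integrableS ig2.
  by rewrite -g1E// -g2E//; ring.
have loc : locally_integrable setT g.
  have := integrable_locally measurableT iB.
  by rewrite patch_setT.
have := @FTC1 R g (BLeft a) _ loc.
have ig y : mu.-integrable [set` Interval (BLeft a) (BRight y)] (EFin \o g).
  exact: integrableS iB.
move=> /(_ ig).
apply: filterS; first exact: (ae_filter_ringOfSetsType mu).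
move=> x Hx ax xb; have := Hx ax.
set P := fun y => \int[mu]_(t in `[a, y]) g t.
move=> [dP P'].
have nE : \forall y \near x, F a + P y = F y.
  near=> y; rewrite [RHS]FE//.
    by apply: ltW; near: y; exact: lt_nbhsr.
  by apply: ltW; near: y; exact: lt_nbhsl.
have [dP2 P2] := derivable_cstD (F a) dP.
split; first exact: (near_eq_derivable _ dP2).
by rewrite derive1E -(near_eq_derive _ nE) -derive1E P2.
Unshelve. all: by end_near. Qed.

End AcDerivative.

Lemma Rintegral_lin_comb (R : realType) (I : finType) (w : I -> R) (g : I -> R -> R)
    (D : set R) : measurable (D : set (measurableTypeR R)) ->
  (forall k, (@lebesgue_measure R).-integrable D (EFin \o g k)) ->
  \int[@lebesgue_measure R]_(x in D) (\sum_k w k * g k x) =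
  \sum_k w k * \int[@lebesgue_measure R]_(x in D) g k x.
Proof.
move=> mD ig.
suff key (s : seq I) : (@lebesgue_measure R).-integrable D
    (EFin \o (fun x => \sum_(k <- s) w k * g k x)) /\
    \int[@lebesgue_measure R]_(x in D) (\sum_(k <- s) w k * g k x) =
    \sum_(k <- s) w k * \int[@lebesgue_measure R]_(x in D) g k x.
  exact: (key (index_enum I)).2.
elim: s => [|k s [IH1 IH2]].
  have -> : (fun x => \sum_(j <- [::]) w j * g j x) = cst 0.
    by apply/funext => x; rewrite big_nil.
  rewrite big_nil Rintegral_cst// mul0r; split => //; exact: integrable0.
have ik : (@lebesgue_measure R).-integrable D (EFin \o (fun x => w k * g k x)).
  have -> : EFin \o (fun x => w k * g k x) = (fun x => (w k)%:E * (EFin \o g k) x)%E by [].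
  exact: integrableZl.
have -> : (fun x => \sum_(j <- k :: s) w j * g j x) =
    (fun x => w k * g k x + \sum_(j <- s) w j * g j x).
  by apply/funext => x; rewrite big_cons.
split; first exact: (integrableD mD ik IH1).
by rewrite RintegralD// IH2 RintegralZl// big_cons.
Qed.

Section CurveLength.
Variables (R : realType) (n : nat).
Notation mu := (@lebesgue_measure R).
Implicit Types (gamma : R -> 'rV[R[i]]_n).

Lemma complexifyK (x : 'rV[R]_(n + n)) : realify (complexify x) = x.
Proof.
apply/rowP => k; rewrite /realify /complexify.
case: (splitP k) => j kj.
  have -> : k = lshift n j by exact: val_inj.
  by rewrite row_mxEl !mxE.
have -> : k = rshift n j by exact: val_inj.
by rewrite row_mxEr !mxE.
Qed.

Lemma normr_realify_le (z : 'rV[R[i]]_n) k : `|realify z 0 k| <= enorm z.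
Proof.
rewrite /enorm -sqrtr_sqr ler_wsqrtr//.
have aux (j : 'I_n) : complex.Re (z 0 j) ^+ 2 + complex.Im (z 0 j) ^+ 2 <=
    \sum_j (complex.Re (z 0 j) ^+ 2 + complex.Im (z 0 j) ^+ 2).
  rewrite [leRHS](bigD1 j)//= lerDl; apply: sumr_ge0 => i _.
  by rewrite addr_ge0// sqr_ge0.
rewrite /realify; case: (splitP k) => j kj.
  have -> : k = lshift n j by exact: val_inj.
  rewrite row_mxEl !mxE; apply: le_trans (aux j); by rewrite lerDl sqr_ge0.
have -> : k = rshift n j by exact: val_inj.
rewrite row_mxEr !mxE; apply: le_trans (aux j); by rewrite lerDr sqr_ge0.
Qed.

Lemma ac_seq_coord gamma k : absolutely_continuous 0 1 gamma ->
  ac_seq 0 1 (fun t => realify (gamma t) 0 k).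
Proof.
move=> ac eps e0; have [d d0 H] := ac _ e0; exists d => // l /andP[H1 H2] ld.
pose s (i : 'I_(size l)) := (nth (0, 0) l i).1.
pose t (i : 'I_(size l)) := (nth (0, 0) l i).2.
have inl (i : 'I_(size l)) : nth (0, 0) l i \in l by exact: mem_nth.
have tl : \sum_i (t i - s i) = total_length l.
  by rewrite /total_length (big_nth (0, 0)) big_mkord.
have HH := H (size l) s t.
apply/ltW/(le_lt_trans _ (HH _ _ _)); last by rewrite tl.
- rewrite /oscillation (big_nth (0, 0)) big_mkord; apply: ler_sum => i _.
  apply: le_trans (normr_realify_le _ k).
  rewrite -/(s i) -/(t i) !mxE.
  by case: splitP => j _; rewrite !mxE raddfB.
- move=> i; move/allP: H1 => /(_ _ (inl i)) /and3P[]; by split.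
move=> i j ij; move/(pairwiseP (0, 0)): H2 => H2.
move: ij; rewrite -val_eqE neq_ltn => /orP[ij|ij].
  by have := H2 i j (ltn_ord i) (ltn_ord j) ij => /orP[]; [left|right].
by have := H2 j i (ltn_ord j) (ltn_ord i) ij => /orP[]; [right|left].
Qed.

Definition real_form (w : 'I_(n + n) -> R) (v : 'rV[R[i]]_n) :=
  \sum_k w k * realify v 0 k.

(* Over half-open intervals lower integrals are superadditive by disjointness. *)
Definition kappa_length_oc (Omega : set 'rV[R[i]]_n) gamma (s t : R) : \bar R :=
  (\int[mu]_(u in `]s, t])
     (kobayashi_royden Omega (gamma u) (velocity gamma u))%:E)%E.

Lemma lbound0_inf_ge0 (A : set R) : lbound A 0 -> 0 <= inf A.
Proof.
move=> A0; have [->|/set0P An0] := eqVneq A set0; first by rewrite inf0.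
exact: lb_le_inf.
Qed.

Lemma kobayashi_royden_ge0 (Omega : set 'rV[R[i]]_n) z v :
  0 <= kobayashi_royden Omega z v.
Proof.
by apply: lbound0_inf_ge0 => x [r [r0 _] <-]; rewrite invr_ge0 ltW.
Qed.

Lemma kappa_length_oc_ge0 (Omega : set 'rV[R[i]]_n) gamma s t :
  (0 <= kappa_length_oc Omega gamma s t)%E.
Proof. by apply: integral_ge0 => x _; rewrite lee_fin kobayashi_royden_ge0. Qed.

Lemma kappa_length_oc_le (Omega : set 'rV[R[i]]_n) gamma s t :
  (kappa_length_oc Omega gamma s t <= kappa_length Omega gamma s t)%E.
Proof.
pose D : set (measurableTypeR R) := `]s, t]%classic.
have mD : measurable D by exact: measurable_itv.
pose f x := (kobayashi_royden Omega (gamma x) (velocity gamma x))%:E.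
have f0 x : (0 <= f x)%E by rewrite lee_fin kobayashi_royden_ge0.
have := @lower_integral_setU _ _ R mu D set0 (`[s, t]%classic) f mD measurable0.
rewrite integral_set0 adde0 setI0 setU0; apply => //.
by move=> x; rewrite /D /= !in_itv /= => /andP[/ltW -> ->].
Qed.

Lemma kappa_length_oc_superadditive (Omega : set 'rV[R[i]]_n) gamma s t u :
  s <= t -> t <= u ->
  (kappa_length_oc Omega gamma s t + kappa_length_oc Omega gamma t u <=
   kappa_length_oc Omega gamma s u)%E.
Proof.
move=> st tu.
pose A : set (measurableTypeR R) := `]s, t]%classic.
pose B : set (measurableTypeR R) := `]t, u]%classic.
have mA : measurable A by exact: measurable_itv.
have mB : measurable B by exact: measurable_itv.
apply: (@lower_integral_setU _ _ R mu A B) => //.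
- apply/seteqP; split => // x []; rewrite /A /B /= !in_itv/=.
  by move=> /andP[_ h1] /andP[h2 _]; move: (le_lt_trans h1 h2); rewrite ltxx.
- move=> x []; rewrite /A /B /= !in_itv/= => /andP[h1 h2]; apply/andP; split=> //.
  + exact: le_trans tu.
  + exact: le_lt_trans h1.
- by move=> x _; rewrite lee_fin kobayashi_royden_ge0.
Qed.

(** The displacement of [real_form w] is the integral of its value at the velocity, which exists
    almost everywhere; a minorant of the metric proportional to that value therefore turns
    displacement into length. *)
Lemma kappa_length_oc_ge (Omega : set 'rV[R[i]]_n) gamma s t (c : R) w :
  absolutely_continuous 0 1 gamma -> 0 <= s -> s <= t -> t <= 1 -> 0 <= c ->
  (forall u v, s <= u -> u <= t ->
    c * `|real_form w v| <= kobayashi_royden Omega (gamma u) v) ->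
  ((c * `|real_form w (gamma t) - real_form w (gamma s)|)%:E <=
   kappa_length_oc Omega gamma s t)%E.
Proof.
move=> ac s0 st t1 c0 H.
have Hk k := ac_density ltr01 (ac_seq_coord k ac).
pose g k : R -> R := projT1 (cid (Hk k)).
have [ig gE] : (forall k, mu.-integrable setT (EFin \o g k)) /\
  (forall k x, 0 <= x -> x <= 1 -> realify (gamma x) 0 k - realify (gamma 0) 0 k =
     \int[mu]_(t in `[0, x]) g k t).
  by split => k; rewrite /g; case: cid => gk [].
have aeg : {ae mu, forall x, forall k, 0 < x -> x < 1 ->
    derivable (fun t => realify (gamma t) 0 k) x 1 /\
    derive1 (fun t => realify (gamma t) 0 k) x = g k x}.
  have FF := ae_filter_ringOfSetsType mu.
  apply: filter_forall => k; rewrite /g; by case: cid => gk [].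
pose G x := \sum_k w k * g k x.
have iG : mu.-integrable setT (EFin \o G).
  have -> : EFin \o G = (fun x => \sum_k ((w k)%:E * (EFin \o g k) x))%E.
    by apply/funext => x; rewrite /G /= -sumEFin.
  apply: integrable_sum => // k _; exact: integrableZl.
have GE : real_form w (gamma t) - real_form w (gamma s) = \int[mu]_(x in `]s, t]) G x.
  have key k : realify (gamma t) 0 k - realify (gamma s) 0 k =
      \int[mu]_(x in `]s, t]) g k x.
    rewrite -(@Rintegral_itvB _ _ (BLeft 0) (BRight t) s) ?bnd_simp//; last first.
      exact: integrableS (ig k).
    rewrite -!gE//; first by ring.
    - exact: le_trans st t1.
    - exact: le_trans s0 st.
  rewrite /G Rintegral_lin_comb => [|//|k]; last exact: integrableS (ig k).
  rewrite /real_form -sumrB; apply: eq_bigr => k _; by rewrite -key; ring.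
rewrite GE.
have iGst : mu.-integrable `]s, t] (EFin \o G) by exact: integrableS iG.
pose D : set (measurableTypeR R) := `]s, t]%classic.
have mG : measurable_fun D G.
  by apply/measurable_EFinP; have /integrableP[] := iGst.
have mcG : measurable_fun D (fun x => (c * `|G x|)%:E).
  apply/measurable_EFinP; apply: measurable_funM => //.
  exact: measurableT_comp.
apply: (@le_trans _ _ (\int[mu]_(x in D) (c * `|G x|)%:E)%E).
  have iabs : mu.-integrable D (EFin \o (fun x => `|G x|)) by exact: integrable_norm.
  have icG : mu.-integrable D (EFin \o (fun x => c * `|G x|)).
    exact: (@integrableZl _ _ R mu D (measurable_itv _) c (EFin \o (fun x => `|G x|)) iabs).
  have mD : measurable D by exact: measurable_itv.
  have fi := integrable_fin_num mD icG.
  rewrite -[X in (_ <= X)%E]fineK; last by exact: fi.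
  rewrite lee_fin -[X in _ <= X]/(\int[mu]_(x in D) (c * `|G x|)).
  rewrite RintegralZl//.
  by rewrite ler_wpM2l//; exact: le_normr_Rintegral.
have [N [mN muN subN]] := aeg.
pose N' := N `|` [set 0] `|` [set 1 : R].
have mN' : measurable (N' : set (measurableTypeR R)).
  by apply: measurableU; first apply: measurableU.
have muN' : mu N' = 0.
  have m1 (x : R) : mu [set x] = 0%E by exact: lebesgue_measure_set1.
  have mN0 : measurable (N `|` [set 0] : set (measurableTypeR R)) by exact: measurableU.
  apply/eqP; rewrite eq_le measure_ge0 andbT.
  apply: (le_trans (measureU2 mu mN0 (measurable_set1 1))).
  rewrite [X in (_ + X)%E]m1 adde0.
  apply: (le_trans (measureU2 mu mN (measurable_set1 0))).
  rewrite [X in (_ + X)%E]m1 adde0.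
  have := lexx (0 : \bar R); rewrite -{1}muN; exact.
(* Comparison with a lower integral is made at every point, so the minorant is set to 0 on the null
   set where the velocity may fail to exist or differ from the density. *)
pose h x : \bar R := ((fun x => (c * `|G x|)%:E) \_ (~` N')) x.
have h0 x : (0 <= h x)%E.
  by rewrite /h /patch; case: ifP => // _; rewrite lee_fin mulr_ge0.
have -> : (\int[mu]_(x in D) (c * `|G x|)%:E = \int[mu]_(x in D) h x)%E.
  apply: ge0_ae_eq_integral => //; first exact: measurable_itv.
  - have mCN' : measurable (~` N' : set (measurableTypeR R)) by exact: measurableC.
    have mD : measurable D by exact: measurable_itv.
    have mr := (measurable_restrict (fun x => (c * `|G x|)%:E) mCN' mD).1.
    by apply: mr; apply: measurable_funS mcG.
  - by move=> x _; rewrite lee_fin mulr_ge0.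
  exists N'; split => // x /= nh; apply: contrapT => nN; apply: nh => _.
  by rewrite /h /patch mem_set.
apply: ge0_le_lower_integral => // x; rewrite /D /= in_itv/= => /andP[/ltW sx xt].
rewrite /h /patch; case: ifPn => [/set_mem xN|_]; last first.
  rewrite lee_fin.
  apply: le_trans (H x (velocity gamma x) sx xt).
  by rewrite mulr_ge0.
have x0 : 0 < x.
  rewrite lt_neqAle (le_trans s0 sx) andbT eq_sym; apply/eqP => x0; apply: xN.
  by left; right.
have x1 : x < 1.
  rewrite lt_neqAle (le_trans xt t1) andbT; apply/eqP => x1; apply: xN.
  by right.
have {}xN : forall k, 0 < x -> x < 1 ->
    derivable (fun t => realify (gamma t) 0 k) x 1 /\
    derive1 (fun t => realify (gamma t) 0 k) x = g k x.
  by apply: contrapT => nx; apply: xN; left; left; apply: subN.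
rewrite lee_fin; apply: le_trans (H x (velocity gamma x) sx xt).
rewrite ler_wpM2l// /real_form (_ : \sum_k _ = G x)//; apply: eq_bigr => k _.
congr (_ * _); rewrite /velocity complexifyK derive1E derive_mx; last first.
  apply/derivable_mxP => i j; rewrite ord1.
  by have [] := xN j x0 x1.
by rewrite mxE -derive1E; have [_] := xN k x0 x1.
Qed.

End CurveLength.

(** * A minimum principle for holomorphic functions *)

Section Bisection.
Variable R : realType.
Variables (Phi : R -> R -> R -> R -> R) (a b c d : R).
Hypotheses (ab : a <= b) (cd : c <= d).
Hypothesis PhiDx : forall x1 x2 x3 y1 y2, a <= x1 -> x1 <= x2 -> x2 <= x3 ->
  x3 <= b -> c <= y1 -> y1 <= y2 -> y2 <= d ->
  Phi x1 x3 y1 y2 = Phi x1 x2 y1 y2 + Phi x2 x3 y1 y2.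
Hypothesis PhiDy : forall x1 x2 y1 y2 y3, a <= x1 -> x1 <= x2 -> x2 <= b ->
  c <= y1 -> y1 <= y2 -> y2 <= y3 -> y3 <= d ->
  Phi x1 x2 y1 y3 = Phi x1 x2 y1 y2 + Phi x1 x2 y2 y3.
Hypothesis Phi_small : forall x y, a <= x -> x <= b -> c <= y -> y <= d ->
  forall eps, 0 < eps -> exists2 delta, 0 < delta &
  forall x1 x2 y1 y2, a <= x1 -> x1 <= x -> x <= x2 -> x2 <= b ->
    c <= y1 -> y1 <= y -> y <= y2 -> y2 <= d ->
    x2 - x1 < delta -> y2 - y1 < delta ->
    `|Phi x1 x2 y1 y2| <= eps * ((x2 - x1) + (y2 - y1)) ^+ 2.

Let w k := (b - a) / 2 ^+ k.
Let h k := (d - c) / 2 ^+ k.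

Let wS k : w k = w k.+1 + w k.+1.
Proof. by rewrite /w exprS; field. Qed.

Let hS k : h k = h k.+1 + h k.+1.
Proof. by rewrite /h exprS; field. Qed.

Let w0 k : 0 <= w k. Proof. by rewrite divr_ge0 ?subr_ge0 ?exprn_ge0. Qed.
Let h0 k : 0 <= h k. Proof. by rewrite divr_ge0 ?subr_ge0 ?exprn_ge0. Qed.

Let good M k (p : R * R) := [/\ a <= p.1, p.1 + w k <= b, c <= p.2, p.2 + h k <= d &
  M / 4 ^+ k <= `|Phi p.1 (p.1 + w k) p.2 (p.2 + h k)|].

Let next k (p q : R * R) := [/\ p.1 <= q.1, q.1 + w k.+1 <= p.1 + w k,
  p.2 <= q.2 & q.2 + h k.+1 <= p.2 + h k].

Let step M k p : good M k p -> exists q, good M k.+1 q /\ next k p q.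
Proof.
case: p => x y [/= ax xb cy yd HM].
have w1 := w0 k.+1; have h1 := h0 k.+1; have wk := wS k; have hk := hS k.
set x' := x + w k.+1; set y' := y + h k.+1.
have E : Phi x (x + w k) y (y + h k) =
  Phi x x' y y' + Phi x x' y' (y' + h k.+1) +
  (Phi x' (x' + w k.+1) y y' + Phi x' (x' + w k.+1) y' (y' + h k.+1)).
  rewrite (_ : x + w k = x' + w k.+1); last by rewrite /x' wk addrA.
  rewrite (_ : y + h k = y' + h k.+1); last by rewrite /y' hk addrA.
  by rewrite (@PhiDx x x') -?PhiDy// /x' /y'; lra.
have M4 : M / 4 ^+ k = M / 4 ^+ k.+1 + M / 4 ^+ k.+1 + (M / 4 ^+ k.+1 + M / 4 ^+ k.+1).
  by rewrite exprS; field.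
have := HM; rewrite E M4 => {}HM.
have [H1|H1] := leP (M / 4 ^+ k.+1) `|Phi x x' y y'|.
  exists (x, y); split; split => //=; lra.
have [H2|H2] := leP (M / 4 ^+ k.+1) `|Phi x x' y' (y' + h k.+1)|.
  exists (x, y'); split; split => //=; rewrite /y'; lra.
have [H3|H3] := leP (M / 4 ^+ k.+1) `|Phi x' (x' + w k.+1) y y'|.
  exists (x', y); split; split => //=; rewrite /x'; lra.
have [H4|H4] := leP (M / 4 ^+ k.+1) `|Phi x' (x' + w k.+1) y' (y' + h k.+1)|.
  exists (x', y'); split; split => //=; rewrite /x' /y'; lra.
exfalso; move: HM; apply/negP; rewrite -ltNge.
apply: (le_lt_trans (ler_normD _ _)); apply: ltrD;
  by apply: (le_lt_trans (ler_normD _ _)); apply: ltrD.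
Qed.

(** Goursat's argument for an additive function of rectangles: if it were nonzero, one of the four
    quarters would keep at least a quarter of the absolute value at each stage. This contradicts
    [Phi_small] at the common point of the nested rectangles. *)
Lemma bisection_eq0 : Phi a b c d = 0.
Proof.
apply/eqP/negPn/negP => Phi0.
pose M := `|Phi a b c d|; have M0 : 0 < M by rewrite normr_gt0.
pose s := fix s k := if k is k'.+1 then
  xget (s k') [set q | good M k'.+1 q /\ next k' (s k') q] else (a, c).
have gs k : good M k (s k).
  elim: k => [|k IH].
    by split => //=; rewrite /w /h expr0 ?divr1 ?subrKC.
  have [q Hq] := step IH.
  by have [] := @xgetI _ (s k) [set q | good M k.+1 q /\ next k (s k) q] q Hq.
have ns k : next k (s k) (s k.+1).
  have [q Hq] := step (gs k).
  by have [] := @xgetI _ (s k) [set q | good M k.+1 q /\ next k (s k) q] q Hq.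
have mx j k : (s j).1 <= (s (j + k)%N).1 /\ (s (j + k)%N).1 + w (j + k) <= (s j).1 + w j /\
   (s j).2 <= (s (j + k)%N).2 /\ (s (j + k)%N).2 + h (j + k) <= (s j).2 + h j.
  elim: k => [|k [H1 [H2 [H3 H4]]]]; first by rewrite addn0 !lexx.
  by rewrite addnS; have [] := ns (j + k)%N; lra.
have ub1 j k : (s k).1 <= (s j).1 + w j.
  have [jk|kj] := leqP j k.
    have := mx j (k - j)%N; rewrite subnKC// => -[_ [H _]].
    by have := w0 k; lra.
  have := mx k (j - k)%N; rewrite subnKC ?(ltnW kj)// => -[H [_ _]].
  by have := w0 j; lra.
have ub2 j k : (s k).2 <= (s j).2 + h j.
  have [jk|kj] := leqP j k.
    have := mx j (k - j)%N; rewrite subnKC// => -[_ [_ [_ H]]].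
    by have := h0 k; lra.
  have := mx k (j - k)%N; rewrite subnKC ?(ltnW kj)// => -[_ [_ [H _]]].
  by have := h0 j; lra.
pose X := [set (s k).1 | k in [set: nat]]; pose Y := [set (s k).2 | k in [set: nat]].
have hsX : has_sup X.
  by split; [exists (s 0%N).1; exists 0%N|exists ((s 0%N).1 + w 0%N) => _ [k _ <-]].
have hsY : has_sup Y.
  by split; [exists (s 0%N).2; exists 0%N|exists ((s 0%N).2 + h 0%N) => _ [k _ <-]].
have X1 k : (s k).1 <= sup X by apply: sup_ubound; [case: hsX|exists k].
have Y1 k : (s k).2 <= sup Y by apply: sup_ubound; [case: hsY|exists k].
have X2 k : sup X <= (s k).1 + w k by apply: sup_le_ub; [case: hsX|move=> _ [j _ <-]].
have Y2 k : sup Y <= (s k).2 + h k by apply: sup_le_ub; [case: hsY|move=> _ [j _ <-]].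
(* At stage k the sum of the two sides has square [(b - a + (d - c)) ^+ 2 / 4 ^+ k], so this
   constant makes the bound smaller than [M / 4 ^+ k]; the added 1 covers a rectangle reduced to a
   point. *)
have e0 : 0 < M / (2 * ((b - a + (d - c)) ^+ 2 + 1)).
  by rewrite divr_gt0// mulr_gt0// ltr_wpDl// sqr_ge0.
have [|||| delta d0 H] := @Phi_small (sup X) (sup Y) _ _ _ _ _ e0.
- exact: X1 0%N.
- by apply: le_trans (X2 0%N) _; rewrite /w expr0 divr1 subrKC.
- exact: Y1 0%N.
- by apply: le_trans (Y2 0%N) _; rewrite /h expr0 divr1 subrKC.
have [k kd] : exists k : nat, b - a + (d - c) < delta * 2 ^+ k.
  exists (Num.bound ((b - a + (d - c)) / delta)).
  rewrite mulrC -ltr_pdivrMr//; apply: (lt_le_trans (archi_boundP _)).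
    by apply: divr_ge0; [apply: addr_ge0; rewrite subr_ge0|exact: ltW].
  by rewrite -natrX ler_nat ltnW// ltn_expl.
have ab' : a <= b := ab.
have cd' : c <= d := cd.
have kw : w k < delta by rewrite ltr_pdivrMr ?exprn_gt0//; lra.
have kh : h k < delta by rewrite ltr_pdivrMr ?exprn_gt0//; lra.
have [G1 G2 G3 G4 G5] := gs k.
have := H (s k).1 ((s k).1 + w k) (s k).2 ((s k).2 + h k) G1 (X1 k) (X2 k) G2 G3 (Y1 k) (Y2 k) G4.
rewrite [_ + w k - _]addrC addKr [_ + h k - _]addrC addKr => /(_ kw kh).
rewrite leNgt => /negP; apply; apply: lt_le_trans G5.
rewrite /w /h -mulrDl expr_div_n -exprM mulnC exprM (_ : 2 ^+ 2 = 4 :> R); last by rewrite expr2; ring.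
rewrite mulrA ltr_pM2r ?invr_gt0 ?exprn_gt0// mulrAC ltr_pdivrMr; last first.
  by rewrite mulr_gt0// ltr_wpDl// sqr_ge0.
rewrite ltr_pM2l//; have := sqr_ge0 (b - a + (d - c)); lra.
Qed.

End Bisection.

Lemma clamp_dist (R : realType) (a b x y : R) : a <= b ->
  `|clamp a b y - clamp a b x| <= `|y - x|.
Proof.
move=> ab; wlog xy : x y / x <= y.
  by move=> H; case: (leP x y) => [/H//|/ltW /H]; rewrite distrC [leRHS]distrC.
by rewrite !ger0_norm ?subr_ge0// ?clamp_homo//; exact: clamp_lip.
Qed.

Section IntervalIntegral.
Variable R : realType.
Notation mu := (@lebesgue_measure R).
Implicit Types (f g : R -> R).

Definition cont_on f (c d : R) := forall x, c <= x -> x <= d -> forall eps, 0 < eps ->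
  exists2 delta, 0 < delta & forall x', c <= x' -> x' <= d -> `|x' - x| < delta ->
    `|f x' - f x| <= eps.

Definition itv_int f (c d : R) : R := \int[mu]_(x in `[c, d]) f x.

Lemma cont_on_sub f c d c' d' : c <= c' -> d' <= d -> cont_on f c d -> cont_on f c' d'.
Proof.
move=> cc dd H x cx xd eps e0.
have [||delta d0 Hd] := H x _ _ _ e0; [exact: le_trans cx|exact: le_trans xd _|].
exists delta => // x' cx' xd'; apply: Hd; [exact: le_trans cx'|exact: le_trans xd' _].
Qed.

Lemma cont_on_integrable f c d : c <= d -> cont_on f c d -> mu.-integrable `[c, d] (EFin \o f).
Proof.
move=> cd H.
have cf : continuous (f \o clamp c d).
  move=> x; apply/cvgrPdist_le => eps e0.
  have [||delta d0 Hd] := H (clamp c d x) _ _ _ e0; rewrite ?clamp_ge ?clamp_le//.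
  near=> y; rewrite distrC /=; apply: Hd; rewrite ?clamp_ge ?clamp_le//.
  have yx : `|x - y| < delta by near: y; apply: cvgr_dist_lt.
  apply: le_lt_trans yx.
  by rewrite [leRHS]distrC; exact: clamp_dist.
have : mu.-integrable `[c, d] (EFin \o (f \o clamp c d)).
  apply: continuous_compact_integrable; first exact: segment_compact.
  exact: continuous_subspaceT.
apply: eq_integrable => // x; rewrite inE /= in_itv/= => /andP[cx xd].
by rewrite clamp_id.
Unshelve. all: by end_near. Qed.

Lemma itv_int_split f c m d : c <= m -> m <= d -> cont_on f c d ->
  itv_int f c d = itv_int f c m + itv_int f m d.
Proof.
move=> cm md H; have cd := le_trans cm md.
have i1 := cont_on_integrable cd H.
have := @Rintegral_itvB R f (BLeft c) (BRight d) m i1.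
rewrite !bnd_simp => /(_ cm md) E.
have i2 : mu.-integrable `]m, d] (EFin \o f).
  apply: integrableS i1 => //; apply: subset_itvr; by rewrite bnd_simp.
by rewrite /itv_int -(Rintegral_itv_obnd_cbnd i2) -E; ring.
Qed.

Lemma itv_int_approx f c d k eta : c <= d -> cont_on f c d ->
  (forall x, c <= x -> x <= d -> `|f x - k| <= eta) ->
  `|itv_int f c d - k * (d - c)| <= eta * (d - c).
Proof.
move=> cd H B.
have i1 := cont_on_integrable cd H.
have mD : measurable (`[c, d]%classic : set (measurableTypeR R)) by exact: measurable_itv.
have cst_int (r : R) : \int[mu]_(x in `[c, d]) r = r * (d - c).
  rewrite Rintegral_cst//; congr (_ * _).
  transitivity (fine (lebesgue_measure (`[c, d]%classic : set R))); first by [].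
  rewrite lebesgue_measure_itv/= lte_fin.
  by case: ltrP => // dc /=; apply/esym/eqP; rewrite subr_eq0 eq_le cd dc.
have ic (r : R) : mu.-integrable `[c, d] (EFin \o cst r).
  apply: cont_on_integrable => // x _ _ eps e0; exists 1 => // x' _ _ _.
  by rewrite subrr normr0 ltW.
have lo : (k - eta) * (d - c) <= itv_int f c d.
  rewrite -cst_int; apply: le_Rintegral => //; first exact: ic.
  move=> x /=; rewrite in_itv/= => /andP[cx xd].
  by have := B x cx xd; rewrite ler_norml => /andP[]; lra.
have hi : itv_int f c d <= (k + eta) * (d - c).
  rewrite -cst_int; apply: le_Rintegral => //; first exact: ic.
  move=> x /=; rewrite in_itv/= => /andP[cx xd].
  by have := B x cx xd; rewrite ler_norml => /andP[]; lra.
by rewrite ler_norml; lra.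
Qed.

Lemma itv_intB f g c d : c <= d -> cont_on f c d -> cont_on g c d ->
  itv_int f c d - itv_int g c d = itv_int (fun x => f x - g x) c d.
Proof.
move=> cd Hf Hg; rewrite /itv_int RintegralB//; exact: cont_on_integrable.
Qed.

Lemma cont_onB f g c d : cont_on f c d -> cont_on g c d -> cont_on (fun x => f x - g x) c d.
Proof.
move=> Hf Hg x cx xd eps e0; have e20 : 0 < eps / 2 by rewrite divr_gt0.
have [d1 d10 H1] := Hf x cx xd _ e20; have [d2 d20 H2] := Hg x cx xd _ e20.
exists (Num.min d1 d2); first by rewrite lt_min d10.
move=> x' cx' xd'; rewrite lt_min => /andP[h1 h2].
have -> : f x' - g x' - (f x - g x) = (f x' - f x) - (g x' - g x) by ring.
by rewrite [eps]splitr; apply: le_trans (ler_normB _ _) (lerD (H1 _ _ _ _) (H2 _ _ _ _)).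
Qed.

End IntervalIntegral.

Section RealGoursat.
Variable R : realType.
Variables (U V : R -> R -> R) (a b c d : R).
Hypotheses (ab : a <= b) (cd : c <= d).
(* First-order expansions with [U_x = V_y], that is, [div (U, -V) = 0]. *)
Hypothesis expansion : forall x y, a <= x -> x <= b -> c <= y -> y <= d ->
  exists A B C : R, forall eps, 0 < eps -> exists2 delta, 0 < delta &
  forall x' y', a <= x' -> x' <= b -> c <= y' -> y' <= d ->
    `|x' - x| < delta -> `|y' - y| < delta ->
    `|U x' y' - U x y - A * (x' - x) - B * (y' - y)| <= eps * (`|x' - x| + `|y' - y|) /\
    `|V x' y' - V x y - C * (x' - x) - A * (y' - y)| <= eps * (`|x' - x| + `|y' - y|).

Let cont_of_expansion (A B X Y u eps : R) : 0 < eps ->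
  `|u - A * X - B * Y| <= 1 * (`|X| + `|Y|) ->
  `|X| + `|Y| < eps / (1 + `|A| + `|B|) -> `|u| <= eps.
Proof.
move=> e0 H1 H2.
have -> : u = (u - A * X - B * Y) + A * X + B * Y by ring.
have hAX : `|A * X| <= `|A| * (`|X| + `|Y|) by rewrite normrM ler_wpM2l// lerDl.
have hBY : `|B * Y| <= `|B| * (`|X| + `|Y|) by rewrite normrM ler_wpM2l// lerDr.
have p0 : 0 < 1 + `|A| + `|B| by rewrite -addrA ltr_pwDl// addr_ge0.
move: H2; rewrite ltr_pdivlMr// => H2.
have := ler_normD (u - A * X - B * Y + A * X) (B * Y).
have := ler_normD (u - A * X - B * Y) (A * X).
nra.
Qed.

Lemma real_goursat_cont x : a <= x -> x <= b -> cont_on (U x) c d.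
Proof.
move=> ax xb y cy yd eps e0.
have [A [B [C H]]] := expansion ax xb cy yd.
have [delta d0 Hd] := H 1 ltr01.
have p0 : 0 < 1 + `|A| + `|B| by rewrite -addrA ltr_pwDl// addr_ge0.
exists (Num.min delta (eps / (1 + `|A| + `|B|))).
  by rewrite lt_min d0 divr_gt0.
move=> y' cy' yd'; rewrite lt_min => /andP[h1 h2].
have [|H1 _] := Hd x y' ax xb cy' yd' _ h1; first by rewrite subrr normr0.
by apply: cont_of_expansion H1 _ => //; rewrite subrr normr0 add0r.
Qed.

Let contV y : c <= y -> y <= d -> cont_on (fun x => V x y) a b.
Proof.
move=> cy yd x ax xb eps e0.
have [A [B [C H]]] := expansion ax xb cy yd.
have [delta d0 Hd] := H 1 ltr01.
have p0 : 0 < 1 + `|C| + `|A| by rewrite -addrA ltr_pwDl// addr_ge0.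
exists (Num.min delta (eps / (1 + `|C| + `|A|))).
  by rewrite lt_min d0 divr_gt0.
move=> x' ax' xb'; rewrite lt_min => /andP[h1 h2].
have [|_ H1] := Hd x' y ax' xb' cy yd h1; first by rewrite subrr normr0.
by apply: cont_of_expansion H1 _ => //; rewrite subrr normr0 addr0.
Qed.

Let near_le (u v w z : R) : u <= v -> v <= w -> u <= z -> z <= w -> `|z - v| <= w - u.
Proof. by move=> *; rewrite ler_norml; apply/andP; split; lra. Qed.

Let sum_leU (u v w k m : R) : u <= w -> k <= m -> (w - v) + k + (v - u) + k <= 2 * ((w - u) + m).
Proof. lra. Qed.

Let sum_leV (u v w k m : R) : u <= w -> k <= m -> k + (w - v) + k + (v - u) <= 2 * (m + (w - u)).
Proof. lra. Qed.

Let combine (eps D p q X1 Y1 X2 Y2 : R) : 0 < eps -> `|p| <= eps / 2 * (X1 + Y1) ->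
  `|q| <= eps / 2 * (X2 + Y2) -> X1 + Y1 + X2 + Y2 <= 2 * D -> `|p - q| <= eps * D.
Proof. move=> e0 hp hq hD; apply: (le_trans (ler_normB _ _)); nra. Qed.

Let Phi x1 x2 y1 y2 := itv_int (U x2) y1 y2 - itv_int (U x1) y1 y2 -
  (itv_int (fun x => V x y2) x1 x2 - itv_int (fun x => V x y1) x1 x2).

(** [Phi] is the flux of (U, -V) through the boundary of a rectangle. Near a point the horizontal
    increment of [U] and the vertical increment of [V] both contribute [A] times the area and
    cancel, up to [eps] times the square of the sum of the sides. Only differentiability at each
    point enters, not continuity of the partial derivatives. *)
Lemma real_goursat : itv_int (U b) c d - itv_int (U a) c d =
  itv_int (fun x => V x d) a b - itv_int (fun x => V x c) a b.
Proof.
apply/eqP; rewrite -subr_eq0; apply/eqP.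
apply: (@bisection_eq0 R Phi a b c d ab cd).
- move=> x1 x2 x3 y1 y2 a1 x12 x23 x3b c1 y12 y2d; rewrite /Phi.
  have cy2 := le_trans c1 y12; have y1d := le_trans y12 y2d.
  rewrite (@itv_int_split _ (fun x => V x y2) x1 x2 x3)//; last first.
    by apply: (@cont_on_sub _ _ a b) => //; exact: contV.
  rewrite (@itv_int_split _ (fun x => V x y1) x1 x2 x3)//; last first.
    by apply: (@cont_on_sub _ _ a b) => //; exact: contV.
  by ring.
- move=> x1 x2 y1 y2 y3 a1 x12 x2b c1 y12 y23 y3d; rewrite /Phi.
  have ax2 := le_trans a1 x12; have x1b := le_trans x12 x2b.
  rewrite (@itv_int_split _ (U x2) y1 y2 y3)//; last first.
    by apply: (@cont_on_sub _ _ c d) => //; exact: real_goursat_cont.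
  rewrite (@itv_int_split _ (U x1) y1 y2 y3)//; last first.
    by apply: (@cont_on_sub _ _ c d) => //; exact: real_goursat_cont.
  by ring.
move=> x y ax xb cy yd eps e0.
have [A [B [C H]]] := expansion ax xb cy yd.
have e20 : 0 < eps / 2 by rewrite divr_gt0.
have [delta d0 Hd] := H _ e20; exists delta => //.
move=> x1 x2 y1 y2 a1 x1x xx2 x2b c1 y1y yy2 y2d dx dy.
have x12 := le_trans x1x xx2; have y12 := le_trans y1y yy2.
have nx1 : `|x1 - x| = x - x1 by rewrite distrC ger0_norm ?subr_ge0.
have nx2 : `|x2 - x| = x2 - x by rewrite ger0_norm ?subr_ge0.
have ny1 : `|y1 - y| = y - y1 by rewrite distrC ger0_norm ?subr_ge0.
have ny2 : `|y2 - y| = y2 - y by rewrite ger0_norm ?subr_ge0.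
set D := (x2 - x1) + (y2 - y1).
have ax2 := le_trans a1 x12; have x1b := le_trans x12 x2b.
have cy2 := le_trans c1 y12; have y1d := le_trans y12 y2d.
have bU : `|itv_int (U x2) y1 y2 - itv_int (U x1) y1 y2 - A * (x2 - x1) * (y2 - y1)| <=
    eps * D * (y2 - y1).
  have c2 : cont_on (U x2) y1 y2.
    by apply: (@cont_on_sub _ _ c d) => //; exact: real_goursat_cont.
  have c1' : cont_on (U x1) y1 y2.
    by apply: (@cont_on_sub _ _ c d) => //; exact: real_goursat_cont.
  rewrite itv_intB//; apply: itv_int_approx => //; first exact: cont_onB.
  move=> z y1z zy2.
  have nz := near_le y1y yy2 y1z zy2; have zd := le_lt_trans nz dy.
  have cz := le_trans c1 y1z; have zd' := le_trans zy2 y2d.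
  have [P2 _] := Hd x2 z ax2 x2b cz zd' (le_lt_trans (near_le x1x xx2 x12 (lexx _)) dx) zd.
  have [P1 _] := Hd x1 z a1 x1b cz zd' (le_lt_trans (near_le x1x xx2 (lexx _) x12) dx) zd.
  have := combine e0 P2 P1; rewrite nx1 nx2 => /(_ _ (sum_leU x x12 nz)).
  by congr (`|_| <= _); ring.
have bV : `|itv_int (fun t => V t y2) x1 x2 - itv_int (fun t => V t y1) x1 x2 -
    A * (y2 - y1) * (x2 - x1)| <= eps * D * (x2 - x1).
  have c2 : cont_on (fun t => V t y2) x1 x2.
    by apply: (@cont_on_sub _ _ a b) => //; exact: contV.
  have c1' : cont_on (fun t => V t y1) x1 x2.
    by apply: (@cont_on_sub _ _ a b) => //; exact: contV.
  rewrite itv_intB//; apply: itv_int_approx => //; first exact: cont_onB.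
  move=> z x1z zx2.
  have nz := near_le x1x xx2 x1z zx2; have zd := le_lt_trans nz dx.
  have az := le_trans a1 x1z; have zb := le_trans zx2 x2b.
  have [_ P2] := Hd z y2 az zb cy2 y2d zd (le_lt_trans (near_le y1y yy2 y12 (lexx _)) dy).
  have [_ P1] := Hd z y1 az zb c1 y1d zd (le_lt_trans (near_le y1y yy2 (lexx _) y12) dy).
  have := combine e0 P2 P1; rewrite ny1 ny2 => /(_ _ (sum_leV y y12 nz)).
  by congr (`|_| <= _); ring.
have -> : Phi x1 x2 y1 y2 =
    (itv_int (U x2) y1 y2 - itv_int (U x1) y1 y2 - A * (x2 - x1) * (y2 - y1)) -
    (itv_int (fun t => V t y2) x1 x2 - itv_int (fun t => V t y1) x1 x2 -
     A * (y2 - y1) * (x2 - x1)) by rewrite /Phi; ring.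
apply: (le_trans (ler_normB _ _)); apply: (le_trans (lerD bU bV)).
by rewrite -mulrDr [y2 - y1 + _]addrC -/D expr2 mulrA.
Qed.

End RealGoursat.

Local Open Scope complex_scope.

Section ComplexModulus.
Variable R : realType.
Implicit Types (z w : R[i]).

(** The norm of [R[i]] takes its values in [R[i]]; this is the same number as a real. *)
Definition cabs z : R := complex.Re `|z|.

Lemma cabsE z : `|z| = (cabs z)%:C.
Proof. by rewrite /cabs normc_def. Qed.

Lemma cabs_def z : cabs z = Num.sqrt (complex.Re z ^+ 2 + complex.Im z ^+ 2).
Proof. by rewrite /cabs normc_def. Qed.

Lemma ltc_cabs z (r : R) : (`|z| < r%:C) = (cabs z < r).
Proof. by rewrite cabsE ltcR. Qed.

Lemma cabs_ge0 z : 0 <= cabs z.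
Proof. by rewrite cabs_def sqrtr_ge0. Qed.

Lemma cabs_eq0 z : (cabs z == 0) = (z == 0).
Proof.
apply/eqP/eqP => [z0|->]; last by rewrite /cabs normr0.
by apply/eqP; rewrite -normr_eq0 cabsE z0.
Qed.

Lemma cabs0 : cabs 0 = 0.
Proof. by apply/eqP; rewrite cabs_eq0. Qed.

Lemma cabs1 : cabs 1 = 1.
Proof. by rewrite /cabs normr1. Qed.

Lemma cabs_gt0 z : (0 < cabs z) = (z != 0).
Proof. by rewrite lt_neqAle cabs_ge0 andbT eq_sym cabs_eq0. Qed.

Lemma cabsM z w : cabs (z * w) = cabs z * cabs w.
Proof. by apply: (@complexI R); rewrite rmorphM /= -!cabsE normrM. Qed.

Lemma cabsV z : cabs z^-1 = (cabs z)^-1.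
Proof. by apply: (@complexI R); rewrite fmorphV /= -!cabsE normfV. Qed.

Lemma cabsN z : cabs (- z) = cabs z.
Proof. by rewrite /cabs normrN. Qed.

Lemma cabsD z w : cabs (z + w) <= cabs z + cabs w.
Proof. by rewrite -lecR rmorphD /= -!cabsE ler_normD. Qed.

Lemma cabsB z w : cabs (z - w) <= cabs z + cabs w.
Proof. by rewrite -[cabs w]cabsN cabsD. Qed.

Lemma cabs_distC z w : cabs (z - w) = cabs (w - z).
Proof. by rewrite -cabsN opprB. Qed.

Lemma cabsR (x : R) : cabs x%:C = `|x|.
Proof. by rewrite cabs_def /= expr0n addr0 sqrtr_sqr. Qed.

Lemma cabsJ z : cabs (conjc z) = cabs z.
Proof. by rewrite /cabs normcJ. Qed.

Lemma Re_le_cabs z : `|complex.Re z| <= cabs z.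
Proof. by rewrite cabs_def -sqrtr_sqr ler_wsqrtr// lerDl sqr_ge0. Qed.

Lemma Im_le_cabs z : `|complex.Im z| <= cabs z.
Proof. by rewrite cabs_def -sqrtr_sqr ler_wsqrtr// lerDr sqr_ge0. Qed.

Lemma cabs_le_ReIm z : cabs z <= `|complex.Re z| + `|complex.Im z|.
Proof.
rewrite cabs_def -[leRHS]ger0_norm ?addr_ge0// -sqrtr_sqr ler_wsqrtr//.
by rewrite sqrrD !real_normK ?num_real// addrAC lerDl mulrn_wge0// mulr_ge0.
Qed.

Lemma complex_ReIm z : z = complex.Re z +i* complex.Im z.
Proof. by case: z. Qed.

End ComplexModulus.

Section LogPolar.
Variable R : realType.
Implicit Types (K : R[i] -> R[i]).

Lemma is_derive_expansion (f : R -> R) (a l : R) : is_derive a 1 f l ->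
  forall eps, 0 < eps -> exists2 delta, 0 < delta &
    forall h, `|h| < delta -> `|f (a + h) - f a - l * h| <= eps * `|h|.
Proof.
move=> [df fl] eps e0.
have : (fun h => h^-1 *: (f (h *: 1 + a) - f a)) @ 0^' --> l.
  by rewrite -fl; exact: df.
move=> /cvgrPdist_le /(_ _ e0) /nbhs_ballP[delta /= d0 Hd].
exists delta => // h hd.
have [->|h0] := eqVneq h 0; first by rewrite addr0 subrr mulr0 subr0 normr0 mulr0.
have := Hd h; rewrite /ball /= sub0r normrN => /(_ hd h0).
rewrite -[h%:A]/(h * 1) mulr1 [h + a]addrC /= => H.
have -> : f (a + h) - f a - l * h = - ((l - h^-1 *: (f (a + h) - f a)) * h).
  by rewrite /GRing.scale /=; field.
by rewrite normrN normrM ler_wpM2r.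
Qed.

(** exp (x + i t), assembled from real functions: logarithmic polar coordinates of the punctured
    plane, in which circles about 0 become vertical segments. *)
Definition cexp (x t : R) : R[i] := (expR x * cos t) +i* (expR x * sin t).

Lemma cexpD x y s t : cexp (x + y) (s + t) = cexp x s * cexp y t.
Proof.
rewrite /cexp expRD cosD sinD; apply/eqP; rewrite eq_complex /=; apply/andP; split;
  apply/eqP; ring.
Qed.

Lemma cabs_cexp x t : cabs (cexp x t) = expR x.
Proof.
rewrite cabs_def /cexp /= !exprMn -mulrDr cos2Dsin2 mulr1 sqrtr_sqr.
by rewrite ger0_norm// expR_ge0.
Qed.

Lemma cexp_expansion0 eps : 0 < eps -> exists2 delta, 0 < delta &
  forall s t : R, `|s| < delta -> `|t| < delta ->
    cabs (cexp s t - 1 - (s +i* t)) <= eps * (`|s| + `|t|).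
Proof.
move=> e0; pose e1 := Num.min (eps / 12) 1.
have e10 : 0 < e1 by rewrite lt_min divr_gt0//=.
have e12 : e1 <= eps / 12 by rewrite ge_min lexx.
have e11 : e1 <= 1 by rewrite ge_min lexx orbT.
clearbody e1.
have [d1 d10 H1] := is_derive_expansion (is_derive_expR 0) e10.
have [d2 d20 H2] := is_derive_expansion (is_derive_cos 0) e10.
have [d3 d30 H3] := is_derive_expansion (is_derive_sin 0) e10.
exists (Num.min (Num.min d1 d2) (Num.min d3 e1)).
  by rewrite !lt_min d10 d20 d30 e10.
move=> s t; rewrite !lt_min => /andP[/andP[s1 s2] /andP[s3 s4]] /andP[/andP[t1 t2] /andP[t3 t4]].
have := H1 s s1; have := H2 t t2; have := H3 t t3.
rewrite !add0r expR0 cos0 sin0 oppr0 mul0r !subr0 !mul1r !addr0 => h3 h2 h1.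
set E := expR s in h1 *; set c := cos t in h2 *; set d := sin t in h3 *.
apply: (le_trans (cabs_le_ReIm _)) => /=; rewrite -/E -/c -/d subr0.
have es : e1 * `|s| <= `|s| by rewrite ler_piMl.
have E3 : `|E| <= 3.
  have -> : E = (E - 1 - s) + 1 + s by ring.
  apply: (le_trans (ler_normD _ _)); have := ler_normD (E - 1 - s) 1.
  rewrite normr1; clear -h1 es s4 e11; lra.
have EB : `|E - 1| <= 2 * `|s|.
  have -> : E - 1 = (E - 1 - s) + s by ring.
  by apply: (le_trans (ler_normD _ _)); clear -h1 es; lra.
have A1 : `|E * c - 1 - s| <= e1 * `|s| + 3 * (e1 * `|t|).
  have -> : E * c - 1 - s = (E - 1 - s) + E * (c - 1) by ring.
  apply: (le_trans (ler_normD _ _)); rewrite normrM; apply: lerD => //.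
  by apply: ler_pM.
have A2 : `|E * d - t| <= 3 * (e1 * `|t|) + 2 * `|s| * e1.
  have -> : E * d - t = E * (d - t) + (E - 1) * t by ring.
  apply: (le_trans (ler_normD _ _)); rewrite !normrM; apply: lerD.
    by apply: ler_pM.
  by apply: ler_pM => //; exact: ltW.
have s0 := normr_ge0 s; have t0 := normr_ge0 t.
have m1 : e1 * `|s| <= eps / 12 * `|s| by rewrite ler_wpM2r.
have m2 : e1 * `|t| <= eps / 12 * `|t| by rewrite ler_wpM2r.
have m3 : 0 <= eps * `|s| by rewrite mulr_ge0// ltW.
have m4 : 0 <= eps * `|t| by rewrite mulr_ge0// ltW.
clear -A1 A2 m1 m2 m3 m4 s0 t0.
lra.
Qed.

Lemma cexp_expansion x t0 eps : 0 < eps -> exists2 delta, 0 < delta &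
  forall s t : R, `|s| < delta -> `|t| < delta ->
    cabs (cexp (x + s) (t0 + t) - cexp x t0 - cexp x t0 * (s +i* t)) <=
      eps * (`|s| + `|t|).
Proof.
move=> e0; have e1 : 0 < eps / expR x by rewrite divr_gt0// expR_gt0.
have [delta d0 H] := cexp_expansion0 e1; exists delta => // s t sd td.
have -> : cexp (x + s) (t0 + t) - cexp x t0 - cexp x t0 * (s +i* t) =
   cexp x t0 * (cexp s t - 1 - (s +i* t)) by rewrite cexpD; ring.
rewrite cabsM cabs_cexp mulrC -ler_pdivlMr ?expR_gt0//.
by apply: (le_trans (H s t sd td)); rewrite mulrAC.
Qed.

Definition cdiff K z := exists L, forall eps, 0 < eps -> exists2 delta, 0 < delta &
  forall h, cabs h < delta -> cabs (K (z + h) - K z - L * h) <= eps * cabs h.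

(** By the chain rule, K (exp (x + i t)) has complex derivative [M = L * z]. The Cauchy-Riemann
    equation needed by [real_goursat] is the fact that [A = Re M] appears in both expansions. *)
Lemma cdiff_cexp_expansion K x y : cdiff K (cexp x y) ->
  exists A B C : R, forall eps, 0 < eps -> exists2 delta, 0 < delta &
  forall x' y', `|x' - x| < delta -> `|y' - y| < delta ->
    `|complex.Re (K (cexp x' y')) - complex.Re (K (cexp x y)) -
      A * (x' - x) - B * (y' - y)| <= eps * (`|x' - x| + `|y' - y|) /\
    `|complex.Im (K (cexp x' y')) - complex.Im (K (cexp x y)) -
      C * (x' - x) - A * (y' - y)| <= eps * (`|x' - x| + `|y' - y|).
Proof.
move=> [L HL]; set z := cexp x y.
pose M := L * z; exists (complex.Re M), (- complex.Im M), (complex.Im M) => eps e0.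
have ex0 : 0 < expR x by exact: expR_gt0.
have cL0 := cabs_ge0 L.
have q0 : 0 < 2 * expR x + 2 by rewrite addr_gt0// mulr_gt0.
have q1 : 0 < 2 * (cabs L + 1) by rewrite mulr_gt0// ltr_wpDl.
have e10 : 0 < eps / (2 * expR x + 2) by rewrite divr_gt0.
have e20 : 0 < Num.min 1 (eps / (2 * (cabs L + 1))) by rewrite lt_min ltr01 divr_gt0.
have [d1 d10 H1] := HL _ e10.
have [d2 d20 H2] := cexp_expansion x y e20.
set e2 := Num.min 1 (eps / (2 * (cabs L + 1))) in e20 H2.
set e1 := eps / (2 * expR x + 2) in e10 H1.
have e21 : e2 <= 1 by rewrite ge_min lexx.
have e22 : e2 * (2 * (cabs L + 1)) <= eps.
  by rewrite -ler_pdivlMr// ge_min lexx orbT.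
have e12 : e1 * (2 * expR x + 2) = eps by rewrite /e1 divfK// gt_eqF.
pose d3 := d1 / (2 * (expR x + 1)).
have ex1 : 0 < expR x + 1 by rewrite addr_gt0.
exists (Num.min d2 d3); first by rewrite lt_min d20 divr_gt0// mulr_gt0.
move=> x' y'; rewrite !lt_min => /andP[s2 s3] /andP[t2 t3].
set s := x' - x in s2 s3 *; set t := y' - y in t2 t3 *.
have := H2 s t s2 t2; rewrite /s /t !subrKC -/s -/t -/z => hz.
set S := `|s| + `|t| in hz *.
have S0 : 0 <= S by rewrite addr_ge0.
have cst : cabs (s +i* t) <= S by exact: cabs_le_ReIm.
pose h := cexp x' y' - z.
have hh : cabs h <= (expR x + e2) * S.
  have -> : h = (h - z * (s +i* t)) + z * (s +i* t) by ring.
  apply: (le_trans (cabsD _ _)); rewrite cabsM cabs_cexp mulrDl addrC.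
  by apply: lerD hz; rewrite ler_wpM2l// ltW.
have hd : cabs h < d1.
  apply: (le_lt_trans hh).
  have : S < 2 * d3 by rewrite mulr_natl mulr2n ltrD.
  rewrite (_ : 2 * d3 = d1 / (expR x + 1)); last by rewrite /d3; field; rewrite gt_eqF.
  rewrite ltr_pdivlMr// => hS; apply: le_lt_trans hS.
  by rewrite mulrC ler_wpM2l// lerD2l.
have := H1 h hd; rewrite (_ : z + h = cexp x' y'); last by rewrite /h; ring.
move=> hK.
have key : cabs (K (cexp x' y') - K z - M * (s +i* t)) <= eps * S.
  have -> : K (cexp x' y') - K z - M * (s +i* t) =
    (K (cexp x' y') - K z - L * h) + L * (h - z * (s +i* t)) by rewrite /M; ring.
  apply: (le_trans (cabsD _ _)); rewrite cabsM.
  have k1 : e1 * cabs h <= e1 * ((expR x + 1) * S).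
    rewrite ler_wpM2l ?(ltW e10)//; apply: (le_trans hh).
    by rewrite ler_wpM2r// lerD2l.
  have k2 : cabs L * cabs (h - z * (s +i* t)) <= cabs L * (e2 * S).
    by rewrite ler_wpM2l.
  have k3 : e1 * ((expR x + 1) * S) = eps * S / 2 by rewrite -e12; field.
  have k4 : cabs L * (e2 * S) <= eps * S / 2.
    have : e2 * (2 * (cabs L + 1)) * S <= eps * S by rewrite ler_wpM2r.
    have : 0 <= e2 * S by rewrite mulr_ge0// ltW.
    clear; nra.
  have := lerD hK (le_refl (cabs L * cabs (h - z * (s +i* t)))).
  move: k1 k2 k3 k4; clear; lra.
have EM : M * (s +i* t) = (complex.Re M * s - complex.Im M * t) +i*
    (complex.Im M * s + complex.Re M * t).
  rewrite {1}[M]complex_ReIm; apply/eqP; rewrite eq_complex /=.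
  by apply/andP; split; apply/eqP; ring.
rewrite EM in key.
split.
  apply: le_trans key; apply: le_trans (Re_le_cabs _); rewrite !raddfB /=.
  by rewrite le_eqVlt; apply/orP; left; apply/eqP; congr `|_|; ring.
apply: le_trans key; apply: le_trans (Im_le_cabs _); rewrite !raddfB /=.
by rewrite le_eqVlt; apply/orP; left; apply/eqP; congr `|_|; ring.
Qed.

(* Cauchy's theorem for [K (exp (x + i t))] on a rectangle makes the circular mean
   of [Re K] independent of the radius. *)
Lemma min_principle K (rho r : R) : 0 < rho -> rho < r ->
  (forall z, z != 0 -> cabs z < r -> cdiff K z) ->
  (forall eps, 0 < eps -> exists2 delta, 0 < delta &
    forall z, cabs z < delta -> cabs (K z - K 0) <= eps) ->
  (forall z, cabs z = rho -> 0 <= complex.Re (K z)) ->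
  0 <= complex.Re (K 0).
Proof.
move=> rho0 rhor dK cK pK; rewrite leNgt; apply/negP => K0.
set k := complex.Re (K 0) in K0.
have e0 : 0 < - k / 2 by rewrite divr_gt0// oppr_gt0.
have [delta d0 Hd] := cK _ e0.
(* The inner circle has radius below [delta], so there [Re K] is within [- k / 2] of the negative
   number [k] and its mean is negative; the minimum with [b] guarantees [a <= b]. *)
pose b := ln rho; pose a := Num.min b (ln (delta / 2)).
have ab : a <= b by rewrite ge_min lexx.
have d20 : 0 < delta / 2 by rewrite divr_gt0.
have ea : expR a < delta.
  apply: (@le_lt_trans _ _ (expR (ln (delta / 2)))).
    by rewrite ler_expR ge_min lexx orbT.
  by rewrite lnK ?posrE// ltr_pdivrMr// ltr_pMr// ltr1n.
have eb : expR b = rho by rewrite lnK.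
have pi0 : 0 <= 2 * pi :> R by rewrite mulr_ge0// pi_ge0.
pose U x t := complex.Re (K (cexp x t)); pose V x t := complex.Im (K (cexp x t)).
have expan : forall x y, a <= x -> x <= b -> 0 <= y -> y <= 2 * pi ->
  exists A B C : R, forall eps, 0 < eps -> exists2 delta, 0 < delta &
  forall x' y', a <= x' -> x' <= b -> 0 <= y' -> y' <= 2 * pi ->
    `|x' - x| < delta -> `|y' - y| < delta ->
    `|U x' y' - U x y - A * (x' - x) - B * (y' - y)| <= eps * (`|x' - x| + `|y' - y|) /\
    `|V x' y' - V x y - C * (x' - x) - A * (y' - y)| <= eps * (`|x' - x| + `|y' - y|).
  move=> x y ax xb _ _.
  have dKx : cdiff K (cexp x y).
    apply: dK; first by rewrite -cabs_gt0 cabs_cexp expR_gt0.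
    by rewrite cabs_cexp; apply: le_lt_trans rhor; rewrite -eb ler_expR.
  have [A [B [C H]]] := cdiff_cexp_expansion dKx.
  exists A, B, C => eps eps0; have [dd dd0 Hdd] := H _ eps0.
  by exists dd => // x' y' _ _ _ _; exact: Hdd.
have := real_goursat ab pi0 expan.
(* The sides t = 0 and t = 2 pi coincide in the plane, so their contributions cancel and the means
   over the two circles agree. *)
have -> : (fun x => V x (2 * pi)) = (fun x => V x 0).
  apply/funext => x; rewrite /V /cexp.
  have -> : 2 * pi = 0 + pi *+ 2 :> R by rewrite add0r mulr_natl.
  by rewrite cosD2pi sinD2pi.
rewrite subrr => /eqP; rewrite subr_eq0 => /eqP E.
have Ib : 0 <= itv_int (U b) 0 (2 * pi).
  by apply: Rintegral_ge0 => t _; apply: pK; rewrite cabs_cexp.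
have ca : cont_on (U a) 0 (2 * pi) by exact: (real_goursat_cont expan).
have := @itv_int_approx R (U a) 0 (2 * pi) k (- k / 2) pi0 ca.
rewrite subr0 -E => H.
have Ha : forall x, 0 <= x -> x <= 2 * pi -> `|U a x - k| <= - k / 2.
  move=> t _ _; apply: le_trans (Hd (cexp a t) _).
    by rewrite /U /k -raddfB; exact: Re_le_cabs.
  by rewrite cabs_cexp.
have := H Ha; rewrite ler_norml => /andP[_ Hle].
have pik : 0 < pi * - k by rewrite mulr_gt0 ?pi_gt0 ?oppr_gt0.
by move: Ib Hle pik; clear; lra.
Qed.

End LogPolar.

(** * Lower bound for the Kobayashi-Royden metric *)

Section ComplexLimits.
Variable R : realType.
Implicit Types (f g q : R[i] -> R[i]) (z l m : R[i]).

Definition clim q l := forall eps, 0 < eps -> exists2 delta, 0 < delta &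
  forall h, h != 0 -> cabs h < delta -> cabs (q h - l) <= eps.

Lemma eq_clim q q' l : (forall h, h != 0 -> q h = q' h) -> clim q l -> clim q' l.
Proof.
move=> E H eps e0; have [d d0 Hd] := H _ e0.
by exists d => // h h0 hd; rewrite -E//; exact: Hd.
Qed.

Lemma clim_cst l : clim (fun=> l) l.
Proof.
by move=> eps e0; exists 1 => // h _ _; rewrite subrr cabs0 ltW.
Qed.

Lemma climD q q' l l' : clim q l -> clim q' l' -> clim (fun h => q h + q' h) (l + l').
Proof.
move=> H H' eps e0; have e20 : 0 < eps / 2 by rewrite divr_gt0.
have [d d0 Hd] := H _ e20; have [d' d'0 Hd'] := H' _ e20.
exists (Num.min d d'); first by rewrite lt_min d0.
move=> h h0; rewrite lt_min => /andP[h1 h2].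
have -> : q h + q' h - (l + l') = (q h - l) + (q' h - l') by ring.
by rewrite [eps]splitr; apply: le_trans (cabsD _ _) (lerD (Hd _ _ _) (Hd' _ _ _)).
Qed.

Lemma climM q q' l l' : clim q l -> clim q' l' -> clim (fun h => q h * q' h) (l * l').
Proof.
move=> H H' eps e0.
have c0 := cabs_ge0 l; have c0' := cabs_ge0 l'.
have p0 : 0 < cabs l + cabs l' + 1 by rewrite ltr_wpDl// addr_ge0.
have e10 : 0 < Num.min 1 (eps / (cabs l + cabs l' + 1)).
  by rewrite lt_min ltr01 divr_gt0.
have [d d0 Hd] := H _ e10; have [d' d'0 Hd'] := H' _ e10.
set e := Num.min _ _ in e10 Hd Hd'.
have e1 : e <= 1 by rewrite ge_min lexx.
have e2 : e * (cabs l + cabs l' + 1) <= eps by rewrite -ler_pdivlMr// ge_min lexx orbT.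
exists (Num.min d d'); first by rewrite lt_min d0.
move=> h h0; rewrite lt_min => /andP[h1 h2].
have -> : q h * q' h - l * l' = (q h - l) * (q' h - l') + (q h - l) * l' + l * (q' h - l').
  by ring.
have H1 := Hd h h0 h1; have H2 := Hd' h h0 h2.
have a1 : cabs ((q h - l) * (q' h - l')) <= e * 1.
  by rewrite cabsM; apply: ler_pM; rewrite ?cabs_ge0//; exact: le_trans e1.
have a2 : cabs ((q h - l) * l') <= e * cabs l' by rewrite cabsM ler_wpM2r.
have a3 : cabs (l * (q' h - l')) <= e * cabs l by rewrite cabsM mulrC ler_wpM2r.
apply: (le_trans (cabsD _ _)); apply: (le_trans (lerD (cabsD _ _) (lexx _))).
by move: a1 a2 a3 e2; clear; lra.
Qed.

Lemma climV q l : l != 0 -> clim q l -> clim (fun h => (q h)^-1) l^-1.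
Proof.
move=> l0 H eps e0.
have cl : 0 < cabs l by rewrite cabs_gt0.
have e10 : 0 < Num.min (cabs l / 2) (eps * (cabs l) ^+ 2 / 2).
  by rewrite lt_min !divr_gt0// mulr_gt0// exprn_gt0.
have [d d0 Hd] := H _ e10; exists d => // h h0 hd.
have := Hd h h0 hd; rewrite le_min => /andP[h1 h2].
have q0 : cabs l / 2 <= cabs (q h).
  have := cabsB (q h) (q h - l); rewrite subKr; move: h1; clear; lra.
have qn : q h != 0 by rewrite -cabs_gt0; apply: lt_le_trans q0; rewrite divr_gt0.
have -> : (q h)^-1 - l^-1 = - ((q h - l) / (q h * l)) by field; rewrite l0.
rewrite cabsN cabsM cabsV cabsM ler_pdivrMr ?mulr_gt0 ?cabs_gt0//.
apply: (le_trans h2); rewrite -mulrA ler_pM2l//.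
by have := ler_wpM2r (ltW cl) q0; rewrite expr2; lra.
Qed.

Lemma cdiff_clim f z : cdiff f z <-> exists L, clim (fun h => (f (z + h) - f z) / h) L.
Proof.
split=> [[L H]|[L H]]; exists L => eps e0; have [d d0 Hd] := H _ e0; exists d => // h.
  move=> h0 hd; have ch : 0 < cabs h by rewrite cabs_gt0.
  have -> : (f (z + h) - f z) / h - L = (f (z + h) - f z - L * h) / h by field.
  by rewrite cabsM cabsV ler_pdivrMr//; exact: Hd.
move=> hd; have [->|h0] := eqVneq h 0.
  by rewrite addr0 subrr mulr0 subr0 cabs0 mulr0.
have -> : f (z + h) - f z - L * h = ((f (z + h) - f z) / h - L) * h by field.
by rewrite cabsM ler_wpM2r ?cabs_ge0//; exact: Hd.
Qed.

Lemma cdiff_cont f z : cdiff f z -> clim (fun h => f (z + h)) (f z).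
Proof.
move=> /cdiff_clim[L H].
have Hid : clim (fun h => h) 0.
  by move=> eps e0; exists eps => // h _ /ltW; rewrite subr0.
have := climD (climM H Hid) (clim_cst (f z)).
by rewrite mulr0 add0r; apply: eq_clim => h h0; rewrite divfK// subrK.
Qed.

Lemma cdiff_cst l z : cdiff (fun=> l) z.
Proof.
apply/cdiff_clim; exists 0; apply: (eq_clim _ (clim_cst 0)) => h _.
by rewrite subrr mul0r.
Qed.

Lemma cdiff_id z : cdiff id z.
Proof.
apply/cdiff_clim; exists 1; apply: (eq_clim _ (clim_cst 1)) => h h0 /=.
by rewrite [z + h]addrC addrK divff.
Qed.

Lemma cdiffD f g z : cdiff f z -> cdiff g z -> cdiff (fun x => f x + g x) z.
Proof.
move=> /cdiff_clim[L H] /cdiff_clim[M G]; apply/cdiff_clim; exists (L + M).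
by apply: (eq_clim _ (climD H G)) => h h0; field.
Qed.

Lemma cdiffM f g z : cdiff f z -> cdiff g z -> cdiff (fun x => f x * g x) z.
Proof.
move=> df dg; have cg := cdiff_cont dg.
move: df dg => /cdiff_clim[L H] /cdiff_clim[M G]; apply/cdiff_clim.
exists (L * g z + f z * M).
by apply: (eq_clim _ (climD (climM H cg) (climM (clim_cst (f z)) G))) => h h0; field.
Qed.

Lemma cdiff_inv z : z != 0 -> cdiff (fun x => x^-1) z.
Proof.
move=> z0; apply/cdiff_clim; exists (- (z * z)^-1).
have c1 := climM (clim_cst z) (cdiff_cont (cdiff_id z)).
have zz : z * z != 0 by rewrite mulf_neq0.
have c2 := climM (clim_cst (-1)) (climV zz c1).
rewrite mulN1r in c2 => eps e0; have [d d0 Hd] := c2 _ e0.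
exists (Num.min d (cabs z)); first by rewrite lt_min d0 cabs_gt0.
move=> h h0; rewrite lt_min => /andP[h1 h2].
have zh : z + h != 0.
  rewrite addr_eq0; apply/eqP => zh; move: h2; rewrite zh cabsN ltxx//.
have -> : ((z + h)^-1 - z^-1) / h = -1 * (z * (z + h))^-1.
  by field; rewrite h0 zh z0.
exact: Hd.
Qed.

Lemma Re_scale (x : R) z : complex.Re (x%:C * z) = x * complex.Re z.
Proof. by case: z => a b /=; ring. Qed.

Lemma conjc_mulJ z l : conjc (z * conjc l) = conjc z * l.
Proof.
case: z l => [a b] [c d]; apply/eqP; rewrite eq_complex /=.
by apply/andP; split; apply/eqP; ring.
Qed.

(** Caratheodory's inequality, with 4 in place of the sharp constant 2. The auxiliary function [K]
    multiplies [f - f 0], rather than [f], by a function with a pole at 0, which makes the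
    singularity removable; balancing this by [f + f 0] costs the factor 2. *)
Lemma positive_real_part_bound f L (r : R) : 0 < r ->
  (forall z, cabs z < r -> cdiff f z) ->
  (forall z, cabs z < r -> 0 <= complex.Re (f z)) ->
  clim (fun h => (f h - f 0) / h) L ->
  cabs L * r <= 4 * complex.Re (f 0).
Proof.
move=> r0 df pf HL.
have pf0 : 0 <= complex.Re (f 0) by apply: pf; rewrite cabs0.
have [->|L0] := eqVneq L 0; first by rewrite cabs0 mul0r mulr_ge0.
have cL : 0 < cabs L by rewrite cabs_gt0.
(* Nothing is known on the circle of radius [r] itself; the estimate on smaller circles passes to
   the limit. *)
suff key rho : 0 < rho -> rho < r -> cabs L * rho <= 4 * complex.Re (f 0).
  rewrite leNgt; apply/negP => H.
  have h1 : 4 * complex.Re (f 0) / cabs L < r by rewrite ltr_pdivrMr// [r * _]mulrC.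
  have h0 : 0 <= 4 * complex.Re (f 0) / cabs L by rewrite divr_ge0 ?mulr_ge0// ltW.
  set t := 4 * complex.Re (f 0) / cabs L in h1 h0.
  have k1 : 0 < (t + r) / 2 by lra.
  have k2 : (t + r) / 2 < r by lra.
  have := key _ k1 k2.
  have -> : 4 * complex.Re (f 0) = cabs L * t by rewrite /t; field; rewrite gt_eqF.
  rewrite ler_pM2l//; lra.
move=> rho0 rhor.
pose c := conjc L / (cabs L)%:C.
have cc : cabs c = 1.
  by rewrite /c cabsM cabsV cabsJ cabsR ger0_norm ?cabs_ge0// divff// gt_eqF.
have cLC : (cabs L)%:C != 0 :> R[i] by rewrite -cabs_gt0 cabsR normr_gt0 gt_eqF.
have cLE : complex.Re (c * L) = cabs L.
  suff -> : c * L = (cabs L)%:C by [].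
  by rewrite /c mulrAC [_ * L]mulrC -sqr_normc cabsE expr2 mulfK.
(* On the circle of radius [rho], [B] is real with values in [-2/rho, 2/rho], so that
   [Re K >= 0] there, while [K 0 = 4 f(0) / rho - c L]. *)
pose B z := c * z^-1 + (rho ^- 2)%:C * (conjc c * z).
pose K z := if z == 0 then (2 / rho)%:C * (f 0 + f 0) - c * L else
  (2 / rho)%:C * (f z + f 0) - (f z - f 0) * B z.
have K0 : K 0 = (2 / rho)%:C * (f 0 + f 0) - c * L by rewrite /K eqxx.
have : 0 <= complex.Re (K 0).
  apply: (@min_principle R K rho r) => //.
  - move=> z z0 zr.
    have dB : cdiff B z.
      apply: cdiffD; first by apply: cdiffM (cdiff_inv z0); exact: cdiff_cst.
      by do 2 (apply: cdiffM; first exact: cdiff_cst); exact: cdiff_id.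
    pose K' z := (2 / rho)%:C * (f z + f 0) + (f z + - f 0) * (-1 * B z).
    have : cdiff K' z.
      have dfz := df z zr.
      apply: cdiffD; first by apply: cdiffM; [exact: cdiff_cst|
        apply: cdiffD => //; exact: cdiff_cst].
      apply: cdiffM; first by apply: cdiffD => //; exact: cdiff_cst.
      by apply: cdiffM => //; exact: cdiff_cst.
    move=> [M HM]; exists M => eps e0; have [d d0 Hd] := HM _ e0.
    exists (Num.min d (cabs z)); first by rewrite lt_min d0 cabs_gt0.
    move=> h; rewrite lt_min => /andP[h1 h2].
    have zh : z + h != 0.
      by rewrite addrC addr_eq0; apply/eqP => zh; move: h2; rewrite zh cabsN ltxx.
    have KE x : x != 0 -> K x = K' x by move=> /negbTE xn; rewrite /K /K' xn; ring.
    by rewrite !KE//; exact: Hd.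
  - have f0c : clim (fun h => f h) (f 0).
      have := cdiff_cont (df 0 _); rewrite cabs0 => /(_ r0).
      by apply: eq_clim => h _; rewrite add0r.
    have Kc : clim K (K 0).
      rewrite K0; have idc : clim (fun h => h) 0.
        by move=> eps e0; exists eps => // h _ /ltW; rewrite subr0.
      have c1 := climM (clim_cst (2 / rho)%:C) (climD f0c (clim_cst (f 0))).
      have c2 := climM (clim_cst c) HL.
      have c3 := climM (climM idc idc) (climM (clim_cst ((rho ^- 2)%:C * conjc c)) HL).
      have c4 := climM (clim_cst (-1)) (climD c2 c3).
      have := climD c1 c4; rewrite mul0r mul0r addr0 mulN1r.
      apply: eq_clim => h h0; rewrite /K (negbTE h0) /B; field.
      by rewrite h0 andbT -cabs_gt0 [cabs _]cabsR normr_gt0 gt_eqF.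
    move=> eps e0; have [d d0 Hd] := Kc _ e0; exists d => // z zd.
    have [->|z0] := eqVneq z 0; first by rewrite subrr cabs0 ltW.
    exact: Hd.
  move=> z zrho.
  have z0 : z != 0 by rewrite -cabs_gt0 zrho.
  have BE : B z = (2 / rho ^+ 2 * complex.Re (c * conjc z))%:C.
    rewrite /B invc_norm cabsE zrho -rmorphXn -fmorphV /=.
    have -> : c * ((rho ^- 2)%:C * conjc z) + (rho ^- 2)%:C * (conjc c * z) =
      (rho ^- 2)%:C * (c * conjc z + conjc (c * conjc z)) by rewrite conjc_mulJ; ring.
    rewrite addcJ -(rmorph_nat (@real_complex R)) -!rmorphM /=; congr (_%:C).
    ring.
  have pz : 0 <= complex.Re (f z) by apply: pf; rewrite zrho.
  rewrite /K (negbTE z0) BE.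
  have bRe : `|complex.Re (c * conjc z)| <= rho.
    by apply: (le_trans (Re_le_cabs _)); rewrite cabsM cabsJ cc mul1r zrho.
  set T := complex.Re _ in bRe *.
  rewrite [_ * (_)%:C]mulrC raddfB /= !Re_scale !raddfB !raddfD /=.
  set u := complex.Re (f z) in pz *; set v := complex.Re (f 0) in pf0 *.
  have -> : 2 / rho * (u + v) - 2 / rho ^+ 2 * T * (u - v) =
    2 / rho ^+ 2 * (rho * (u + v) - T * (u - v)) by field; rewrite gt_eqF.
  rewrite mulr_ge0// ?divr_ge0 ?exprn_ge0 ?(ltW rho0)// subr_ge0.
  apply: (le_trans (ler_norm _)); rewrite normrM; apply: ler_pM => //.
  by rewrite ler_norml; move: pz pf0; clear; lra.
rewrite K0 raddfB /= Re_scale raddfD /= cLE subr_ge0 => H.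
rewrite -ler_pdivlMr//; apply: (le_trans H).
by rewrite le_eqVlt; apply/orP; left; apply/eqP; field; rewrite gt_eqF.
Qed.

End ComplexLimits.

Section ComplexForm.
Variables (R : realType) (n : nat).
Implicit Types (c : 'I_n -> R[i]) (v w z : 'rV[R[i]]_n).

Definition cform c v : R[i] := \sum_j v 0 j * c j.

Lemma cformD c v w : cform c (v + w) = cform c v + cform c w.
Proof. by rewrite /cform -big_split; apply: eq_bigr => j _; rewrite mxE mulrDl. Qed.

Lemma cformB c v w : cform c (v - w) = cform c v - cform c w.
Proof. by rewrite /cform -sumrB; apply: eq_bigr => j _; rewrite !mxE mulrBl. Qed.

Lemma cformZ c a v : cform c (a *: v) = a * cform c v.
Proof. by rewrite /cform mulr_sumr; apply: eq_bigr => j _; rewrite mxE mulrA. Qed.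

Lemma clim_coord (phi : R[i] -> 'rV[R[i]]_n) (a : R[i]) j : derivable phi a 1 ->
  clim (fun h => (phi (a + h) 0 j - phi a 0 j) / h) ('D_1 phi a 0 j).
Proof.
move=> dphi eps e0.
have e0' : 0 < eps%:C by rewrite ltcR.
have := dphi => /cvg_ballP /(_ _ e0') /nbhs_ballP[delta /= d0 Hd].
have dE : delta = (complex.Re delta)%:C.
  by apply/eqP; rewrite eq_complex /= eqxx -(ger0_Im (ltW d0)) eqxx.
exists (complex.Re delta).
  by move: d0; rewrite {1}dE ltcR.
move=> h h0 hd.
have := Hd h; rewrite /ball /= sub0r normrN dE ltc_cabs => /(_ hd h0).
rewrite /mx_ball => -[_ /(_ 0 j)]; rewrite /ball /= -/(derive _ _ _) ltc_cabs.
rewrite cabs_distC => /ltW; rewrite !mxE.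
by rewrite (_ : h%:A = h); [rewrite [h + a]addrC mulrC|exact: mulr1].
Qed.

Lemma clim_cform (phi : R[i] -> 'rV[R[i]]_n) (a : R[i]) c p : derivable phi a 1 ->
  clim (fun h => (cform c (phi (a + h) - p) - cform c (phi a - p)) / h)
    (cform c ('D_1 phi a)).
Proof.
move=> dphi.
suff : forall s : seq 'I_n,
    clim (fun h => \sum_(j <- s) ((phi (a + h) 0 j - phi a 0 j) / h) * c j)
      (\sum_(j <- s) 'D_1 phi a 0 j * c j).
  move=> /(_ (index_enum _)); apply: eq_clim => h h0.
  have -> : cform c (phi (a + h) - p) - cform c (phi a - p) =
    cform c (phi (a + h)) - cform c (phi a) by rewrite !cformB; ring.
  rewrite /cform -sumrB mulr_suml; apply: eq_bigr => j _.
  by rewrite -mulrBl mulrAC.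
elim=> [|j s IH].
  rewrite big_nil; apply: (eq_clim _ (clim_cst 0)) => h _; by rewrite big_nil.
rewrite big_cons; have := climD (climM (clim_coord j dphi) (clim_cst (c j))) IH.
by apply: eq_clim => h h0; rewrite big_cons.
Qed.

Lemma derivable_affine (p v : 'rV[R[i]]_n) (a : R[i]) :
  derivable (fun t : R[i] => p + t *: v) a 1 /\ 'D_1 (fun t : R[i] => p + t *: v) a = v.
Proof.
suff H : h^-1 *: (p + (h%:A + a) *: v - (p + a *: v)) @[h --> (0 : R[i])^'] --> v.
  split; first by apply: cvgP H.
  exact: cvg_lim H.
apply: (@cvg_trans _ (v @[h --> (0 : R[i])^'])); last exact: cvg_cst.
apply: near_eq_cvg; near=> h.
have h0 : h != 0 by near: h; exact: nbhs_dnbhs_neq.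
rewrite opprD addrACA subrr add0r -scalerBl addrK scalerA.
by rewrite (_ : h%:A = h); [rewrite mulVf// scale1r|exact: mulr1].
Unshelve. all: by end_near. Qed.

Lemma nbhs_coordP (U : set 'rV[R[i]]_n) z : nbhs z U <->
  exists2 e : R, 0 < e & forall w, (forall j, cabs (w 0 j - z 0 j) < e) -> U w.
Proof.
split=> [/nbhs_ballP[e /= e0 He]|[e e0 He]].
  have eE : e = (complex.Re e)%:C.
    by apply/eqP; rewrite eq_complex /= eqxx -(ger0_Im (ltW e0)) eqxx.
  exists (complex.Re e); first by move: e0; rewrite {1}eE ltcR.
  move=> w Hw; apply: He; split => // i j.
  by rewrite /ball /= eE ltc_cabs cabs_distC ord1.
apply/nbhs_ballP; exists e%:C; first by rewrite /= ltcR.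
move=> w [_ Hw]; apply: He => j.
by have := Hw 0 j; rewrite /ball /= ltc_cabs cabs_distC.
Qed.

(** The [inf] of an empty set is 0, so lower bounds on the metric require some disc to exist; a
    small affine one does. *)
Lemma kobayashi_royden_nonempty (Omega : set 'rV[R[i]]_n) z v : open Omega -> Omega z ->
  exists2 r : R, 0 < r & exists phi, [/\ holomorphic_disc Omega r phi, phi 0 = z & 'D_1 phi 0 = v].
Proof.
move=> oO Oz.
have /nbhs_coordP[e e0 He] : nbhs z Omega by exact: open_nbhs_nbhs.
pose M := 1 + \sum_j cabs (v 0 j).
have M0 : 0 < M by rewrite ltr_pwDl// sumr_ge0// => j _; exact: cabs_ge0.
exists (e / M); first by rewrite divr_gt0.
exists (fun t => z + t *: v); split.
- move=> t; rewrite ltc_cabs ltr_pdivlMr// => tM.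
  split; first by have [] := derivable_affine z v t.
  apply: He => j; rewrite !mxE [X in cabs X]addrC addKr cabsM; apply: le_lt_trans tM.
  rewrite ler_wpM2l ?cabs_ge0// /M (bigD1 j)//= addrCA lerDl addr_ge0// sumr_ge0//.
  by move=> i _; exact: cabs_ge0.
- by rewrite scale0r addr0.
- by have [] := derivable_affine z v 0.
Qed.

(** The supporting functional maps every disc in [Omega] into the half-plane of nonnegative real
    part, where [positive_real_part_bound] controls the derivative at the centre. *)
Lemma kobayashi_royden_ge_cform (Omega : set 'rV[R[i]]_n) c p z v :
  open Omega -> Omega z ->
  (forall w, Omega w -> 0 <= complex.Re (cform c (w - p))) ->
  cabs (cform c v) <= 4 * complex.Re (cform c (z - p)) * kobayashi_royden Omega z v.
Proof.
move=> oO Oz cO.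
set u := complex.Re (cform c (z - p)).
have u0 : 0 <= u by exact: cO.
have key (r : R) phi : 0 < r -> holomorphic_disc Omega r phi -> phi 0 = z ->
    'D_1 phi 0 = v -> cabs (cform c v) * r <= 4 * u.
  move=> r0 hphi p0 dp.
  have := @positive_real_part_bound R (fun t => cform c (phi t - p)) (cform c v) r r0.
  rewrite p0; apply.
  - move=> t tr; apply/cdiff_clim; exists (cform c ('D_1 phi t)).
    by apply: clim_cform; have [] := hphi t; rewrite ?ltc_cabs.
  - by move=> t tr; apply: cO; have [] := hphi t; rewrite ?ltc_cabs.
  - rewrite -dp -p0; have /hphi[d0 _] : `|0 : R[i]| < r%:C by rewrite ltc_cabs cabs0.
    by apply: eq_clim (clim_cform c p d0) => h _; rewrite add0r.
have [r r0 [phi [h1 h2 h3]]] := kobayashi_royden_nonempty v oO Oz.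
(* Division by [u] is impossible here, for instance when [c] vanishes; a single disc then forces
   [cform c v = 0]. *)
have [u00|un0] := eqVneq u 0.
  have := key r phi r0 h1 h2 h3; rewrite u00 !mulr0 mul0r pmulr_lle0//.
have up : 0 < 4 * u by rewrite mulr_gt0// lt_neqAle eq_sym un0.
rewrite mulrC -ler_pdivrMr//; apply: lb_le_inf.
  by exists r^-1; exists r => //; split => //; exists phi.
move=> _ [s [s0 [psi [k1 k2 k3]]] <-].
rewrite ler_pdivrMr// mulrC ler_pdivlMr//; exact: key k1 k2 k3.
Qed.

End ComplexForm.

(** * Euclidean geometry of convex domains *)

Section EuclideanNorm.
Variables (R : realType) (n : nat).
Implicit Types (v w z : 'rV[R[i]]_n).

Lemma cauchy_schwarz_sum (I : finType) (a b : I -> R) :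
  (\sum_i a i * b i) ^+ 2 <= (\sum_i a i ^+ 2) * (\sum_i b i ^+ 2).
Proof.
set A := \sum_i a i ^+ 2; set B := \sum_i b i ^+ 2; set P := \sum_i a i * b i.
have B0 : 0 <= B by apply: sumr_ge0 => i _; exact: sqr_ge0.
have : 0 <= \sum_i (B * a i - P * b i) ^+ 2 by apply: sumr_ge0 => i _; exact: sqr_ge0.
have -> : \sum_i (B * a i - P * b i) ^+ 2 = B * (A * B - P ^+ 2).
  transitivity (\sum_i (B ^+ 2 * a i ^+ 2 - 2 * B * P * (a i * b i) + P ^+ 2 * b i ^+ 2)).
    by apply: eq_bigr => i _; ring.
  rewrite big_split sumrB /= -!mulr_sumr -/A -/B -/P. ring.
have [B00|Bn0] := eqVneq B 0.
  move=> _; suff -> : P = 0 by rewrite expr0n/= B00 mulr0.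
  apply: big1 => i _; suff -> : b i = 0 by rewrite mulr0.
  apply/eqP; rewrite -sqrf_eq0; apply/eqP.
  by move/psumr_eq0P: B00 => /(_ (fun i _ => sqr_ge0 (b i))) /(_ i isT).
by rewrite pmulr_rge0 ?subr_ge0// lt_neqAle eq_sym Bn0.
Qed.

Lemma enormE z : enorm z = Num.sqrt (\sum_k realify z 0 k ^+ 2).
Proof.
rewrite /enorm; congr Num.sqrt; rewrite big_split_ord /= -big_split /=.
by apply: eq_bigr => j _; rewrite /realify row_mxEl row_mxEr !mxE.
Qed.

Lemma enorm_ge0 z : 0 <= enorm z.
Proof. by rewrite /enorm sqrtr_ge0. Qed.

Lemma realifyD v w : realify (v + w) = realify v + realify w.
Proof.
by apply/rowP => k; rewrite /realify !mxE; case: splitP => j _; rewrite !mxE raddfD.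
Qed.

Lemma enormD v w : enorm (v + w) <= enorm v + enorm w.
Proof.
set S := fun z => \sum_k realify z 0 k ^+ 2.
have S0 z : 0 <= S z by apply: sumr_ge0 => k _; exact: sqr_ge0.
rewrite -[leRHS]ger0_norm ?addr_ge0 ?enorm_ge0// -sqrtr_sqr enormE ler_wsqrtr//.
rewrite sqrrD !enormE !sqr_sqrtr ?S0// -/(S v) -/(S w).
rewrite -sqrtrM//.
have -> : \sum_k realify (v + w) 0 k ^+ 2 =
    S v + (\sum_k realify v 0 k * realify w 0 k) *+ 2 + S w.
  rewrite /S -sumrMnl -!big_split /=; apply: eq_bigr => k _.
  by rewrite realifyD mxE sqrrD.
rewrite lerD2r lerD2l lerMn2r/=.
apply: (le_trans (ler_norm _)); rewrite -sqrtr_sqr ler_wsqrtr//.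
exact: cauchy_schwarz_sum.
Qed.

Lemma enormZ (a : R[i]) v : enorm (a *: v) = cabs a * enorm v.
Proof.
rewrite /enorm cabs_def -sqrtrM ?addr_ge0 ?sqr_ge0//; congr Num.sqrt.
rewrite mulr_sumr; apply: eq_bigr => j _; rewrite !mxE.
by case: a (v 0 j) => [a b] [c d] /=; ring.
Qed.

Lemma enormN v : enorm (- v) = enorm v.
Proof. by rewrite -scaleN1r enormZ cabsN cabs1 mul1r. Qed.

Lemma enorm_distC v w : enorm (v - w) = enorm (w - v).
Proof. by rewrite -enormN opprB. Qed.

Lemma enorm0 : enorm (0 : 'rV[R[i]]_n) = 0.
Proof. by rewrite -(scale0r 0) enormZ cabs0 mul0r. Qed.

Lemma enorm_dist_triangle v w z : enorm (v - z) <= enorm (v - w) + enorm (w - z).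
Proof. by rewrite -{1}(subrK w v) -addrA enormD. Qed.

Lemma cabs_le_enorm v j : cabs (v 0 j) <= enorm v.
Proof.
rewrite cabs_def /enorm ler_wsqrtr// [leRHS](bigD1 j)//= lerDl sumr_ge0// => i _.
by rewrite addr_ge0// sqr_ge0.
Qed.

Lemma enorm_le_sum v : enorm v <= \sum_j cabs (v 0 j).
Proof.
rewrite /enorm -[leRHS]ger0_norm ?sumr_ge0//; last by move=> j _; exact: cabs_ge0.
rewrite -sqrtr_sqr ler_wsqrtr//.
have key (s : seq 'I_n) : \sum_(j <- s) (complex.Re (v 0 j) ^+ 2 + complex.Im (v 0 j) ^+ 2) <=
    (\sum_(j <- s) cabs (v 0 j)) ^+ 2.
  elim: s => [|j s IH]; first by rewrite !big_nil expr0n.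
  rewrite !big_cons sqrrD cabs_def sqr_sqrtr ?addr_ge0 ?sqr_ge0// -[leRHS]addrA lerD2l.
  apply: (le_trans IH); rewrite lerDr mulrn_wge0// mulr_ge0 ?sqrtr_ge0//.
  by rewrite sumr_ge0// => i _; exact: cabs_ge0.
exact: key.
Qed.

Lemma enorm_eq0 v : (enorm v == 0) = (v == 0).
Proof.
apply/eqP/eqP => [v0|->]; last exact: enorm0.
apply/rowP => j; rewrite mxE; apply/eqP; rewrite -cabs_eq0 eq_le cabs_ge0 andbT -v0.
exact: cabs_le_enorm.
Qed.

Lemma enorm_gt0 v : (0 < enorm v) = (v != 0).
Proof. by rewrite lt_neqAle enorm_ge0 andbT eq_sym enorm_eq0. Qed.

Lemma nbhs_enormP (U : set 'rV[R[i]]_n) z : nbhs z U <->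
  exists2 e : R, 0 < e & forall w, enorm (w - z) < e -> U w.
Proof.
split=> [/nbhs_coordP[e e0 He]|[e e0 He]].
  exists e => // w wz; apply: He => j; apply: le_lt_trans wz.
  by have := cabs_le_enorm (w - z) j; rewrite !mxE.
apply/nbhs_coordP; exists (e / n.+1%:R); first by rewrite divr_gt0.
move=> w Hw; apply: He; apply: (le_lt_trans (enorm_le_sum _)).
apply: (@le_lt_trans _ _ (\sum_(j < n) e / n.+1%:R)).
  by apply: ler_sum => j _; rewrite !mxE; exact: ltW.
rewrite sumr_const card_ord -[X in X < _]mulr_natr mulrAC ltr_pdivrMr// ltr_pM2l// ltr_nat//.
Qed.

Lemma closure_enormP (A : set 'rV[R[i]]_n) z :
  closure A z <-> forall e, 0 < e -> exists2 w, A w & enorm (w - z) < e.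
Proof.
split=> [cA e e0|H B /nbhs_enormP[e e0 He]].
  have [|w [Aw Bw]] := cA [set w | enorm (w - z) < e].
    by apply/nbhs_enormP; exists e.
  by exists w.
have [w Aw wz] := H e e0; exists w; split => //; exact: He.
Qed.

Lemma cabs_cform_le (c : 'I_n -> R[i]) v :
  cabs (cform c v) <= (\sum_j cabs (c j)) * enorm v.
Proof.
rewrite mulr_suml; apply: (@le_trans _ _ (\sum_j cabs (v 0 j * c j))).
  rewrite /cform; elim/big_ind2: _ => [|x1 x2 y1 y2 h1 h2|//]; first by rewrite cabs0.
  by apply: (le_trans (cabsD _ _)); exact: lerD.
by apply: ler_sum => j _; rewrite cabsM mulrC ler_wpM2l ?cabs_ge0 ?cabs_le_enorm.
Qed.

End EuclideanNorm.

Section ConvexDomain.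
Variables (R : realType) (n : nat).
Variable Omega : set 'rV[R[i]]_n.
Hypotheses (oO : open Omega) (cO : convex_set Omega).
Implicit Types (v w z p : 'rV[R[i]]_n).

Definition conv_pt x y (t : R) : 'rV[R[i]]_n := x + t%:C *: (y - x).

Lemma conv_ptE x y t : conv_pt x y t = (1 - t)%:C *: x + t%:C *: y.
Proof.
by rewrite /conv_pt scalerBr raddfB /= scalerBl scale1r addrA addrAC.
Qed.

Lemma conv_ptP x y t : Omega x -> Omega y -> 0 <= t -> t <= 1 -> Omega (conv_pt x y t).
Proof.
move=> Ox Oy t0 t1.
have t0' : 0 <= t%:C :> R[i] by rewrite ler0c.
have t1' : t%:C <= 1 :> R[i] by rewrite lecR.
have := cO (Itv01 t0' t1') (mem_set Oy) (mem_set Ox).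
move/set_mem; congr Omega; rewrite conv_ptE addrC raddfB /=.
by [].
Qed.

End ConvexDomain.

Section BoundaryDistance.
Variables (R : realType) (n : nat).
Variable Omega : set 'rV[R[i]]_n.
Hypotheses (oO : open Omega) (cO : convex_set Omega) (bO : boundary Omega !=set0).
Implicit Types (v w z p x y : 'rV[R[i]]_n).

Let interiorO : Omega° = Omega. Proof. exact/interior_id. Qed.

Lemma boundary_closure p : boundary Omega p -> closure Omega p.
Proof. by case. Qed.

Lemma boundary_notin p : boundary Omega p -> ~ Omega p.
Proof. by move=> [_ +]; rewrite interiorO. Qed.

Lemma boundaryP p : closure Omega p -> ~ Omega p -> boundary Omega p.
Proof. by move=> ? ?; split => //; rewrite interiorO. Qed.

Lemma conv_ptB x y (s t : R) : conv_pt x y s - conv_pt x y t = (s - t)%:C *: (y - x).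
Proof. by rewrite /conv_pt opprD addrACA subrr add0r -scalerBl rmorphB. Qed.

Lemma conv_pt0 x y : conv_pt x y (0 : R) = x.
Proof. by rewrite /conv_pt scale0r addr0. Qed.

Lemma conv_pt1 x y : conv_pt x y (1 : R) = y.
Proof. by rewrite /conv_pt scale1r subrKC. Qed.

Lemma segment_exit x y : Omega x -> ~ Omega y ->
  exists t : R, [/\ 0 <= t, t <= 1 & boundary Omega (conv_pt x y t)].
Proof.
move=> Ox Oy.
pose A := [set t : R | [/\ 0 <= t, t <= 1 & Omega (conv_pt x y t)]].
have A0 : A 0 by split => //; rewrite ?conv_pt0.
have hA : has_sup A by split; [exists 0|exists 1 => t []].
have s0 : 0 <= sup A by apply: sup_ubound; [case: hA|].
have s1 : sup A <= 1 by apply: sup_le_ub; [case: hA|move=> t []].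
have dn t s : enorm (conv_pt x y t - conv_pt x y s) = `|t - s| * enorm (y - x).
  by rewrite conv_ptB enormZ cabsR.
have N0 : 0 < enorm (y - x) + 1 by rewrite ltr_wpDl// enorm_ge0.
exists (sup A); split => //; apply: boundaryP.
  apply/closure_enormP => e e0.
  have [t At ht] := sup_adherent (divr_gt0 e0 N0) hA.
  have ts : t <= sup A by apply: sup_ubound; [case: hA|].
  exists (conv_pt x y t); first by case: At.
  rewrite dn distrC ger0_norm ?subr_ge0//.
  have : sup A - t < e / (enorm (y - x) + 1) by lra.
  rewrite ltr_pdivlMr//; apply: le_lt_trans; rewrite ler_wpM2l ?subr_ge0//.
  by rewrite lerDl.
move=> Os.
have s1' : sup A < 1.
  by rewrite lt_neqAle s1 andbT; apply/eqP => s1e; apply: Oy; rewrite -(conv_pt1 x y) -s1e.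
have /nbhs_enormP[e e0 He] : nbhs (conv_pt x y (sup A)) Omega by exact: open_nbhs_nbhs.
pose d := Num.min (1 - sup A) (e / (2 * (enorm (y - x) + 1))).
have d0 : 0 < d by rewrite lt_min subr_gt0 s1' divr_gt0// mulr_gt0.
have d1 : d <= 1 - sup A by rewrite ge_min lexx.
have d2 : d * (2 * (enorm (y - x) + 1)) <= e.
  by rewrite -ler_pdivlMr ?mulr_gt0// ge_min lexx orbT.
have : A (sup A + d).
  split; [by rewrite addr_ge0// ltW|lra|apply: He].
  rewrite dn addrAC subrr add0r gtr0_norm//.
  apply: lt_le_trans d2; rewrite ltr_pM2l//; have := enorm_ge0 (y - x); lra.
move=> Ad; have : sup A + d <= sup A by apply: sup_ubound; [case: hA|].
lra.
Qed.

Lemma bdist_le z w : boundary Omega w -> bdist Omega z <= enorm (z - w).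
Proof.
move=> bw; apply: ge_inf; last by exists w.
by exists 0 => _ [v _ <-]; exact: enorm_ge0.
Qed.

Lemma bdist_ge z r : (forall w, boundary Omega w -> r <= enorm (z - w)) -> r <= bdist Omega z.
Proof.
move=> H; apply: lb_le_inf; last by move=> _ [w bw <-]; exact: H.
by have [w bw] := bO; exists (enorm (z - w)), w.
Qed.

Lemma bdist_ge0 z : 0 <= bdist Omega z.
Proof. by apply: bdist_ge => w _; exact: enorm_ge0. Qed.

Lemma bdist_near z e : 0 < e -> exists2 w, boundary Omega w & enorm (z - w) < bdist Omega z + e.
Proof.
move=> e0; have [|_ [w bw <-] H] := @inf_adherent R [set enorm (z - w) | w in boundary Omega] e e0.
  split; first by have [w bw] := bO; exists (enorm (z - w)), w.
  by exists 0 => _ [v _ <-]; exact: enorm_ge0.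
by exists w.
Qed.

Lemma ball_bdist_sub z w : Omega z -> enorm (w - z) < bdist Omega z -> Omega w.
Proof.
move=> Oz wz; apply: contrapT => Ow.
have [t [t0 t1 bt]] := segment_exit Oz Ow.
have := bdist_le z bt; rewrite leNgt => /negP; apply.
rewrite -{1}(conv_pt0 z w) conv_ptB sub0r enormZ cabsR normrN ger0_norm//.
by apply: le_lt_trans wz; rewrite ler_piMl// enorm_ge0.
Qed.

Lemma bdist_ge_ball z r : (forall w, enorm (w - z) < r -> Omega w) -> r <= bdist Omega z.
Proof.
move=> H; apply: bdist_ge => w bw; rewrite leNgt; apply/negP => zw.
by apply: (boundary_notin bw); apply: H; rewrite enorm_distC.
Qed.

Lemma bdist_gt0 z : Omega z -> 0 < bdist Omega z.
Proof.
move=> Oz; have /nbhs_enormP[e e0 He] : nbhs z Omega by exact: open_nbhs_nbhs.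
by apply: lt_le_trans e0 _; exact: bdist_ge_ball.
Qed.

Lemma bdist_lip z w : bdist Omega z <= bdist Omega w + enorm (z - w).
Proof.
rewrite -lerBlDr; apply: bdist_ge => v bv; rewrite lerBlDr addrC.
by apply: le_trans (bdist_le z bv) _; exact: enorm_dist_triangle.
Qed.

(** The homothety of centre [x] and ratio [u] carries the ball of radius [r0] about [o] onto the
    ball in question, and convexity keeps its image in [Omega]. *)
Lemma conv_ball_sub x o (r0 u : R) w : Omega x -> 0 < u -> u <= 1 ->
  (forall v, enorm (v - o) < r0 -> Omega v) ->
  enorm (w - conv_pt x o u) < u * r0 -> Omega w.
Proof.
move=> Ox u0 u1 Ho wu.
pose o' := o + (u^-1)%:C *: (w - conv_pt x o u).
have -> : w = conv_pt x o' u.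
  rewrite /conv_pt /o' -addrA [_%:C *: _ - x]addrC addrA scalerDr scalerA -rmorphM /=.
  by rewrite divff ?gt_eqF// scale1r addrA subrKC.
apply: (conv_ptP cO Ox) => //; last exact: ltW.
apply: Ho; rewrite /o' addrC addKr enormZ cabsR gtr0_norm ?invr_gt0//.
by rewrite mulrC ltr_pdivrMr// mulrC.
Qed.

(** A ball about [x] is carried by a homothety centred at a point [q] of [Omega] close to [p]; for
    [q] close enough, the image ball contains the given point of the segment towards [p]. *)
Lemma closure_conv_in x p (t : R) : Omega x -> closure Omega p -> 0 <= t -> t < 1 ->
  Omega (conv_pt x p t).
Proof.
move=> Ox cp t0 t1.
have /nbhs_enormP[e e0 He] : nbhs x Omega by exact: open_nbhs_nbhs.
have tt : 0 < 1 - t by rewrite subr_gt0.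
have [->|tn0] := eqVneq t 0; first by rewrite conv_pt0.
have tp : 0 < t by rewrite lt_neqAle eq_sym tn0.
have [q Oq qp] := (closure_enormP Omega p).1 cp ((1 - t) * e / t) (divr_gt0 (mulr_gt0 tt e0) tp).
apply: (@conv_ball_sub q x e (1 - t)) => //; first lra.
have -> : conv_pt x p t - conv_pt q x (1 - t) = t%:C *: (p - q).
  by apply/rowP => j; rewrite !mxE raddfB /=; ring.
rewrite enormZ cabsR gtr0_norm// enorm_distC mulrC -ltr_pdivlMr//.
Qed.

End BoundaryDistance.

(** * Upper bound for the Kobayashi distance *)

Section KobayashiUpperBound.
Variables (R : realType) (n : nat).
Variable Omega : set 'rV[R[i]]_n.
Hypotheses (oO : open Omega) (cO : convex_set Omega) (bO : boundary Omega !=set0).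
Implicit Types (v w z p x y o : 'rV[R[i]]_n).

Lemma cabs_natr (m : nat) : cabs (m%:R : R[i]) = m%:R.
Proof. by rewrite -(rmorph_nat (@real_complex R)) cabsR ger0_norm. Qed.

Lemma poincare0_ge0 (a : R[i]) : cabs a < 1 -> 0 <= poincare0 a.
Proof.
move=> a1; rewrite /poincare0 -/(cabs a) mulr_ge0 ?invr_ge0// ln_ge0//.
have a0 := cabs_ge0 a.
rewrite ler_pdivlMr ?subr_gt0// mul1r; lra.
Qed.

Lemma disc_chain_ge0 z w s : disc_chain Omega z w s -> 0 <= s.
Proof.
by elim=> // phi a {}w {}s _ a1 _ s0; rewrite addr_ge0// poincare0_ge0// -ltc_cabs.
Qed.

Lemma kobayashi_le z w s : disc_chain Omega z w s -> kobayashi Omega z w <= s.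
Proof. by move=> H; apply: ge_inf => //; exists 0 => r /disc_chain_ge0. Qed.

(** [w] sits at parameter 1 of an affine disc of radius 2 centred at [z], that is, at 1/2 in the
    unit disc, so one link always costs [poincare0] of 1/2. *)
Definition disc_adjacent z w := forall t : R[i], cabs t < 2 -> Omega (z + t *: (w - z)).

Definition disc_prefix (m : nat) z w := forall y s, disc_chain Omega w y s ->
  disc_chain Omega z y (poincare0 (2^-1 : R[i]) * m%:R + s).

Lemma disc_prefix0 z : disc_prefix 0 z z.
Proof. by move=> y s; rewrite mulr0 add0r. Qed.

Lemma disc_prefix_trans m m' z w v : disc_prefix m z w -> disc_prefix m' w v ->
  disc_prefix (m + m') z v.
Proof. by move=> H H' y s /H' /H; rewrite natrD mulrDr addrA. Qed.

Lemma disc_prefix1 z w : disc_adjacent z w -> disc_prefix 1 z w.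
Proof.
move=> adj y s wy; pose phi (t : R[i]) := z + t *: (2 *: (w - z)).
have p0 : phi 0 = z by rewrite /phi scale0r addr0.
have p1 : phi 2^-1 = w by rewrite /phi scalerA mulVf// scale1r subrKC.
rewrite mulr1 -{1}p0; apply: disc_chain_cons; last by rewrite p1.
- move=> t; rewrite ltc_cabs => t1; split.
    by have [] := derivable_affine z (2 *: (w - z)) t.
  rewrite /phi scalerA; apply: adj.
  by rewrite cabsM cabs_natr mulrC gtr_pMr.
- rewrite ltc_cabs cabsV cabs_natr.
  by rewrite invf_lt1// ltr1n.
Qed.

Lemma disc_adjacent_ball z w rho : 0 < rho -> (forall v, enorm (v - z) < rho -> Omega v) ->
  2 * enorm (w - z) <= rho -> disc_adjacent z w.
Proof.
move=> rho0 H wz t t2; apply: H; rewrite addrC addKr enormZ.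
have [->|e0] := eqVneq (enorm (w - z)) 0; first by rewrite mulr0.
by apply: lt_le_trans wz; rewrite ltr_pM2r// lt_neqAle eq_sym e0 enorm_ge0.
Qed.

(** On the segment from [o] to [x], convexity provides balls whose radii shrink geometrically in
    proportion to the distance to [x], with one link between consecutive centres. The cost is
    proportional to the number of centres until that distance is comparable with [bdist Omega x],
    hence logarithmic. *)
Lemma kobayashi_upper_bound o (D : R) : Omega o -> exists C A : R, 0 < A /\
  forall x y, Omega x -> Omega y -> enorm (x - o) <= D -> enorm (y - o) <= D ->
   kobayashi Omega x y <= C - A * ln (bdist Omega x) - A * ln (bdist Omega y).
Proof.
move=> Oo.
have /nbhs_enormP[r0 r00 Hr] : nbhs o Omega by exact: open_nbhs_nbhs.
pose D' := `|D| + bdist Omega o + 1.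
have D'0 : 0 < D' by rewrite ltr_wpDl// addr_ge0// bdist_ge0.
have q0 : 0 < 2 * D' + r0 by rewrite addr_gt0// mulr_gt0.
(* With this ratio, twice the distance between consecutive centres is at most the smaller of the two
   radii, so there is a link in both directions. *)
pose th := 2 * D' / (2 * D' + r0).
have th0 : 0 < th by rewrite divr_gt0// mulr_gt0.
have th1 : th < 1 by rewrite ltr_pdivrMr// mul1r ltrDl.
have thE : (1 - th) * (2 * D') = th * r0 by rewrite /th; field; rewrite gt_eqF.
have lth : ln th < 0 by rewrite ln_lt0// th0.
clearbody th.
have c0 : 0 <= poincare0 (2^-1 : R[i]).
  apply: poincare0_ge0; rewrite cabsV cabs_natr.
  by rewrite invf_lt1// ltr1n.
set c := poincare0 _ in c0.
have near_o x : Omega x -> enorm (x - o) <= D -> exists2 J : nat,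
    J%:R <= 1 + (ln (4 * D') - ln (bdist Omega x)) / - ln th &
    disc_prefix J.+1 x o /\ disc_prefix J.+1 o x.
  move=> Ox xD.
  have d0 : 0 < bdist Omega x by exact: bdist_gt0.
  have xD' : enorm (o - x) <= D'.
    rewrite enorm_distC; apply: (le_trans xD); rewrite /D' -addrA.
    by apply: (le_trans (ler_norm _)); rewrite lerDl addr_ge0// bdist_ge0.
  have dD : bdist Omega x <= 4 * D'.
    have := bdist_lip bO x o; have := bdist_ge0 bO o; have := ler_norm D.
    move: xD D'0; rewrite /D'; clear; lra.
  have D4 : 0 < 4 * D' by rewrite mulr_gt0.
  have lg : 0 <= ln (4 * D') - ln (bdist Omega x) by rewrite subr_ge0 ler_ln ?posrE.
  have nlth : 0 < - ln th by rewrite oppr_gt0.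
  have thjE j : (th ^+ j * D' <= bdist Omega x / 4) =
      ((ln (4 * D') - ln (bdist Omega x)) / - ln th <= j%:R).
    have -> : (th ^+ j * D' <= bdist Omega x / 4) =
        (ln (th ^+ j * (4 * D')) <= ln (bdist Omega x)).
      rewrite ler_ln ?posrE ?mulr_gt0 ?exprn_gt0// ler_pdivlMr//.
      by congr (_ <= _); ring.
    rewrite lnM ?posrE ?exprn_gt0// lnXn// -mulr_natr ler_pdivrMr//.
    by apply/idP/idP; lra.
  have exJ : exists J : nat, th ^+ J * D' <= bdist Omega x / 4.
    exists (Num.bound ((ln (4 * D') - ln (bdist Omega x)) / - ln th)).
    by rewrite thjE; apply/ltW/archi_boundP; rewrite divr_ge0// ltW.
  pose J := ex_minn exJ; exists J.
    rewrite /J; case: ex_minnP => -[|m] hm mm.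
      by rewrite addr_ge0// divr_ge0// ltW.
    have : ~~ (th ^+ m * D' <= bdist Omega x / 4).
      by apply/negP => /mm; rewrite ltnn.
    rewrite thjE -ltNge => h.
    by rewrite -natr1 [X in X <= _]addrC lerD2l ltW.
  pose P j := conv_pt x o (th ^+ j).
  have thj j : 0 < th ^+ j by rewrite exprn_gt0.
  have thj1 j : th ^+ j <= 1 by rewrite exprn_ile1// ltW.
  have ballP j v : enorm (v - P j) < th ^+ j * r0 -> Omega v.
    by apply: (conv_ball_sub cO Ox).
  have dP j : 2 * enorm (P j - P j.+1) <= th ^+ j.+1 * r0.
    have -> : enorm (P j - P j.+1) = th ^+ j * ((1 - th) * enorm (o - x)).
      rewrite conv_ptB enormZ cabsR exprSr -[X in X - _]mulr1 -mulrBr.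
      by rewrite ger0_norm ?mulr_ge0 ?subr_ge0 ?(ltW th1) ?(ltW (thj j))// mulrA.
    rewrite exprSr mulrCA -mulrA ler_pM2l// -thE mulrCA.
    by rewrite ler_wpM2l ?subr_ge0 ?(ltW th1)// ler_pM2l.
  have P0 : P 0%N = o by rewrite /P expr0 conv_pt1.
  have pre j : disc_prefix j o (P j) /\ disc_prefix j (P j) o.
    elim: j => [|j [IH1 IH2]]; first by rewrite P0; split; exact: disc_prefix0.
    have fw : disc_prefix 1 (P j) (P j.+1).
      apply: disc_prefix1; apply: (disc_adjacent_ball (mulr_gt0 (thj j) r00) (ballP j)).
      rewrite enorm_distC; apply: (le_trans (dP j)).
      by rewrite exprSr ler_pM2r// ler_piMr// ltW.
    have bw : disc_prefix 1 (P j.+1) (P j).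
      apply: disc_prefix1.
      apply: (disc_adjacent_ball (mulr_gt0 (thj j.+1) r00) (ballP j.+1)).
      exact: dP.
    split; first by have := disc_prefix_trans IH1 fw; rewrite addn1.
    by have := disc_prefix_trans bw IH2; rewrite add1n.
  (* [P J] is so close to [x] that the ball of radius [bdist Omega x] about [x] supplies the last
     link in both directions. *)
  have xJ : enorm (x - P J) <= bdist Omega x / 4.
    rewrite -{1}(conv_pt0 x o) conv_ptB enormZ cabsR sub0r normrN gtr0_norm//.
    rewrite /J; case: ex_minnP => m hm _; apply: le_trans hm.
    by rewrite ler_pM2l.
  have ballx v : enorm (v - x) < bdist Omega x -> Omega v by exact: ball_bdist_sub.
  have ballJ v : enorm (v - P J) < bdist Omega x / 2 -> Omega v.
    move=> h; apply: ballx; apply: (le_lt_trans (enorm_dist_triangle v (P J) x)).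
    rewrite [enorm (P J - x)]enorm_distC; move: h xJ d0; clear; lra.
  have d20 : 0 < bdist Omega x / 2 by rewrite divr_gt0.
  have fw : disc_prefix 1 x (P J).
    apply: disc_prefix1; apply: (disc_adjacent_ball d0 ballx).
    by rewrite enorm_distC; move: xJ d0; clear; lra.
  have bw : disc_prefix 1 (P J) x.
    apply: disc_prefix1.
    by apply: (disc_adjacent_ball d20 ballJ); move: xJ d0; clear; lra.
  split; first by have := disc_prefix_trans fw (pre J).2; rewrite add1n.
  by have := disc_prefix_trans (pre J).1 bw; rewrite addn1.
(* [c / - ln th] is the cost per unit of logarithm; adding 1 makes [A] positive knowing only
   [0 <= c]. *)
pose A := (c + 1) / - ln th.
have A0 : 0 < A by rewrite divr_gt0// ?oppr_gt0// ltr_wpDl.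
exists (c * 4 + 2 * A * ln (4 * D')), A; split => // x y Ox Oy xD yD.
have dD z : enorm (z - o) <= D -> bdist Omega z <= 4 * D'.
  move=> zD; have := bdist_lip bO z o; have := bdist_ge0 bO o; have := ler_norm D.
  by move: zD D'0; rewrite /D'; clear; lra.
have [Jx hJx [px _]] := near_o x Ox xD; have [Jy hJy [_ py]] := near_o y Oy yD.
have D4 : 0 < 4 * D' by rewrite mulr_gt0.
have lgx : 0 <= ln (4 * D') - ln (bdist Omega x).
  by rewrite subr_ge0 ler_ln ?posrE ?dD// bdist_gt0.
have lgy : 0 <= ln (4 * D') - ln (bdist Omega y).
  by rewrite subr_ge0 ler_ln ?posrE ?dD// bdist_gt0.
have nlth : 0 < - ln th by rewrite oppr_gt0.
have := kobayashi_le (disc_prefix_trans px py (disc_chain_nil Oy)).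
move=> H; apply: (le_trans H); rewrite -/c addr0 natrD -[Jx.+1%:R]natr1 -[Jy.+1%:R]natr1.
set lx := ln (4 * D') - _ in hJx lgx; set ly := ln (4 * D') - _ in hJy lgy.
have -> : c * 4 + 2 * A * ln (4 * D') - A * ln (bdist Omega x) - A * ln (bdist Omega y) =
  c * 4 + A * lx + A * ly by rewrite /lx /ly; ring.
have cA (z : R) : 0 <= z -> c * (z / - ln th) <= A * z.
  move=> z0; have -> : A * z = ((c + 1) * z) / - ln th by rewrite /A mulrAC.
  by rewrite [c * _]mulrA ler_pM2r ?invr_gt0// ler_wpM2r// lerDl.
have := cA _ lgx; have := cA _ lgy.
have := ler_wpM2l c0 hJx; have := ler_wpM2l c0 hJy.
by rewrite !mulrDr !mulr1; lra.
Qed.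

End KobayashiUpperBound.

(** * Supporting functionals at boundary points *)

Section LineDerivative.
Variables (R : realType) (m : nat).
Implicit Types (rho : 'rV[R]_m -> R) (x w : 'rV[R]_m).

Lemma is_derive_line rho x w (t : R) : differentiable rho (x + t *: w) ->
  is_derive t 1 (fun s : R => rho (x + s *: w)) ('d rho (x + t *: w) w).
Proof.
move=> df.
have E : (fun h : R => h^-1 *: (((fun s : R => rho (x + s *: w)) \o shift t) (h *: 1) -
     rho (x + t *: w))) =
   (fun h : R => h^-1 *: ((rho \o shift (x + t *: w)) (h *: w) - rho (x + t *: w))).
  apply/funext => h /=; congr (_ *: (rho _ - _)).
  by rewrite /shift /= scalerDl addrCA (_ : h *: 1 = h)//; exact: mulr1.
have dv := @diff_derivable R _ _ rho _ w df.
split.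
  by rewrite /derivable E; exact: dv.
by rewrite /derive E -deriveE.
Qed.

Lemma holder_taylor rho x w (L alpha : R) : 0 <= L -> 0 < alpha ->
  (forall t : R, 0 <= t -> t <= 1 -> differentiable rho (x + t *: w)) ->
  (forall t : R, 0 <= t -> t <= 1 ->
     `|'d rho (x + t *: w) w - 'd rho x w| <= L * `|t *: w| `^ alpha * `|w|) ->
  rho (x + w) <= rho x + 'd rho x w + L * `|w| `^ alpha * `|w|.
Proof.
move=> L0 a0 df H.
pose g (s : R) := rho (x + s *: w); pose dg (s : R) := 'd rho (x + s *: w) w.
have dgs (s : R) : 0 <= s -> s <= 1 -> is_derive s 1 g (dg s).
  by move=> s0 s1; apply: is_derive_line; exact: df.
have [||c] := @MVT R g dg 0 1 ltr01.
- by move=> s; rewrite in_itv/= => /andP[s0 s1]; apply: dgs; exact: ltW.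
- apply: derivable_within_continuous => s; rewrite in_itv/= => /andP[s0 s1].
  by have [] := dgs s s0 s1.
rewrite in_itv/= => /andP[c0 c1].
rewrite /g scale1r scale0r addr0 subr0 mulr1 => E.
have -> : rho (x + w) = rho x + dg c by rewrite -E; ring.
rewrite -addrA lerD2l.
rewrite -lerBlDl; apply: (le_trans (ler_norm _)).
apply: (le_trans (H c (ltW c0) (ltW c1))).
rewrite ler_wpM2r// ler_wpM2l//; apply: ge0_ler_powR; rewrite ?nnegrE//; first exact: ltW.
by rewrite normrZ gtr0_norm// ler_piMl// ltW.
Qed.

Lemma first_order_positive rho x w : differentiable rho x -> 0 <= rho x ->
  0 < 'd rho x w ->
  exists2 s0 : R, 0 < s0 & forall s, 0 < s -> s < s0 -> 0 < rho (x + s *: w).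
Proof.
move=> df r0 dw.
have d0 : is_derive (0 : R) 1 (fun s : R => rho (x + s *: w)) ('d rho x w).
  have := @is_derive_line rho x w 0; rewrite scale0r addr0; exact.
have e0 : 0 < 'd rho x w / 2 by rewrite divr_gt0.
have [delta dd H] := is_derive_expansion d0 e0; exists delta => // s sp sd.
have := H s; rewrite gtr0_norm// => /(_ sd); rewrite add0r scale0r addr0.
rewrite ler_norml => /andP[h _].
have := mulr_gt0 dw sp; move: h r0.
set D := 'd rho x w * s; set D' := 'd rho x w / 2 * s.
have -> : D' = D / 2 by rewrite /D' mulrAC.
have aux (a b c : R) : - (c / 2) <= a - b - c -> 0 <= b -> 0 < c -> 0 < a.
  by clear; lra.
exact: aux.
Qed.

End LineDerivative.

Section RealLinearForms.
Variables (R : realType) (n : nat).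
Implicit Types (v w : 'rV[R[i]]_n).

Lemma realifyZ (t : R) v : realify (t%:C *: v) = t *: realify v.
Proof.
apply/rowP => k; rewrite /realify !mxE; case: splitP => j _; rewrite !mxE;
  by case: (v 0 j) => a b /=; ring.
Qed.

Lemma realifyB v w : realify (v - w) = realify v - realify w.
Proof.
apply/rowP => k; rewrite /realify !mxE; case: splitP => j _; rewrite !mxE;
  by case: (v 0 j) => a b; case: (w 0 j) => c d /=; ring.
Qed.

Lemma realifyK v : complexify (realify v) = v.
Proof.
apply/rowP => j; rewrite /complexify mxE /realify row_mxEl row_mxEr !mxE.
by case: (v 0 j).
Qed.

(** The complex-linear form is v |-> l v - i l (i v), evaluated at the basis vectors. *)
Lemma real_linear_cform (l : 'rV[R[i]]_n -> R) :
  (forall v w, l (v + w) = l v + l w) -> (forall (t : R) v, l (t%:C *: v) = t * l v) ->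
  exists c : 'I_n -> R[i], forall v, complex.Re (cform c v) = l v.
Proof.
move=> lD lZ.
pose e j : 'rV[R[i]]_n := delta_mx 0 j.
exists (fun j => l (e j) -i* l ('i *: e j)) => v.
have l0 : l 0 = 0 by rewrite -[0 in LHS](scale0r 0) -(rmorph0 (@real_complex R)) lZ mul0r.
have ->  : l v = \sum_j l (v 0 j *: e j).
  rewrite {1}[v]row_sum_delta; elim/big_ind2: _ => // x1 x2 y1 y2 <- <-; exact: lD.
rewrite /cform raddf_sum; apply: eq_bigr => j _.
have -> : v 0 j *: e j = (complex.Re (v 0 j))%:C *: e j + (complex.Im (v 0 j))%:C *: ('i *: e j).
  rewrite scalerA -scalerDl; congr (_ *: _); case: (v 0 j) => a b /=.
  by apply/eqP; rewrite eq_complex /=; apply/andP; split; apply/eqP; ring.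
rewrite lD !lZ; case: (v 0 j) => a b /=; ring.
Qed.

Lemma Im_cform c v : complex.Im (cform c v) = - complex.Re (cform c ('i *: v)).
Proof. by rewrite cformZ; case: (cform c v) => a b /=; ring. Qed.

Lemma norm_realify_le v : `|realify v| <= enorm v.
Proof.
rewrite [leLHS]/Num.norm /= mx_normrE; apply/bigmax_leP; split; first exact: enorm_ge0.
by move=> [i k] _ /=; rewrite ord1; exact: normr_realify_le.
Qed.

End RealLinearForms.

Section BoundaryData.
Variables (R : realType) (n : nat).
Variable Omega : set 'rV[R[i]]_n.
Hypotheses (oO : open Omega) (cO : convex_set Omega).
Implicit Types (v w z p : 'rV[R[i]]_n).

Lemma nbhs_realify (U : set 'rV[R]_(n + n)) p : nbhs (realify p) U ->
  exists2 e : R, 0 < e & forall z, enorm (z - p) < e -> U (realify z).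
Proof.
move=> /nbhs_normP[e /= e0 He]; exists e => // z zp; apply: He.
rewrite /= -realifyB; apply: le_lt_trans (norm_realify_le _) _.
by rewrite enorm_distC.
Qed.

Lemma enorm_le_realify v : enorm v <= (n + n)%:R * `|realify v|.
Proof.
apply: (le_trans (enorm_le_sum v)).
have le_k k : `|realify v 0 k| <= `|realify v|.
  rewrite [leRHS]/Num.norm /= mx_normrE; apply/bigmax_geP; right => /=.
  by exists (0, k).
apply: (@le_trans _ _ (\sum_j (`|realify v| + `|realify v|))).
  apply: ler_sum => j _; apply: (le_trans (cabs_le_ReIm _)).
  have := le_k (lshift n j); have := le_k (rshift n j).
  by rewrite /realify row_mxEl row_mxEr !mxE => h1 h2; exact: lerD.
by rewrite sumr_const card_ord -mulr2n -mulrnA mul2n -addnn mulr_natl.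
Qed.

Variables (rho : 'rV[R]_(n + n) -> R).

Let D z v := 'd rho (realify z) (realify v).

Let DD z v w : D z (v + w) = D z v + D z w.
Proof. by rewrite /D realifyD linearD. Qed.

Let DZ z (t : R) v : D z (t%:C *: v) = t * D z v.
Proof. by rewrite /D realifyZ linearZ. Qed.

(** If the differential were positive on [w - p] for some [w] in [Omega], then [rho] would be
    positive at the points of the segment from [p] to [w] near [p], which convexity places in
    [Omega]. *)
Lemma boundary_gradient p : boundary Omega p ->
  (\forall x \near realify p, differentiable rho x /\ (Omega (complexify x) <-> rho x < 0)) ->
  rho (realify p) = 0 /\ forall w, Omega w -> D p (w - p) <= 0.
Proof.
move=> bp near_p; have [r r0 Hr] := nbhs_realify near_p.
have Or z : enorm (z - p) < r -> Omega z <-> rho (realify z) < 0.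
  by move=> /Hr[_]; rewrite realifyK.
have [dp _] := Hr p ltac:(by rewrite subrr enorm0).
have nO := boundary_notin oO bp.
have r0' : 0 <= rho (realify p).
  rewrite leNgt; apply/negP => h; apply: nO; apply/Or => //.
  by rewrite subrr enorm0.
split.
  apply/eqP; rewrite eq_le r0' andbT leNgt; apply/negP => h.
  have cont := differentiable_continuous dp.
  have /nbhs_realify[e e0 He] : nbhs (realify p) [set x | 0 < rho x].
    exact: (cvgr_gt _ cont).
  have er0 : 0 < Num.min e r by rewrite lt_min e0.
  have [z Oz] := (closure_enormP Omega p).1 (boundary_closure bp) _ er0.
  rewrite lt_min => /andP[ze zr].
  have := He z ze; have /Or := zr; move=> [/(_ Oz) h1 _] /=.
  by rewrite ltNge (ltW h1).
move=> w Ow; rewrite leNgt; apply/negP => Dw.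
have [s0 s00 Hs] := first_order_positive dp r0' Dw.
have N0 : 0 < enorm (w - p) + 1 by rewrite ltr_wpDl// enorm_ge0.
pose s := Num.min (Num.min (s0 / 2) (r / (2 * (enorm (w - p) + 1)))) (1 / 2).
have sp : 0 < s by rewrite !lt_min !divr_gt0// mulr_gt0.
have s1 : s <= 1 / 2 by rewrite ge_min lexx orbT.
have s2 : s <= s0 / 2 by rewrite !ge_min lexx.
have s3 : s * (2 * (enorm (w - p) + 1)) <= r.
  by rewrite -ler_pdivlMr ?mulr_gt0// !ge_min lexx orbT.
have := Hs s sp; rewrite -realifyZ -realifyD => H.
have ss0 : s < s0 by lra.
have := H ss0; apply/negP; rewrite -leNgt; apply: ltW.
apply/Or.
  rewrite addrC addKr enormZ cabsR gtr0_norm//.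
  by apply: lt_le_trans s3; rewrite ltr_pM2l//; have := enorm_ge0 (w - p); lra.
have := @closure_conv_in _ _ Omega oO cO w p (1 - s) Ow (boundary_closure bp).
have -> : conv_pt w p (1 - s) = p + s%:C *: (w - p).
  by rewrite -/(conv_pt p w s) !conv_ptE subKr addrC.
by apply; lra.
Qed.

End BoundaryData.

Section LocalData.
Variables (R : realType) (n : nat).
Variable Omega : set 'rV[R[i]]_n.
Hypotheses (oO : open Omega) (cO : convex_set Omega).
Implicit Types (v w z p : 'rV[R[i]]_n).

(** Collects what is used of a defining function, in Euclidean norms and without real coordinates.
    The vector [e0] is an inward direction, transversal to the boundary at all nearby points with
    uniform slope [m]. *)
Lemma local_data p (alpha : R) : 0 < alpha -> boundary Omega p ->
  (exists rho, defining_function Omega p rho /\ holder_differential alpha p rho) ->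
  exists (f : 'rV[R[i]]_n -> R) (D : 'rV[R[i]]_n -> 'rV[R[i]]_n -> R) (r L m M : R) e0,
  [/\ [/\ 0 < r, 0 < L, 0 < m & 0 < M],
      (forall z v w, D z (v + w) = D z v + D z w) /\
      (forall z (t : R) v, D z (t%:C *: v) = t * D z v),
      forall z, enorm (z - p) < r -> [/\ Omega z <-> f z < 0,
         D z e0 <= - m & forall v, `|D z v| <= M * enorm v],
      forall z w, enorm (z - p) < r -> enorm (z + w - p) < r ->
         f (z + w) <= f z + D z w + L * (enorm w) `^ alpha * enorm w
    & forall q, enorm (q - p) < r -> boundary Omega q ->
         f q = 0 /\ forall w, Omega w -> D q (w - q) <= 0].
Proof.
move=> a0 bp [rho [def_rho [U nU [L0 HL]]]].
pose D z v := 'd rho (realify z) (realify v).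
have DD z v w : D z (v + w) = D z v + D z w by rewrite /D realifyD linearD.
have DZ z (t : R) v : D z (t%:C *: v) = t * D z v by rewrite /D realifyZ linearZ.
have near2 : \forall x \near realify p, U x /\
   [/\ differentiable rho x, exists u, 'd rho x u != 0
      & Omega (complexify x) <-> rho x < 0].
  by apply: filterI => //; apply: filterS def_rho => x [].
have [r1 r10 Hr1] := nbhs_realify near2.
pose L := `|L0| + 1; have Lp : 0 < L by rewrite ltr_wpDl.
have L0L : L0 <= L by rewrite (le_trans (ler_norm _))// lerDl.
have [c Hc] := real_linear_cform (DD p) (DZ p).
pose M0 := \sum_j cabs (c j).
have M00 : 0 <= M0 by apply: sumr_ge0 => j _; exact: cabs_ge0.
have Dp_le v : `|D p v| <= M0 * enorm v.
  by rewrite -Hc; apply: (le_trans (Re_le_cabs _)); exact: cabs_cform_le.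
have [e0 e0D] : exists e0, D p e0 < 0.
  have [_ [_ [v dv] _]] := Hr1 p ltac:(by rewrite subrr enorm0).
  have E : D p (complexify v) = 'd rho (realify p) v by rewrite /D complexifyK.
  have [h|h] := ltP (D p (complexify v)) 0; first by exists (complexify v).
  exists (- complexify v).
  have -> : - complexify v = (-1 : R)%:C *: complexify v.
    by rewrite raddfN /= scaleN1r.
  by rewrite DZ mulN1r oppr_lt0 lt_neqAle h andbT eq_sym E.
pose m := - D p e0 / 2; have m0 : 0 < m by rewrite divr_gt0// oppr_gt0.
have N0 : 0 < enorm e0 + 1 by rewrite ltr_wpDl// enorm_ge0.
(* Within distance [r] of [p], Hoelder continuity changes [D z e0] by at most [m], which is half of
   [- D p e0]. *)
pose t := m / (L * (enorm e0 + 1)); have t0 : 0 < t by rewrite divr_gt0// mulr_gt0.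
pose r := Num.min r1 (t `^ (alpha^-1)).
have rp : 0 < r by rewrite lt_min r10 powR_gt0.
have rr1 : r <= r1 by rewrite ge_min lexx.
have rt (s : R) : 0 <= s -> s < r -> s `^ alpha <= t.
  move=> s0 sr; apply: (@le_trans _ _ ((t `^ alpha^-1) `^ alpha)).
    apply: ge0_ler_powR; rewrite ?nnegrE// ?powR_ge0//; first exact: ltW.
    by apply: (le_trans (ltW sr)); rewrite ge_min lexx orbT.
  by rewrite -powRrM mulVf ?gt_eqF// powRr1// ltW.
have hold z z' v : enorm (z - p) < r -> enorm (z' - p) < r ->
    `|D z v - D z' v| <= L * enorm (z - z') `^ alpha * enorm v.
  move=> zp z'p.
  have [Uz _] := Hr1 z (lt_le_trans zp rr1); have [Uz' _] := Hr1 z' (lt_le_trans z'p rr1).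
  apply: (le_trans (HL _ _ _ Uz Uz')).
  apply: (@le_trans _ _ (L * `|realify z - realify z'| `^ alpha * `|realify v|)).
    by rewrite ler_wpM2r// ler_wpM2r ?powR_ge0.
  have h1 : `|realify z - realify z'| `^ alpha <= enorm (z - z') `^ alpha.
    apply: ge0_ler_powR; rewrite ?nnegrE ?enorm_ge0//; first exact: ltW.
    by rewrite -realifyB norm_realify_le.
  apply: ler_pM => //; last exact: norm_realify_le.
    by rewrite mulr_ge0 ?powR_ge0// ltW.
  by rewrite ler_pM2l.
exists (rho \o realify), D, r, L, m, (M0 + L * t), e0; split => //.
- by split=> //; rewrite ltr_wpDl// mulr_gt0.
- move=> z zp; have [_ [_ _ Hz]] := Hr1 z (lt_le_trans zp rr1).
  have h v : `|D z v - D p v| <= L * t * enorm v.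
    apply: (le_trans (hold z p v zp _)); first by rewrite subrr enorm0.
    by rewrite ler_wpM2r ?enorm_ge0// ler_pM2l// rt// enorm_ge0.
  rewrite realifyK in Hz; split => //.
    have := h e0; rewrite ler_norml => /andP[_ h1].
    have h2 : L * t * enorm e0 <= m.
      have -> : m = L * t * (enorm e0 + 1).
        by rewrite /t; field; rewrite !gt_eqF.
      by apply: ler_wpM2l; rewrite ?lerDl// mulr_ge0// ltW.
    have aux (x y b : R) : x - y <= b -> b <= - y / 2 -> x <= - (- y / 2).
      by clear; lra.
    exact: aux h1 h2.
  move=> v; have -> : D z v = D p v + (D z v - D p v) by rewrite addrC subrK.
  apply: (le_trans (ler_normD _ _)); rewrite mulrDl; exact: lerD.
- move=> z w zp zwp /=; rewrite realifyD.
  have inball (s : R) : 0 <= s -> s <= 1 -> enorm (z + s%:C *: w - p) < r.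
    move=> s0 s1.
    have -> : z + s%:C *: w - p = (1 - s)%:C *: (z - p) + s%:C *: (z + w - p).
      by rewrite -conv_ptE /conv_pt opprB addrA subrK [z + w]addrC addrK addrAC.
    apply: (le_lt_trans (enormD _ _)); rewrite !enormZ !cabsR !ger0_norm ?subr_ge0//.
    have h1 : (1 - s) * enorm (z - p) <= (1 - s) * Num.max (enorm (z - p)) (enorm (z + w - p)).
      by rewrite ler_wpM2l ?subr_ge0// le_max lexx.
    have h2 : s * enorm (z + w - p) <= s * Num.max (enorm (z - p)) (enorm (z + w - p)).
      by rewrite ler_wpM2l// le_max lexx orbT.
    apply: (le_lt_trans (lerD h1 h2)); rewrite -mulrDl subrK mul1r gt_max zp zwp//.
  have inz : enorm (z - p) < r by [].
  have := @holder_taylor R _ rho (realify z) (realify w) L alpha (ltW Lp) a0.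
  have ltr (s : R) : 0 <= s -> s <= 1 -> differentiable rho (realify z + s *: realify w).
    move=> s0 s1; rewrite -realifyZ -realifyD.
    by have [_ [? _ _]] := Hr1 _ (lt_le_trans (inball s s0 s1) rr1).
  move=> /(_ ltr) H; apply: (le_trans (H _)).
    move=> s s0 s1; rewrite -realifyZ -realifyD.
    have [Us _] := Hr1 _ (lt_le_trans (inball s s0 s1) rr1).
    have [Uz _] := Hr1 z (lt_le_trans zp rr1).
    apply: (le_trans (HL _ _ _ Us Uz)); rewrite realifyD addrAC subrr add0r.
    by rewrite ler_wpM2r// ler_wpM2r ?powR_ge0.
  rewrite lerD2l; apply: ler_pM => //; last exact: norm_realify_le.
    by rewrite mulr_ge0 ?powR_ge0// ltW.
  rewrite ler_pM2l//; apply: ge0_ler_powR; rewrite ?nnegrE ?enorm_ge0 ?norm_realify_le//.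
  exact: ltW.
move=> q qp bq; apply: (boundary_gradient oO cO) => //.
have qr : 0 < r - enorm (q - p) by rewrite subr_gt0.
apply/nbhs_normP; exists ((r - enorm (q - p)) / (n + n).+1%:R).
  by rewrite /= divr_gt0.
move=> x /= qx.
have xp : enorm (complexify x - p) < r.
  apply: (le_lt_trans (enorm_dist_triangle _ q _)).
  suff : enorm (complexify x - q) < r - enorm (q - p) by lra.
  apply: (le_lt_trans (enorm_le_realify _)).
  rewrite realifyB complexifyK distrC.
  move: qx; rewrite ltr_pdivlMr// => qx.
  by apply: le_lt_trans qx; rewrite mulrC ler_wpM2l// ler_nat.
have := Hr1 _ (lt_le_trans xp rr1); rewrite complexifyK => -[_ [h1 _ h2]].
by split.
Qed.

End LocalData.

Section LocalFrame.
Variables (R : realType) (n : nat).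
Variable Omega : set 'rV[R[i]]_n.
Hypotheses (oO : open Omega) (cO : convex_set Omega).
Implicit Types (v w z p q : 'rV[R[i]]_n).

Definition support_form p (c : 'I_n -> R[i]) :=
  forall w, Omega w -> 0 <= complex.Re (cform c (w - p)).

Lemma cabs_cform_real_le (c : 'I_n -> R[i]) (B : R) v :
  (forall w, `|complex.Re (cform c w)| <= B * enorm w) ->
  cabs (cform c v) <= 2 * B * enorm v.
Proof.
move=> H; apply: (le_trans (cabs_le_ReIm _)).
have h1 := H v; have := H ('i *: v).
have -> : enorm ('i *: v) = enorm v.
  have ci : cabs ('i : R[i]) = 1 by rewrite cabs_def /= expr0n add0r expr1n sqrtr1.
  by rewrite enormZ ci mul1r.
rewrite -normrN -Im_cform => h2.
by rewrite -mulrA mulr_natl mulr2n lerD.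
Qed.

(* The last estimate is Hoelder continuity of the normal at a point [q'] lying almost
   on the supporting hyperplane at [q]; integer powers of [s] avoid real exponents. *)
Lemma local_frame p (alpha : R) : 0 < alpha -> boundary Omega p ->
  (exists rho, defining_function Omega p rho /\ holder_differential alpha p rho) ->
  exists (c : 'rV[R[i]]_n -> 'I_n -> R[i]) (r M K s0 : R) (N : nat) e0,
  [/\ [/\ 0 < r, 0 < M, 0 < K & 0 < s0],
    forall q, boundary Omega q -> enorm (q - p) < r ->
      [/\ support_form q (c q), forall v, cabs (cform (c q) v) <= M * enorm v
        & complex.Re (cform (c q) e0) = 1]
  & forall q q', boundary Omega q -> boundary Omega q' ->
      enorm (q - p) < r -> enorm (q' - p) < r ->
      forall s, 0 < s -> s <= s0 ->
      complex.Re (cform (c q) (q' - q)) <= s ^+ N.+1 ->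
      forall v, cabs (cform (c q) v - cform (c q') v) <= K * s * enorm v].
Proof.
move=> a0 bp Hrho.
have [f [D [r [L [m [M1 [e0 [[r0 L0 m0 M10] [DD DZ] Hz taylor Hq]]]]]]]] :=
  local_data oO cO a0 bp Hrho.
(* Normalising by the value at [e0] makes the functionals at different boundary points comparable;
   the negative denominator makes [l q] nonnegative on the translate of [Omega] by [- q]. *)
pose l z v := D z v / D z e0.
have lD z v w : l z (v + w) = l z v + l z w by rewrite /l DD mulrDl.
have lZ z (t : R) v : l z (t%:C *: v) = t * l z v by rewrite /l DZ mulrA.
pose c z := projT1 (cid (real_linear_cform (lD z) (lZ z))).
have cE z v : complex.Re (cform (c z) v) = l z v by rewrite /c; case: cid => cc /= ->.
have De0 z : enorm (z - p) < r -> D z e0 < 0.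
  by move=> /Hz[_ h _]; apply: (le_lt_trans h); rewrite oppr_lt0.
have DE z v : enorm (z - p) < r -> D z v = l z v * D z e0.
  by move=> zr; rewrite /l divfK// lt_eqF// De0.
have le0 z : enorm (z - p) < r -> l z e0 = 1.
  by move=> zr; rewrite /l divff// lt_eqF// De0.
pose M2 := M1 / m; have M20 : 0 < M2 by rewrite divr_gt0.
have lM z v : enorm (z - p) < r -> `|l z v| <= M2 * enorm v.
  move=> zr; have [_ h1 h2] := Hz z zr.
  have -> : M2 * enorm v = (M1 * enorm v) * m^-1 by rewrite /M2 mulrAC.
  rewrite /l normrM normfV; apply: (ler_pM _ _ (h2 v)); rewrite ?invr_ge0//.
  rewrite lef_pV2 ?posrE//; last by rewrite normr_gt0 lt_eqF// De0.
  by rewrite ltr0_norm ?De0// lerNr.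
have l_ge0 q w : boundary Omega q -> enorm (q - p) < r -> Omega w -> 0 <= l q (w - q).
  move=> bq qr Ow; have [_ h] := Hq q qr bq.
  by rewrite /l mulr_le0// ?h// invr_le0 ltW// De0.
(* For s <= 1 this gives (s ^ N) ^ alpha <= s, so a displacement of size s ^ N has a Taylor
   remainder of order s ^ (N + 1). *)
have [N0 Na] : exists N0 : nat, 1 <= N0.+1%:R * alpha.
  exists (Num.bound alpha^-1); rewrite -ler_pdivrMr// div1r.
  apply: ltW; apply: (lt_le_trans (archi_boundP _)); first by rewrite invr_ge0 ltW.
  by rewrite ler_nat.
set N := N0.+1 in Na.
pose E := enorm e0; have E0 : 0 <= E by exact: enorm_ge0.
pose B := 1 + M2 * E; have B0 : 0 < B by rewrite ltr_pwDl// mulr_ge0// ltW.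
have B10 : 0 < B + 1 by rewrite addr_gt0.
pose Q := L * (B + 1) `^ alpha * (B + 1).
have Q0 : 0 < Q by rewrite !mulr_gt0// powR_gt0.
pose K1 := (Q + 1) / m; have K10 : 0 < K1 by rewrite divr_gt0// addr_gt0.
have K1E0 : 0 < K1 * E + 1 by rewrite ltr_wpDl// mulr_ge0// ltW.
pose s0 := Num.min (Num.min 1 (1 / (K1 * E + 1))) (r / (4 * (B + 1))).
have s00 : 0 < s0 by rewrite !lt_min ltr01 !divr_gt0// mulr_gt0.
exists c, (r / 2), (2 * M2), (2 * (1 + K1)), s0, N, e0.
have rr q : enorm (q - p) < r / 2 -> enorm (q - p) < r.
  by move=> h; apply: (lt_le_trans h); rewrite ler_pdivrMr// ler_peMr ?ltW// ltrDr.
split.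
- by split; [exact: divr_gt0|exact: mulr_gt0|apply: mulr_gt0 => //; exact: addr_gt0|].
- move=> q bq /rr qr; split.
  + by move=> w Ow; rewrite cE; exact: l_ge0.
  + by move=> v; apply: cabs_cform_real_le => w; rewrite cE; exact: lM.
  + by rewrite cE le0.
move=> q q' bq bq' /rr qr q'r2 s sp ss0 Hs.
have q'r := rr _ q'r2.
rewrite cE in Hs.
have s1 : s <= 1 by apply: (le_trans ss0); rewrite !ge_min lexx.
have s2 : s * (K1 * E + 1) <= 1.
  rewrite -ler_pdivlMr//; apply: (le_trans ss0); by rewrite !ge_min lexx orbT.
have s3 : s * (4 * (B + 1)) <= r.
  by rewrite -ler_pdivlMr ?mulr_gt0//; apply: (le_trans ss0); rewrite !ge_min lexx orbT.
have sN0 : 0 < s ^+ N by rewrite exprn_gt0.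
have sNs : s ^+ N <= s by rewrite /N exprS ler_piMr ?(ltW sp)// exprn_ile1// ltW.
have half v : enorm v <= 1 -> l q v - l q' v <= (1 + K1) * s.
  (* The part of [v] tangential at [q']: its value under [l q] is exactly the difference of the two
     functionals at [v]. *)
  move=> v1; pose v' := v - (l q' v)%:C *: e0.
  have lq'v' : l q' v' = 0.
    by rewrite /v' -scaleN1r -(rmorphN1 (@real_complex R)) lD lZ lZ le0// mulr1 mulN1r subrr.
  have lqv' : l q v' = l q v - l q' v.
    by rewrite /v' -scaleN1r -(rmorphN1 (@real_complex R)) lD lZ lZ le0// mulr1 mulN1r.
  have v'B : enorm v' <= B.
    apply: (le_trans (enormD _ _)); rewrite enormN enormZ cabsR; apply: lerD => //.
    rewrite ler_wpM2r//; apply: (le_trans (lM q' v q'r)).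
    by rewrite ler_piMr// ltW.
  (* From [q'], move tangentially by order s ^ N and inward by order s ^ (N + 1), with [K1] large
     enough to beat the Taylor remainder. The end point lies in [Omega], so [l q] is nonnegative at
     it relative to [q]; dividing by s ^ N gives the estimate. *)
  pose w := (- s ^+ N)%:C *: v' + (K1 * s ^+ N.+1)%:C *: e0.
  have wE : enorm w <= s ^+ N * (B + 1).
    apply: (le_trans (enormD _ _)); rewrite !enormZ !cabsR normrN.
    rewrite !ger0_norm ?(ltW sN0)//; last by rewrite mulr_ge0 ?exprn_ge0// ltW.
    rewrite mulrDr mulr1; apply: lerD; first by rewrite ler_pM2l.
    rewrite exprSr mulrCA -[leRHS]mulr1 -mulrA ler_pM2l//.
    apply: le_trans s2; rewrite mulrAC [s * _]mulrC ler_wpM2r ?(ltW sp)//.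
    by rewrite lerDl.
  have wr : enorm (q' + w - p) < r.
    rewrite addrAC; apply: (le_lt_trans (enormD _ _)).
    have : enorm w <= r / 4.
      apply: (le_trans wE); apply: (@le_trans _ _ (s * (B + 1))).
        by rewrite ler_wpM2r// ltW.
      by rewrite ler_pdivlMr// -mulrA [(B + 1) * 4]mulrC.
    by move: q'r2 r0; clear; lra.
  have lw k : enorm (k - p) < r -> l k w = - s ^+ N * l k v' + K1 * s ^+ N.+1.
    by move=> kr; rewrite /w lD !lZ le0// mulr1.
  have Ow : Omega (q' + w).
    have [-> _ _] := Hz _ wr.
    apply: (le_lt_trans (taylor q' w q'r wr)).
    have [-> _] := Hq q' q'r bq'.
    rewrite add0r DE// lw// lq'v' mulr0 add0r.
    have pw : L * enorm w `^ alpha * enorm w <= Q * s ^+ N.+1.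
      have pw1 : enorm w `^ alpha <= s * (B + 1) `^ alpha.
        apply: (@le_trans _ _ ((s ^+ N * (B + 1)) `^ alpha)).
          by apply: ge0_ler_powR; rewrite ?nnegrE ?enorm_ge0 ?mulr_ge0 ?(ltW sN0) ?(ltW a0) ?(ltW B10).
        rewrite powRM ?(ltW sN0) ?(ltW B10)// ler_wpM2r ?powR_ge0//.
        rewrite -powR_mulrn ?(ltW sp)// -powRrM -[leRHS]powRr1 ?(ltW sp)//.
        by apply: ger_powR => //; rewrite sp.
      have -> : Q * s ^+ N.+1 = L * (s * (B + 1) `^ alpha) * (s ^+ N * (B + 1)).
        by rewrite /Q exprS; ring.
      by apply: ler_pM; rewrite ?enorm_ge0 ?mulr_ge0 ?powR_ge0 ?(ltW L0)// ler_pM2l.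
    have sN1 : 0 < s ^+ N.+1 by rewrite exprn_gt0.
    have [_ h _] := Hz q' q'r.
    have h2 : K1 * s ^+ N.+1 * D q' e0 <= K1 * s ^+ N.+1 * - m.
      by rewrite ler_pM2l// mulr_gt0.
    have h3 : K1 * s ^+ N.+1 * - m = - (Q * s ^+ N.+1 + s ^+ N.+1).
      by rewrite /K1; field; rewrite gt_eqF.
    rewrite h3 in h2; apply: (le_lt_trans (lerD h2 pw)).
    by rewrite opprD addrAC addNr add0r oppr_lt0.
  have := l_ge0 q _ bq qr Ow.
  have -> : q' + w - q = (q' - q) + w by rewrite addrAC.
  rewrite lD lw// lqv' => h.
  have h4 : s ^+ N * (l q v - l q' v) <= s ^+ N * ((1 + K1) * s).
    have -> : s ^+ N * ((1 + K1) * s) = s ^+ N.+1 + K1 * s ^+ N.+1 by rewrite exprSr; ring.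
    have aux (x y u k : R) : 0 <= x + (- y + k) -> x <= u -> y <= u + k by clear; lra.
    by apply: aux Hs; rewrite -mulNr.
  by rewrite -(ler_pM2l sN0).
have full v : `|l q v - l q' v| <= (1 + K1) * s * enorm v.
  have [->|v0] := eqVneq v 0.
    rewrite -(scale0r 0) -(rmorph0 (@real_complex R)) !lZ !mul0r subrr normr0.
    by rewrite !mulr_ge0 ?enorm_ge0// ltW// addr_gt0.
  have ev : 0 < enorm v by rewrite enorm_gt0.
  have half2 w : enorm w <= enorm v -> l q w - l q' w <= (1 + K1) * s * enorm v.
    move=> wv; have := half ((enorm v)^-1%:C *: w).
    rewrite enormZ cabsR gtr0_norm ?invr_gt0// mulrC ler_pdivrMr// mul1r => /(_ wv).
    by rewrite !lZ -mulrBr mulrC ler_pdivrMr.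
  rewrite ler_norml; apply/andP; split; last exact: half2.
  have := half2 (- v); rewrite enormN lexx => /(_ isT).
  rewrite -scaleN1r -(rmorphN1 (@real_complex R)) !lZ.
  have aux (x y u : R) : -1 * x - -1 * y <= u -> - u <= x - y by clear; lra.
  exact: aux.
move=> v.
have -> : cform (c q) v - cform (c q') v = cform (fun j => c q j - c q' j) v.
  by rewrite /cform -sumrB; apply: eq_bigr => j _; rewrite mulrBr.
rewrite -[2 * _ * s]mulrA; apply: cabs_cform_real_le => w.
have -> : cform (fun j => c q j - c q' j) w = cform (c q) w - cform (c q') w.
  by rewrite /cform -sumrB; apply: eq_bigr => j _; rewrite mulrBr.
by rewrite raddfB /= !cE.
Qed.

End LocalFrame.

Section Tangency.
Variables (R : realType) (n : nat).
Variable Omega : set 'rV[R[i]]_n.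
Hypotheses (oO : open Omega) (cO : convex_set Omega).
Implicit Types (v w z p q : 'rV[R[i]]_n).

Lemma first_order_negative m (rho : 'rV[R]_m -> R) (x w : 'rV[R]_m) :
  differentiable rho x -> rho x <= 0 -> 'd rho x w < 0 ->
  exists2 s0 : R, 0 < s0 & forall s, 0 < s -> s < s0 -> rho (x + s *: w) < 0.
Proof.
move=> df r0 dw.
have d0 : is_derive (0 : R) 1 (fun s : R => rho (x + s *: w)) ('d rho x w).
  have := @is_derive_line _ _ rho x w 0; rewrite scale0r addr0; exact.
have e0 : 0 < - 'd rho x w / 2 by rewrite divr_gt0// oppr_gt0.
have [delta dd H] := is_derive_expansion d0 e0; exists delta => // s sp sd.
have := H s; rewrite gtr0_norm// => /(_ sd); rewrite add0r scale0r addr0.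
rewrite ler_norml => /andP[_ h].
have dws : 'd rho x w * s < 0 by rewrite nmulr_rlt0.
have aux (a b c t : R) : a - b - c * t <= - c / 2 * t -> b <= 0 -> c * t < 0 -> a < 0.
  by clear; lra.
exact: aux h r0 dws.
Qed.

(** A direction on which d rho is negative enters [Omega], so Re c is nonnegative on it. If Re c
    vanished at [v] but d rho did not, then [v] or [- v], tilted slightly by a negative multiple of
    [e0], would make both negative. *)
Lemma support_real_tangent p c e0 v :
  boundary Omega p -> support_form Omega p c -> 0 < complex.Re (cform c e0) ->
  (exists rho, defining_function Omega p rho) ->
  complex.Re (cform c v) = 0 -> real_tangent Omega p v.
Proof.
move=> bp sp ce0 [rho drho] cv; exists rho; split => //.
pose D w := 'd rho (realify p) (realify w).
have DD w1 w2 : D (w1 + w2) = D w1 + D w2 by rewrite /D realifyD linearD.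
have DZ (t : R) w : D (t%:C *: w) = t * D w by rewrite /D realifyZ linearZ.
have near_p : \forall x \near realify p, differentiable rho x /\ (Omega (complexify x) <-> rho x < 0).
  by apply: filterS drho => x [? _ _ ?]; split.
have [rp0 _] := boundary_gradient oO cO bp near_p.
have [r r0 Hr] := nbhs_realify near_p.
have [dp _] := Hr p ltac:(by rewrite subrr enorm0).
have key w : D w < 0 -> 0 <= complex.Re (cform c w).
  move=> Dw; have rp0le : rho (realify p) <= 0 by rewrite rp0.
  have [s0 s00 Hs] := first_order_negative dp rp0le Dw.
  have N0 : 0 < enorm w + 1 by rewrite ltr_wpDl// enorm_ge0.
  pose s := Num.min (s0 / 2) (r / (2 * (enorm w + 1))).
  have s_gt0 : 0 < s by rewrite !lt_min !divr_gt0// mulr_gt0.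
  have s2 : s <= s0 / 2 by rewrite !ge_min lexx.
  have s3 : s * (2 * (enorm w + 1)) <= r.
    by rewrite -ler_pdivlMr ?mulr_gt0// !ge_min lexx orbT.
  have ss0 : s < s0 by move: s2 s00; clear; lra.
  have := Hs s s_gt0 ss0; rewrite -realifyZ -realifyD => H.
  have Os : Omega (p + s%:C *: w).
    have pr : enorm (p + s%:C *: w - p) < r.
      rewrite addrC addKr enormZ cabsR gtr0_norm//.
      apply: lt_le_trans s3; rewrite ltr_pM2l//.
      have -> : 2 * (enorm w + 1) = enorm w + (enorm w + 2) by ring.
      by rewrite ltrDl ltr_wpDl// enorm_ge0.
    by have [_ h] := Hr _ pr; rewrite realifyK in h; apply/h.
  have := sp _ Os; rewrite addrC addKr cformZ Re_scale pmulr_rge0//.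
apply/eqP/negPn/negP => Dv0.
have neg w : complex.Re (cform c w) = 0 -> D w < 0 -> False.
  move=> cw Dw.
  have N0 : 0 < 2 * (`|D e0| + 1) by rewrite mulr_gt0// ltr_wpDl.
  pose t := - D w / (2 * (`|D e0| + 1)).
  have t0 : 0 < t by rewrite divr_gt0// oppr_gt0.
  have := key (w + (- t)%:C *: e0).
  rewrite cformD cformZ raddfD /= Re_scale cw add0r DD DZ.
  rewrite nmulr_rge0 ?oppr_lt0// leNgt ce0 => H.
  suff : D w + - t * D e0 < 0 by move=> /H.
  have tE : t * (2 * (`|D e0| + 1)) = - D w by rewrite /t divfK// gt_eqF.
  have h : t * - D e0 <= t * `|D e0| by rewrite ler_pM2l// -normrN ler_norm.
  have aux (a b k s : R) : s * (2 * (k + 1)) = - a -> s * - b <= s * k -> a < 0 ->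
      0 < s -> 0 <= s * k -> a + - s * b < 0 by clear; lra.
  have h4 : 0 <= t * `|D e0| by apply: mulr_ge0; [exact: ltW|exact: normr_ge0].
  exact: (aux _ _ _ _ tE h Dw t0 h4).
have [h|h] := ltP (D v) 0; first exact: neg h.
apply: (neg ((-1 : R)%:C *: v)).
  by rewrite cformZ Re_scale cv mulr0.
by rewrite DZ mulN1r oppr_lt0 lt_def h andbT.
Qed.

End Tangency.

(** * Drift along curves *)

Section ExitChain.
Variable R : realType.

Lemma first_exit (F : R -> R) (s b D : R) : s <= b -> cont_on F s b -> F s < D ->
  (forall t, s <= t -> t <= b -> F t <= D) \/
  exists s', [/\ s <= s', s' <= b, F s' = D & forall t, s <= t -> t <= s' -> F t <= D].
Proof.
move=> sb cF Fs.
pose A := [set t : R | [/\ s <= t, t <= b & D <= F t]].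
have [A0|/set0P[x0 Ax0]] := eqVneq A set0.
  left => t st tb; rewrite leNgt; apply/negP => h.
  have At : A t by split => //; exact: ltW.
  by rewrite A0 in At.
right; have hA : has_inf A by split; [exists x0|exists s => t []].
have sA : s <= inf A by apply: lb_le_inf; [exists x0|move=> t []].
have Ab : inf A <= b by have [_ h _] := Ax0; apply: le_trans h; apply: ge_inf => //; exists s => t [].
have below t : s <= t -> t < inf A -> F t < D.
  move=> st tA; rewrite ltNge; apply/negP => h.
  have : inf A <= t.
    apply: ge_inf; first by exists s => u [].
    by split => //; apply: le_trans Ab; exact: ltW.
  by rewrite leNgt tA.
have DF : D <= F (inf A).
  rewrite leNgt; apply/negP => h.
  have e0 : 0 < (D - F (inf A)) / 2 by rewrite divr_gt0// subr_gt0.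
  have [d d0 Hd] := cF _ sA Ab _ e0.
  have [t At tA] := inf_adherent d0 hA.
  have At' : inf A <= t by apply: ge_inf => //; exists s => u [].
  have [st tb DFt] := At.
  have := Hd t st tb; rewrite ger0_norm ?subr_ge0// => H.
  have : `|F t - F (inf A)| <= (D - F (inf A)) / 2 by apply: H; lra.
  rewrite ler_norml => /andP[_]; lra.
have FD : F (inf A) <= D.
  rewrite leNgt; apply/negP => h.
  have e0 : 0 < (F (inf A) - D) / 2 by rewrite divr_gt0// subr_gt0.
  have [d d0 Hd] := cF _ sA Ab _ e0.
  have sA' : s < inf A.
    rewrite lt_neqAle sA andbT; apply/eqP => E; move: h; rewrite -E.
    by rewrite ltNge (ltW Fs).
  pose t := Num.max s (inf A - d / 2).
  have t1 : s <= t by rewrite le_max lexx.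
  have t2 : t < inf A by rewrite gt_max sA'; lra.
  have t3 : inf A - d / 2 <= t by rewrite le_max lexx orbT.
  have := Hd t t1 (le_trans (ltW t2) Ab); rewrite ltr0_norm ?subr_lt0// => H.
  have : `|F t - F (inf A)| <= (F (inf A) - D) / 2 by apply: H; lra.
  have := below t t1 t2; rewrite ler_norml => h1 /andP[h2 _]; lra.
exists (inf A); split => //; first by apply/eqP; rewrite eq_le FD DF.
move=> t st tA; have [->//|tn] := eqVneq t (inf A).
by apply/ltW/below => //; rewrite lt_neqAle tn.
Qed.

(* [L] is a superadditive length, [tau] the cost of an exit, and [J] counts the
   exits already paid for between [a] and the current time. *)
Lemma exit_chain (L : R -> R -> R) (F X : R -> R -> R) (thr w : nat -> R) (tau a s0 b : R) :
  0 < tau -> a <= s0 -> s0 <= b ->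
  (forall s t, a <= s -> s <= t -> t <= b -> 0 <= L s t) ->
  (forall s t u, a <= s -> s <= t -> t <= u -> u <= b -> L s t + L t u <= L s u) ->
  (forall J, 0 < thr J) -> (forall J, 0 <= w J) ->
  (forall s, s0 <= s -> s <= b -> F s s = 0 /\ cont_on (F s) s b) ->
  (forall J s s', s0 <= s -> s <= s' -> s' <= b -> J%:R * tau <= L a s ->
     F s s' = thr J -> (forall u, s <= u -> u <= s' -> F s u <= thr J) ->
     tau <= L s s') ->
  (forall J s s', s0 <= s -> s <= s' -> s' <= b -> J%:R * tau <= L a s ->
     (forall u, s <= u -> u <= s' -> F s u <= thr J) ->
     X s s' <= w J /\ forall t, s' <= t -> t <= b -> X s t <= w J + X s' t) ->
  exists k : nat, forall t, s0 <= t -> t <= b -> X s0 t <= \sum_(0 <= j < k) w j.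
Proof.
move=> tau0 as0 s0b L0 LD thr0 w0 F0 exit_cost step.
(* Induction on the number [k] of exits that the remaining length can still pay for; [J] counts
   those already paid and selects the terms of [w]. *)
have key k : forall J s, s0 <= s -> s <= b -> J%:R * tau <= L a s -> L s b < k%:R * tau ->
    forall t, s <= t -> t <= b -> X s t <= \sum_(J <= j < J + k) w j.
  elim: k => [J s s0s sb _|k IH J s s0s sb HJ Hk t st tb].
    by rewrite mul0r ltNge L0// (le_trans as0).
  have as_ : a <= s by exact: le_trans s0s.
  rewrite addnS big_nat_recl ?leq_addr//.
  have sum_ge0 : 0 <= \sum_(J <= i < J + k) w i.+1 by apply: sumr_ge0.
  have [Fss Fc] := F0 s s0s sb.
  have thrJ : F s s < thr J by rewrite Fss.
  have [H|[s' [ss' s'b Fs' H]]] := first_exit sb Fc thrJ.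
    have [h _] := step J s t s0s st tb HJ (fun u su ut => H u su (le_trans ut tb)).
    by apply: (le_trans h); rewrite lerDl.
  have [t_s'|s't] := leP t s'.
    have [h _] := step J s t s0s st tb HJ (fun u su ut => H u su (le_trans ut t_s')).
    by apply: (le_trans h); rewrite lerDl.
  have [_ h] := step J s s' s0s ss' s'b HJ H.
  apply: (le_trans (h t (ltW s't) tb)); rewrite lerD2l.
  have cost := exit_cost J s s' s0s ss' s'b HJ Fs' H.
  have := IH J.+1 s'; rewrite addSn big_add1 /=; apply => //; last exact: ltW.
  - exact: le_trans ss'.
  - have := LD a s s' (lexx a) as_ ss' s'b; rewrite -natr1; lra.
  - by have := LD s s' b as_ ss' s'b (lexx b); rewrite -natr1 in Hk; lra.
have [k Hk] : exists k : nat, L s0 b < k%:R * tau.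
  exists (Num.bound (L s0 b / tau)); rewrite -ltr_pdivrMr//; apply: archi_boundP.
  by rewrite divr_ge0 ?L0// ltW.
exists k => t s0t tb; apply: (key k 0%N) => //.
by rewrite mul0r L0.
Qed.

Lemma sum_geometric_le (q : R) k : 0 <= q -> q < 1 -> \sum_(0 <= j < k) q ^+ j <= (1 - q)^-1.
Proof.
move=> q0 q1; have h : 0 < 1 - q by rewrite subr_gt0.
rewrite -[leRHS]mul1r ler_pdivlMr//.
suff -> : (\sum_(0 <= j < k) q ^+ j) * (1 - q) = 1 - q ^+ k.
  by rewrite lerBlDr lerDl exprn_ge0.
elim: k => [|k IH]; first by rewrite big_geq// mul0r expr0 subrr.
by rewrite big_nat_recr//= mulrDl IH exprS; ring.
Qed.

End ExitChain.

Section RealAux.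
Variable R : realType.
Implicit Types x : R.

Lemma third_le x1 x2 x3 : x3 <= x1 -> 3 * x1 <= x2 + x2 + x2 -> x3 <= x2.
Proof. lra. Qed.

Lemma eighth_le x : 1 <= 8 * x -> 8^-1 <= x.
Proof. lra. Qed.

Lemma dist_le_of_triangle x1 x2 x3 x4 : x1 <= x2 -> x3 <= x4 + x1 -> x4 <= x3 + x1 ->
  `|x3 - x4| <= x2.
Proof. by rewrite ler_norml => *; apply/andP; split; lra. Qed.

Lemma drift_step x1 x2 x3 x4 x5 x6 x7 x8 x9 : x1 <= x2 + x3 + x9 -> x6 <= x7 + x8 ->
  x2 <= x5 -> x7 <= x4 -> x1 + x6 <= x5 + x4 + x9 + (x3 + x8).
Proof. lra. Qed.

End RealAux.

Section CurveEstimates.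
Variables (R : realType) (n : nat).
Variable Omega : set 'rV[R[i]]_n.
Hypotheses (oO : open Omega) (cO : convex_set Omega) (bO : boundary Omega !=set0).
Implicit Types (v w z p : 'rV[R[i]]_n).

(* [L] is the kappa-length; abstracting it makes the estimates available for the
   reversed curve too. *)
Record length_curve (g : R -> 'rV[R[i]]_n) (L : R -> R -> R) (a b : R) : Prop := LengthCurve {
  lc_in : forall t, a <= t -> t <= b -> Omega (g t) ;
  lc_cont : forall s, a <= s -> s <= b -> forall eps, 0 < eps -> exists2 delta, 0 < delta &
    forall t, a <= t -> t <= b -> `|t - s| < delta -> enorm (g t - g s) <= eps ;
  lc_ge0 : forall s t, a <= s -> s <= t -> t <= b -> 0 <= L s t ;
  lc_add : forall s t u, a <= s -> s <= t -> t <= u -> u <= b -> L s t + L t u <= L s u ;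
  lc_low : forall s t (k : R) (x : 'I_(n + n) -> R), a <= s -> s <= t -> t <= b -> 0 <= k ->
    (forall u v, s <= u -> u <= t -> k * `|real_form x v| <= kobayashi_royden Omega (g u) v) ->
    k * `|real_form x (g t) - real_form x (g s)| <= L s t }.

Lemma real_formB (x : 'I_(n + n) -> R) v w : real_form x (v - w) = real_form x v - real_form x w.
Proof.
by rewrite /real_form -sumrB; apply: eq_bigr => k _; rewrite realifyB !mxE mulrBr.
Qed.

Lemma real_form_cform (c : 'I_n -> R[i]) : exists x : 'I_(n + n) -> R,
  forall v, real_form x v = complex.Re (cform c v).
Proof.
exists (fun k : 'I_(n + n) => match fintype.split k with inl j => complex.Re (c j) | inr j => - complex.Im (c j) end).
move=> v; rewrite /real_form big_split_ord /= /cform raddf_sum -big_split /=.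
apply: eq_bigr => j _.
rewrite (unsplitK (inl j : 'I_n + 'I_n)) (unsplitK (inr j : 'I_n + 'I_n)).
rewrite /realify row_mxEl row_mxEr !mxE; case: (v 0 j) => x y; case: (c j) => s t /=; ring.
Qed.

Lemma unit_rotation (z : R[i]) : exists2 e : R[i], cabs e = 1 & complex.Re (e * z) = cabs z.
Proof.
have [->|z0] := eqVneq z 0; first by exists 1; rewrite ?cabs1// mulr0 cabs0.
have cz : cabs z != 0 by rewrite cabs_eq0.
have czC : (cabs z)%:C != 0 :> R[i] by rewrite -cabs_eq0 cabsR normr_eq0.
exists (conjc z / (cabs z)%:C).
  by rewrite cabsM cabsV cabsJ cabsR ger0_norm ?cabs_ge0// divff.
suff -> : conjc z / (cabs z)%:C * z = (cabs z)%:C by [].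
by rewrite mulrAC [_ * z]mulrC -sqr_normc cabsE expr2 mulfK.
Qed.

Lemma cform_mul (e : R[i]) (c : 'I_n -> R[i]) v : cform (fun j => e * c j) v = e * cform c v.
Proof. by rewrite /cform mulr_sumr; apply: eq_bigr => j _; rewrite mulrCA. Qed.

Variables (g : R -> 'rV[R[i]]_n) (L : R -> R -> R) (a b : R).
Hypothesis lc : length_curve g L a b.

(** [lc_low] speaks of real functionals only; multiplying [c] by a unit number that makes its value
    at the displacement real recovers the modulus. *)
Lemma length_ge_cform (c : 'I_n -> R[i]) p (k : R) s t : a <= s -> s <= t -> t <= b -> 0 < k ->
  support_form Omega p c ->
  (forall u, s <= u -> u <= t -> complex.Re (cform c (g u - p)) <= k) ->
  cabs (cform c (g t - g s)) <= 4 * k * L s t.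
Proof.
move=> as_ st tb k0 sp H.
have [e e1 eE] := unit_rotation (cform c (g t - g s)).
have [x Hx] := real_form_cform (fun j => e * c j).
have k40 : 0 < 4 * k by rewrite mulr_gt0.
have := lc_low lc (k := (4 * k)^-1) (x := x) as_ st tb.
rewrite -real_formB Hx cform_mul eE ger0_norm ?cabs_ge0//.
rewrite [_ * cabs _]mulrC ler_pdivrMr// [L s t * _]mulrC; apply; first by rewrite invr_ge0 ltW.
move=> u v su ut; rewrite Hx cform_mul mulrC ler_pdivrMr//.
apply: (le_trans (Re_le_cabs _)); rewrite cabsM e1 mul1r.
have Ou : Omega (g u) by apply: (lc_in lc); [exact: le_trans su|exact: le_trans ut tb].
apply: (le_trans (kobayashi_royden_ge_cform v oO Ou sp)).
by rewrite mulrC ler_wpM2l ?kobayashi_royden_ge0// ler_pM2l// H.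
Qed.

Definition form_dist (c c' : 'I_n -> R[i]) : R := \sum_j cabs (c j - c' j).

Lemma form_dist_ge0 c c' : 0 <= form_dist c c'.
Proof. by apply: sumr_ge0 => j _; exact: cabs_ge0. Qed.

Lemma form_distC c c' : form_dist c c' = form_dist c' c.
Proof. by apply: eq_bigr => j _; rewrite cabs_distC. Qed.

Lemma form_dist_triangle c c' c'' : form_dist c c'' <= form_dist c c' + form_dist c' c''.
Proof.
rewrite /form_dist -big_split; apply: ler_sum => j _ /=.
have -> : c j - c'' j = (c j - c' j) + (c' j - c'' j) by ring.
exact: cabsD.
Qed.

Lemma cform_form_dist c c' v : cabs (cform c v) <= cabs (cform c' v) + form_dist c c' * enorm v.
Proof.
have -> : cform c v = cform c' v + cform (fun j => c j - c' j) v.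
  by rewrite /cform -big_split; apply: eq_bigr => j _ /=; ring.
by apply: (le_trans (cabsD _ _)); rewrite lerD2l; exact: cabs_cform_le.
Qed.

Lemma form_dist_le c c' (k : R) : (forall v, cabs (cform c v - cform c' v) <= k * enorm v) ->
  form_dist c c' <= n%:R * k.
Proof.
move=> H; apply: (@le_trans _ _ (\sum_(j < n) k)); last first.
  by rewrite sumr_const card_ord mulr_natl.
apply: ler_sum => j _.
have := H (delta_mx 0 j).
have cd (d : 'I_n -> R[i]) : cform d (delta_mx 0 j) = d j.
  rewrite /cform (bigD1 j)//= mxE !eqxx mul1r big1 ?addr0// => i ij.
  by rewrite mxE eqxx (negbTE ij) mul0r.
rewrite !cd; suff -> : enorm (delta_mx 0 j : 'rV[R[i]]_n) = 1 by rewrite mulr1.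
rewrite /enorm (bigD1 j)//= mxE !eqxx /= big1 => [|i ij].
  by rewrite expr1n expr0n !addr0 sqrtr1.
by rewrite mxE eqxx (negbTE ij) /= expr0n addr0.
Qed.

(* While the normal coordinate with respect to [c (pi s)] moves by less than
   [thr J], the normals [c (pi t)] stay close to [c (pi s)] by the jump estimate;
   leaving that range costs length at least 1/8, after which the curve is closer to
   the boundary by the geometric decay assumed on [bdist], so the drifts are
   summable. *)
Lemma normal_drift (c : 'rV[R[i]]_n -> 'I_n -> R[i]) p (r M K sig0 sig q : R) (N : nat)
    (pi : R -> 'rV[R[i]]_n) :
  0 < r -> 0 < M -> 0 < K -> a <= b ->
  (forall x, boundary Omega x -> enorm (x - p) < r ->
     support_form Omega x (c x) /\ forall v, cabs (cform (c x) v) <= M * enorm v) ->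
  (forall x y, boundary Omega x -> boundary Omega y ->
      enorm (x - p) < r -> enorm (y - p) < r ->
      forall s, 0 < s -> s <= sig0 ->
      complex.Re (cform (c x) (y - x)) <= s ^+ N.+1 ->
      forall v, cabs (cform (c x) v - cform (c y) v) <= K * s * enorm v) ->
  0 < sig -> sig <= sig0 -> sig <= 1 -> 0 < q -> q < 1 ->
  (forall t, a <= t -> t <= b -> [/\ boundary Omega (pi t), enorm (pi t - p) < r,
     enorm (g t - pi t) <= 2 * bdist Omega (g t) & enorm (g t - p) <= r / 2]) ->
  (forall (J : nat) t, a <= t -> t <= b -> J%:R * 8^-1 <= L a t ->
     6 * M * bdist Omega (g t) <= (sig * q ^+ J) ^+ N.+1) ->
  forall t, a <= t -> t <= b ->
    cabs (cform (c (pi a)) (g t - g a)) + form_dist (c (pi a)) (c (pi t)) <=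
    (1 + n%:R * K * (1 + r)) * sig / (1 - q).
Proof.
move=> r0 M0 K0 ab frame jump sig_gt0 sigs0 sig1 q0 q1 Hpi Hd.
have [lin lcont l0 ladd llow] := lc.
pose sg (J : nat) := sig * q ^+ J.
have sg0 J : 0 < sg J by rewrite mulr_gt0// exprn_gt0.
have sgs0 J : sg J <= sig by rewrite /sg ler_piMr ?(ltW sig_gt0)// exprn_ile1// ltW.
(* A third of the jump threshold, since the normal coordinate of [pi t] relative to [pi s] has three
   contributions: the movement of the curve, and the gaps between [g s], [g t] and their boundary
   points. *)
pose thr (J : nat) := sg J ^+ N.+1 / 3.
have thr0 J : 0 < thr J by rewrite divr_gt0// exprn_gt0.
have thr_sg J : thr J <= sg J.
  have h1 : sg J ^+ N.+1 <= sg J.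
    by rewrite exprS ler_piMr ?(ltW (sg0 J))// exprn_ile1 ?(ltW (sg0 J))// (le_trans (sgs0 J)).
  by apply: le_trans h1; rewrite /thr ler_pdivrMr// ler_peMr ?exprn_ge0 ?(ltW (sg0 J))// ler1n.
have thr3 J : thr J + thr J + thr J = sg J ^+ N.+1 by rewrite /thr; field.
pose F s t := cabs (cform (c (pi s)) (g t - g s)).
pose X s t := F s t + form_dist (c (pi s)) (c (pi t)).
pose nK := n%:R * K; have nK0 : 0 <= nK by rewrite mulr_ge0// ltW.
(* [sg J] bounds the movement of the coordinate, [nK * sg J] the change of normal, and
   [nK * sg J * r] the error of measuring the rest of the curve, of diameter at most [r], with the
   new normal. *)
pose w J := (1 + nK * (1 + r)) * sg J.
have r10 : 0 < 1 + r by rewrite addr_gt0.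
have W0 : 0 <= 1 + nK * (1 + r) by rewrite addr_ge0// mulr_ge0// ltW.
have dM s t J : a <= s -> s <= t -> t <= b -> J%:R * 8^-1 <= L a s ->
    forall x, x = pi t -> M * enorm (g t - x) <= thr J.
  move=> as_ st tb HJ x ->.
  have at_ := le_trans as_ st.
  have HJ' : J%:R * 8^-1 <= L a t.
    by have := ladd a s t (lexx a) as_ st tb; have := l0 s t as_ st tb; lra.
  have [_ _ h _] := Hpi t at_ tb; have := Hd J t at_ tb HJ'.
  have h2 : M * enorm (g t - pi t) <= M * (2 * bdist Omega (g t)) by rewrite ler_pM2l.
  rewrite -/(sg J) -thr3; move: h2; set A := M * enorm _.
  have -> : 6 * M * bdist Omega (g t) = 3 * (M * (2 * bdist Omega (g t))) by ring.
  exact: third_le.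
have near_pi s t J : a <= s -> s <= t -> t <= b -> J%:R * 8^-1 <= L a s -> F s t <= thr J ->
    complex.Re (cform (c (pi s)) (g t - pi s)) <= thr J + thr J.
  move=> as_ st tb HJ HF.
  have sb := le_trans st tb.
  have [bs ps _ _] := Hpi s as_ sb.
  have -> : g t - pi s = (g t - g s) + (g s - pi s) by rewrite addrA subrK.
  rewrite cformD raddfD /=; apply: lerD.
    by apply: (le_trans (ler_norm _)); apply: (le_trans (Re_le_cabs _)).
  apply: (le_trans (ler_norm _)); apply: (le_trans (Re_le_cabs _)).
  apply: (le_trans ((frame _ bs ps).2 _)).
  exact: (dM s s J as_ (lexx s) sb HJ _ erefl).
have close s t J : a <= s -> s <= t -> t <= b -> J%:R * 8^-1 <= L a s -> F s t <= thr J ->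
    form_dist (c (pi s)) (c (pi t)) <= nK * sg J.
  move=> as_ st tb HJ HF.
  have sb := le_trans st tb; have at_ := le_trans as_ st.
  have [bs ps _ _] := Hpi s as_ sb; have [bt pt _ _] := Hpi t at_ tb.
  rewrite /nK -mulrA; apply: form_dist_le; apply: jump => //.
    by apply: le_trans (sgs0 J) sigs0.
  have -> : pi t - pi s = (g t - pi s) + (pi t - g t) by rewrite [RHS]addrC subrKA.
  rewrite cformD raddfD /= -thr3; apply: lerD; first exact: near_pi.
  apply: (le_trans (ler_norm _)); apply: (le_trans (Re_le_cabs _)).
  apply: (le_trans ((frame _ bs ps).2 _)); rewrite enorm_distC.
  exact: (dM s t J as_ st tb HJ _ erefl).
have [k Hk] : exists k : nat, forall t, a <= t -> t <= b -> X a t <= \sum_(0 <= j < k) w j.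
  apply: (@exit_chain R L F X thr w 8^-1 a a b) => //.
  - by move=> J; rewrite mulr_ge0// ltW.
  - move=> s as_ sb; split; first by rewrite /F subrr /cform big1 ?cabs0// => j _; rewrite mxE mul0r.
    move=> x sx xb eps e0.
    have [bs ps _ _] := Hpi s as_ sb.
    have [d d0 Hdd] := lcont x (le_trans as_ sx) xb (eps / M) (divr_gt0 e0 M0).
    exists d => // x' sx' xb' xx'.
    have := Hdd x' (le_trans as_ sx') xb' xx'; rewrite ler_pdivlMr// mulrC => h.
    have h2 : cabs (cform (c (pi s)) (g x' - g x)) <= eps.
      by apply: le_trans h; exact: (frame _ bs ps).2.
    have e1 : cform (c (pi s)) (g x' - g s) = cform (c (pi s)) (g x - g s) + cform (c (pi s)) (g x' - g x).
      by rewrite -cformD; congr (cform _ _); rewrite [RHS]addrC subrKA.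
    have := cabsD (cform (c (pi s)) (g x - g s)) (cform (c (pi s)) (g x' - g x)).
    rewrite -e1 => h3.
    have := cabsB (cform (c (pi s)) (g x' - g s)) (cform (c (pi s)) (g x' - g x)).
    have -> : cform (c (pi s)) (g x' - g s) - cform (c (pi s)) (g x' - g x) =
      cform (c (pi s)) (g x - g s) by rewrite e1 addrK.
    move=> h4; rewrite /F.
    exact: dist_le_of_triangle h2 h3 h4.
  - move=> J s s' as_ ss' s'b HJ Fs' Fle.
    have sb := le_trans ss' s'b.
    have [bs ps _ _] := Hpi s as_ sb.
    (* Before the exit the coordinate is at most 2 thr, so moving it by thr costs at least thr / (4
       * 2 thr) = 1/8. *)
    have := @length_ge_cform (c (pi s)) (pi s) (thr J + thr J) s s' as_ ss' s'b.
    rewrite addr_gt0 ?thr0// => /(_ isT (frame _ bs ps).1 _).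
    rewrite -/(F s s') Fs' => H.
    have : thr J <= 4 * (thr J + thr J) * L s s'.
      by apply: H => u su us'; apply: near_pi => //; [exact: le_trans us' s'b|exact: Fle].
    have -> : 4 * (thr J + thr J) * L s s' = thr J * (8 * L s s') by ring.
    by rewrite -[X in X <= _]mulr1 ler_pM2l ?thr0//; exact: eighth_le.
  - move=> J s s' as_ ss' s'b HJ Fle.
    have Fs' : F s s' <= thr J by exact: Fle.
    have cl := close s s' J as_ ss' s'b HJ Fs'.
    have sgw : sg J + nK * sg J <= w J.
      by rewrite /w mulrDl mul1r lerD2l ler_wpM2r ?(ltW (sg0 J))// ler_peMr// lerDl ltW.
    split.
      apply: le_trans sgw; apply: lerD => //; exact: le_trans Fs' (thr_sg J).
    move=> t s't tb; rewrite /X.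
    have e1 : F s t <= F s s' + F s' t + nK * sg J * r.
      rewrite /F.
      have -> : g t - g s = (g s' - g s) + (g t - g s') by rewrite [RHS]addrC subrKA.
      rewrite cformD; apply: (le_trans (cabsD _ _)); rewrite -addrA lerD2l.
      apply: (le_trans (cform_form_dist _ (c (pi s')) _)); rewrite lerD2l.
      apply: ler_pM; rewrite ?form_dist_ge0 ?enorm_ge0//.
      have [_ _ _ g1] := Hpi t (le_trans (le_trans as_ ss') s't) tb.
      have [_ _ _ g2] := Hpi s' (le_trans as_ ss') s'b.
      apply: (le_trans (enorm_dist_triangle _ p _)); rewrite [enorm (p - _)]enorm_distC.
      by rewrite [r]splitr; exact: lerD.
    have e2 := form_dist_triangle (c (pi s)) (c (pi s')) (c (pi t)).
    have e3 : w J = sg J + nK * sg J + nK * sg J * r by rewrite /w; ring.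
    have e4 := le_trans Fs' (thr_sg J).
    rewrite e3; exact: drift_step e1 e2 e4 cl.
move=> t at_ tb; apply: (le_trans (Hk t at_ tb)).
rewrite /w -mulr_sumr -[leRHS]mulrA ler_wpM2l//.
rewrite /sg -mulr_sumr ler_pM2l//; apply: sum_geometric_le => //; exact: ltW.
Qed.

End CurveEstimates.

(** * Displacement controlled by the Goldilocks integral *)

Section Goldilocks.
Variables (R : realType) (n : nat).
Variable Omega : set 'rV[R[i]]_n.
Hypothesis oO : open Omega.
Implicit Types (v w z p : 'rV[R[i]]_n).

Lemma derive_dilation (phi : R[i] -> 'rV[R[i]]_n) (s a : R[i]) : s != 0 ->
  derivable phi (s * a) 1 ->
  derivable (fun t => phi (s * t)) a 1 /\ 'D_1 (fun t => phi (s * t)) a = s *: 'D_1 phi (s * a).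
Proof.
move=> s0 dphi.
suff H : h^-1 *: (phi (s * (h%:A + a)) - phi (s * a)) @[h --> (0 : R[i])^'] --> s *: 'D_1 phi (s * a).
  split; first by apply: cvgP H.
  exact: cvg_lim H.
apply: (@cvg_trans _ (s *: ((s * h)^-1 *: (phi ((s * h)%:A + s * a) - phi (s * a))) @[h --> (0 : R[i])^'])).
  apply: near_eq_cvg; near=> h.
  have h0 : h != 0 by near: h; exact: nbhs_dnbhs_neq.
  rewrite scalerA invfM mulrA divff// mul1r.
  by rewrite !(_ : forall x : R[i], x%:A = x) ?mulrDr// => x; exact: mulr1.
apply: cvgZr.
have H2 : (s * h) @[h --> (0 : R[i])^'] --> (0 : R[i])^'.
  move=> A /= /nbhs_ballP[e /= e0 HA].
  have s0' : 0 < `|s| by rewrite normr_gt0.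
  apply/nbhs_ballP; exists (e / `|s|); first by rewrite /= divr_gt0.
  move=> h; rewrite /ball /= sub0r normrN ltr_pdivlMr// => hd h0.
  apply: HA; last by rewrite mulf_neq0.
  by rewrite /ball /= sub0r normrN normrM mulrC.
exact: (cvg_comp _ _ H2 dphi).
Unshelve. all: by end_near. Qed.

Lemma kobayashi_royden_scale z v (s : R) : 0 < s -> Omega z ->
  s * kobayashi_royden Omega z (s^-1%:C *: v) <= kobayashi_royden Omega z v.
Proof.
move=> s0 Oz; have [r0 r00 [phi0 Hphi0]] := kobayashi_royden_nonempty v oO Oz.
apply: lb_le_inf; first by exists r0^-1; exists r0 => //; split => //; exists phi0.
move=> _ [r [r_gt0 [phi [h1 h2 h3]]] <-].
rewrite mulrC -ler_pdivlMr// -invfM; apply: ge_inf.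
  by exists 0 => _ [x [x0 _] <-]; rewrite invr_ge0 ltW.
have sC : s^-1%:C != 0 :> R[i] by rewrite -cabs_eq0 cabsR normr_eq0 invr_eq0 gt_eqF.
exists (r * s) => //; split; first exact: mulr_gt0.
have D t : cabs t < r * s -> cabs (s^-1%:C * t) < r.
  by move=> tr; rewrite cabsM cabsR gtr0_norm ?invr_gt0// mulrC ltr_pdivrMr.
exists (fun t => phi (s^-1%:C * t)); split.
- move=> t; rewrite ltc_cabs => /D tr.
  have tr' : `|s^-1%:C * t| < r%:C by rewrite ltc_cabs.
  have [d o] := h1 _ tr'; split; last exact: o.
  by have [] := derive_dilation sC d.
- by rewrite mulr0.
- have [|d o] := h1 (s^-1%:C * 0); first by rewrite mulr0 ltc_cabs cabs0.
  by have [_ ->] := derive_dilation sC d; rewrite mulr0 h3.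
Qed.

Lemma goldilocks_M_bound U r z v : goldilocks_M Omega U r \is a fin_num ->
  (0 <= goldilocks_M Omega U r)%E -> Omega z -> U z -> bdist Omega z <= r ->
  enorm v <= fine (goldilocks_M Omega U r) * kobayashi_royden Omega z v.
Proof.
move=> Mfin M_ge0 Oz Uz dz.
have M0 : 0 <= fine (goldilocks_M Omega U r) by exact: fine_ge0.
have [v0|v0] := leP (enorm v) 0.
  by apply: (le_trans v0); rewrite mulr_ge0// kobayashi_royden_ge0.
set u := (enorm v)^-1%:C *: v.
have eu : enorm u = 1 by rewrite enormZ cabsR gtr0_norm ?invr_gt0// mulVf ?gt_eqF.
have : ((kobayashi_royden Omega z u)%:E^-1 <= goldilocks_M Omega U r)%E.
  by apply: ereal_sup_ubound; exists z, u; split.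
have sc := kobayashi_royden_scale v v0 Oz; rewrite -/u in sc.
(* A vanishing metric would put 0^-1 = +oo below the supremum, which is finite. *)
have := kobayashi_royden_ge0 Omega z u; rewrite le_eqVlt => /orP[/eqP ku|ku].
  rewrite -ku inve0 leye_eq => /eqP h; by rewrite h in Mfin.
rewrite inver gt_eqF// -[X in (_ <= X)%E -> _](fineK Mfin) lee_fin => h.
apply: le_trans (ler_wpM2l M0 sc).
rewrite mulrCA -[X in X <= _]mulr1 ler_pM2l//.
by rewrite -ler_pdivrMr// mul1r.
Qed.

Lemma goldilocks_M_le U (x y : R) : x <= y -> (goldilocks_M Omega U x <= goldilocks_M Omega U y)%E.
Proof.
move=> xy; apply: le_ereal_sup => _ [z [v [h1 h2 h3 ->]]].
by exists z, v; split => //; exact: le_trans xy.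
Qed.

(** [exit_chain] with the sup norm of the displacement as both functionals. That norm is attained at
    one real coordinate, so a single real functional sees the whole exit, and moving by [m J] costs
    length at least 1, more than the 1/8 that is charged. *)
Lemma goldilocks_drift (g : R -> 'rV[R[i]]_n) (L : R -> R -> R) (a b s0 : R) U (m d : nat -> R) :
  length_curve Omega g L a b -> a <= s0 -> s0 <= b -> (forall J, 0 < m J) ->
  (forall t, s0 <= t -> t <= b -> U (g t)) ->
  (forall J z v, Omega z -> U z -> bdist Omega z <= d J ->
     enorm v <= m J * kobayashi_royden Omega z v) ->
  (forall (J : nat) t, a <= t -> t <= b -> J%:R * 8^-1 <= L a t -> bdist Omega (g t) <= d J) ->
  exists k : nat, forall t, s0 <= t -> t <= b ->
    `|realify (g t - g s0)| <= \sum_(0 <= j < k) m j.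
Proof.
move=> [lin lcont l0 ladd llow] as0 s0b m0 gU kob dg.
pose F s t := `|realify (g t - g s)|.
have Ftri s s' t : F s t <= F s s' + F s' t.
  rewrite /F; have -> : g t - g s = (g s' - g s) + (g t - g s') by rewrite [RHS]addrC subrKA.
  rewrite realifyD; exact: ler_normD.
apply: (@exit_chain R L F F m m 8^-1 a s0 b) => //.
- by move=> J; exact: ltW.
- move=> s s0s sb; split; first by rewrite /F realifyB subrr normr0.
  move=> x sx xb eps e0.
  have ax : a <= x by apply: le_trans sx; exact: le_trans s0s.
  have [dl dl0 H] := lcont x ax xb eps e0.
  exists dl => // x' sx' xb' xx'.
  have ax' : a <= x' by apply: le_trans sx'; exact: le_trans s0s.
  have e1 := H x' ax' xb' xx'.
  apply: le_trans e1; apply: le_trans (norm_realify_le _).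
  rewrite /F; have -> : g x' - g x = (g x' - g s) - (g x - g s) by rewrite opprB subrKA.
  rewrite [X in _ <= `|X|]realifyB; exact: ler_dist_dist.
- move=> J s s' s0s ss' s'b HJ Fs' Fle.
  have as_ : a <= s by exact: le_trans s0s.
  have [k Hk] : exists k, `|realify (g s' - g s) 0 k| = m J.
    have Fn0 : mx_norm (realify (g s' - g s)) != 0 by rewrite -[mx_norm _]/(F s s') Fs' gt_eqF.
    have [[i k] /= Hk] := mx_norm_neq0 Fn0.
    by exists k; rewrite -Fs' /F [RHS]Hk ord1.
  pose x (l : 'I_(n + n)) : R := (l == k)%:R.
  have xE v : real_form x v = realify v 0 k.
    rewrite /real_form (bigD1 k)//= big1 => [|l lk]; first by rewrite /x eqxx mul1r addr0.
    by rewrite /x (negbTE lk) mul0r.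
  have : (m J)^-1 * `|real_form x (g s') - real_form x (g s)| <= L s s'.
    apply: llow => //; first by rewrite invr_ge0 ltW.
    move=> u v su us'; rewrite xE mulrC ler_pdivrMr// mulrC.
    have au : a <= u by exact: le_trans su.
    have ub := le_trans us' s'b.
    have HJ' : J%:R * 8^-1 <= L a u.
      apply: (le_trans HJ); apply: le_trans (ladd a s u (lexx a) as_ su ub).
      by rewrite lerDl l0.
    apply: le_trans (kob J (g u) v (lin u au ub) (gU u (le_trans s0s su) ub) (dg J u au ub HJ')).
    exact: normr_realify_le.
  rewrite -real_formB xE Hk mulVf ?gt_eqF//; apply: le_trans.
  by rewrite invf_le1// ler1n.
- move=> J s s' s0s ss' s'b HJ Fle; split; first exact: Fle.
  move=> t s't tb; apply: (le_trans (Ftri s s' t)); rewrite lerD2r; exact: Fle.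
Qed.

End Goldilocks.

Section LogarithmicSums.
Variable R : realType.
Local Notation mu := (@lebesgue_measure R).
Variables (M : R -> \bar R) (eps : R).
Hypotheses (M_le : forall x y, x <= y -> (M x <= M y)%E) (M_ge0 : forall x, 0 < x -> (0 <= M x)%E).
Hypothesis eps0 : 0 < eps.
Let h r := (M r * (r^-1)%:E)%E.
Hypothesis h_int : (\int[mu]_(r in `]0%R, eps]) h r < +oo)%E.

Let h_ge0 r : 0 < r -> (0 <= h r)%E.
Proof. by move=> r0; rewrite mule_ge0 ?M_ge0// lee_fin invr_ge0 ltW. Qed.

Let h_lower (x y c : R) : 0 < x -> x < y -> 0 <= c -> (c%:E <= M x)%E ->
  ((c * (1 - x / y))%:E <= \int[mu]_(r in `]x, y]) h r)%E.
Proof.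
move=> x0 xy c0 cM; have y0 := lt_trans x0 xy.
pose D : set (measurableTypeR R) := `]x, y]%classic.
have mD : measurable D by exact: measurable_itv.
have -> : ((c * (1 - x / y))%:E = \int[mu]_(r in D) (c / y)%:E)%E.
  rewrite integral_cst//= lebesgue_measure_itv/= lte_fin xy -EFinD -EFinM; congr EFin.
  by field; rewrite gt_eqF.
apply: ge0_le_lower_integral => r; rewrite /D /= in_itv /= => /andP[xr ry].
  by rewrite lee_fin divr_ge0// ltW.
have r0 := lt_trans x0 xr.
rewrite EFinM; apply: lee_pmul; rewrite ?lee_fin ?invr_ge0 ?(ltW y0)//.
  by apply: (le_trans cM); apply/M_le/ltW.
by rewrite lef_pV2.
Qed.

Let h_sub (x y : R) : 0 <= x -> x <= y -> y <= eps ->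
  (\int[mu]_(r in `]x, y]) h r <= \int[mu]_(r in `]0%R, eps]) h r)%E.
Proof.
move=> x0 xy ye.
pose D : set (measurableTypeR R) := `]0%R, eps]%classic.
pose A : set (measurableTypeR R) := `]x, y]%classic.
have mA : measurable A by exact: measurable_itv.
have := @lower_integral_setU _ _ _ mu A set0 D h mA measurable0.
rewrite setI0 setU0 integral_set0 adde0; apply => //.
  move=> r; rewrite /A /D /= !in_itv /= => /andP[xr ry].
  by rewrite (le_lt_trans x0 xr) (le_trans ry ye).
by move=> r; rewrite /D /= in_itv /= => /andP[/h_ge0].
Qed.

Let I := (\int[mu]_(r in `]0%R, eps]) h r)%E.

Let I_fin : I \is a fin_num.
Proof.
rewrite ge0_fin_numE//; apply: integral_ge0 => r; rewrite /= in_itv /= => /andP[r0 _].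
exact: h_ge0.
Qed.

(** If [M x] were infinite, monotonicity would allow every constant as a minorant of [M] on ]x,
    eps], and the integral would exceed its own value by 1. *)
Lemma dini_fin_num x : 0 < x -> x < eps -> M x \is a fin_num.
Proof.
move=> x0 xe; rewrite ge0_fin_numE ?M_ge0// ltNge leye_eq; apply/negP => /eqP Mx.
have u0 : 0 < 1 - x / eps by rewrite subr_gt0 ltr_pdivrMr// mul1r.
have I0 : 0 <= fine I by apply: fine_ge0; apply: integral_ge0 => r; rewrite /= in_itv /= => /andP[r0 _]; exact: h_ge0.
have c0 : 0 <= (fine I + 1) / (1 - x / eps) by apply: divr_ge0; [rewrite addr_ge0|exact: ltW].
have := @h_lower x eps _ x0 xe c0; rewrite Mx leey => /(_ isT).
rewrite divfK ?gt_eqF// => H.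
have := le_trans H (h_sub (ltW x0) (ltW xe) (lexx _)).
by rewrite -/I -(fineK I_fin) lee_fin gerDl ler10.
Qed.

(** Integral test on a geometric scale: by monotonicity the integral over ]eps q^(j+1), eps q^j] is
    at least (1 - q) M (eps q^(j+1)), so these values are summable. The sequence [m] is a tail with
    sums at most [eta / 2], plus a small geometric term that makes it positive. *)
Lemma dini_tail (q eta : R) : 0 < q -> q < 1 -> 0 < eta ->
  exists m : nat -> R, exists2 d : R, 0 < d &
    [/\ forall J, 0 < m J,
        forall J, M (d * q ^+ J) \is a fin_num /\ fine (M (d * q ^+ J)) <= m J
      & forall k : nat, \sum_(0 <= j < k) m j <= eta].
Proof.
move=> q0 q1 eta0.
have qk0 k : 0 < q ^+ k by exact: exprn_gt0.
have eq0 k : 0 < eps * q ^+ k by exact: mulr_gt0.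
have eqe k : eps * q ^+ k <= eps by rewrite ger_pMr// exprn_ile1// ltW.
have eqlt k : eps * q ^+ k.+1 < eps * q ^+ k by rewrite ltr_pM2l// exprS gtr_pMl.
pose a j := fine (M (eps * q ^+ j.+1)).
have Mfin j : M (eps * q ^+ j.+1) \is a fin_num.
  by apply: dini_fin_num => //; apply: (lt_le_trans (eqlt j)).
have a0 j : 0 <= a j by apply/fine_ge0/M_ge0.
have sum_le k : (((1 - q) * \sum_(0 <= j < k) a j)%:E <= \int[mu]_(r in `](eps * q ^+ k)%R, eps]) h r)%E.
  elim: k => [|k IH].
    rewrite big_geq// mulr0; apply: integral_ge0 => r; rewrite /= in_itv /= => /andP[r0 _].
    by apply/h_ge0/(lt_trans _ r0).
  pose A : set (measurableTypeR R) := `](eps * q ^+ k.+1)%R, (eps * q ^+ k)%R]%classic.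
  pose B : set (measurableTypeR R) := `](eps * q ^+ k)%R, eps]%classic.
  pose D : set (measurableTypeR R) := `](eps * q ^+ k.+1)%R, eps]%classic.
  have mA : measurable A by exact: measurable_itv.
  have mB : measurable B by exact: measurable_itv.
  have AB : A `&` B = set0.
    apply/seteqP; split => // r; rewrite /A /B /= !in_itv /= => -[/andP[_ r1] /andP[r2 _]].
    by have := lt_le_trans r2 r1; rewrite ltxx.
  have ABD : A `|` B `<=` D.
    move=> r [|]; rewrite /A /B /D /= !in_itv /= => /andP[r1 r2].
      by rewrite r1 (le_trans r2).
    by rewrite r2 (lt_trans _ r1).
  have hD r : D r -> (0 <= h r)%E.
    by rewrite /D /= in_itv /= => /andP[r1 _]; apply/h_ge0/(lt_trans _ r1).
  apply: le_trans (lower_integral_setU mu mA mB AB ABD hD).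
  rewrite big_nat_recr//= mulrDr addrC EFinD; apply: leeD => //.
  have := h_lower (eq0 k.+1) (eqlt k) (a0 k); rewrite /a fineK// lexx => /(_ isT).
  rewrite mulrC; suff -> : eps * q ^+ k.+1 / (eps * q ^+ k) = q by [].
  by rewrite exprS; field; rewrite !gt_eqF.
have P_le k : \sum_(0 <= j < k) a j <= fine I / (1 - q).
  rewrite ler_pdivlMr ?subr_gt0// mulrC -lee_fin fineK//.
  apply: (le_trans (sum_le k)); apply: h_sub => //; exact: ltW.
pose P := [set \sum_(0 <= j < k) a j | k in [set: nat]].
have hP : has_sup P.
  by split; [exists 0, 0%N => //; rewrite big_geq|exists (fine I / (1 - q)) => _ [k _ <-]].
have e20 : 0 < eta / 2 by rewrite divr_gt0.
have [_ [J0 _ <-] HJ0] := sup_adherent e20 hP.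
have tail k : \sum_(0 <= j < k) a (J0 + j)%N <= eta / 2.
  have : \sum_(0 <= j < J0 + k) a j <= sup P by apply: sup_ubound => //; [case: hP|exists (J0 + k)%N].
  rewrite (@big_cat_nat _ _ _ J0)//= ?leq_addr// -{2}[J0]add0n big_addn addKn.
  under [X in _ + X <= _]eq_bigr do rewrite addnC.
  move: HJ0; move: (sup P) (\sum_(0 <= j < J0) a j) (\sum_(0 <= j < k) _) => x y z; lra.
pose c := eta / 2 * (1 - q).
have c0 : 0 < c by rewrite mulr_gt0// subr_gt0.
exists (fun j => a (J0 + j)%N + c * q ^+ j); exists (eps * q ^+ J0.+1) => //; split.
- by move=> J; rewrite ltr_wpDl// mulr_gt0.
- move=> J; rewrite -mulrA -exprD addSn; split; first exact: Mfin.
  by rewrite lerDl ltW// mulr_gt0.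
- move=> k; rewrite big_split /= -mulr_sumr [leRHS]splitr; apply: lerD => //.
  rewrite /c -mulrA ler_piMr ?(ltW e20)//.
  have q1' : 0 < 1 - q by rewrite subr_gt0.
  by rewrite mulrC -ler_pdivlMr// mul1r; apply: sum_geometric_le => //; exact: ltW.
Qed.

End LogarithmicSums.

(** * Geodesics near a pair of invisible points *)

Section Compactness.
Variables (R : realType) (n : nat).
Implicit Types (v w z p : 'rV[R[i]]_n).

Lemma enorm_complexify_le (x : 'rV[R]_(n + n)) :
  enorm (complexify x) <= (n + n)%:R * `|x|.
Proof. by have := enorm_le_realify (complexify x); rewrite complexifyK. Qed.

Lemma closed_bounded_compact (A : set 'rV[R[i]]_n) r :
  closed A -> (forall z, A z -> enorm z <= r) -> compact A.
Proof.
move=> cA Ar.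
pose B := [set x : 'rV[R]_(n + n) | `|x| <= r].
have cB : compact B.
  apply: bounded_closed_compact.
    exists r; split => //; first exact: num_real.
    by move=> M rM x Bx; apply: (le_trans Bx); exact: ltW.
  have -> : B = (fun x : 'rV[R]_(n + n) => `|x|) @^-1` [set y : R | y <= r] by [].
  apply: closed_comp; last exact: closed_le.
  by move=> x _; exact: norm_continuous.
apply: (@subclosed_compact _ A (complexify @` B)) => //.
- apply: continuous_compact => //; apply: continuous_subspaceT => x U /= /nbhs_enormP[e e0 He].
  have c0 : 0 < (n + n)%:R + 1 :> R by rewrite ltr_wpDl.
  apply/nbhs_ballP; exists (e / ((n + n)%:R + 1)); first by rewrite /= divr_gt0.
  move=> y; rewrite -ball_normE /= distrC ltr_pdivlMr// => xy.
  apply: He; apply: le_lt_trans xy.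
  have -> : complexify y - complexify x = complexify (y - x).
    by apply/rowP => j; rewrite !mxE; apply/eqP; rewrite eq_complex /= !eqxx.
  apply: (le_trans (enorm_complexify_le _)).
  by rewrite mulrC ler_wpM2l// lerDl.
- move=> z Az; exists (realify z); last exact: realifyK.
  exact: (le_trans (norm_realify_le _) (Ar z Az)).
Qed.

(** The nested sets [Q e] generate a proper filter containing a compact set, and a cluster point of
    it is approached by every [Q e]. *)
Lemma cluster_point (Q : R -> set 'rV[R[i]]_n) r :
  (forall e, 0 < e -> Q e !=set0) -> (forall e e', e <= e' -> Q e `<=` Q e') ->
  (forall e z, Q e z -> enorm z <= r) ->
  exists z, forall e d, 0 < e -> 0 < d -> exists2 w, Q e w & enorm (w - z) < d.
Proof.
move=> Q0 Qle Qr.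
pose B := closure [set z : 'rV[R[i]]_n | enorm z <= r].
have cB : compact B.
  apply: (@closed_bounded_compact _ (r + 1)); first exact: closed_closure.
  move=> z /closure_enormP/(_ 1 ltr01)[w /= wr wz].
  have -> : z = w + (z - w) by rewrite addrC subrK.
  apply: (le_trans (enormD _ _)); rewrite lerD// enorm_distC; exact: ltW.
pose F := filter_from [set e : R | 0 < e] Q.
have PF : ProperFilter F.
  apply: filter_from_proper; last by move=> e; exact: Q0.
  apply: filter_from_filter; first by exists 1; exact: ltr01.
  move=> e e' /= e0 e'0; exists (Num.min e e'); first by rewrite /= lt_min e0.
  move=> z Qz; split; apply: Qle Qz; first by rewrite ge_min lexx.
  by rewrite ge_min lexx orbT.
have FB : F B.
  exists 1; first exact: ltr01.
  by move=> z Qz; apply: subset_closure; exact: (Qr _ _ Qz).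
have [z [_ cl]] := cB F PF FB.
exists z => e d e0 d0.
have FQ : F (Q e) by exists e.
have Nz : nbhs z [set w | enorm (w - z) < d] by apply/nbhs_enormP; exists d.
by have [w [Qw wz]] := cl _ _ FQ Nz; exists w.
Qed.

End Compactness.

Section Curves.
Variables (R : realType) (n : nat).
Variable Omega : set 'rV[R[i]]_n.
Hypotheses (oO : open Omega) (bO : boundary Omega !=set0).
Implicit Types (v w z p : 'rV[R[i]]_n).

Lemma absolutely_continuous_dist (gamma : R -> 'rV[R[i]]_n) : absolutely_continuous 0 1 gamma ->
  forall eps, 0 < eps -> exists2 delta : R, 0 < delta &
    forall s t, 0 <= s -> s <= 1 -> 0 <= t -> t <= 1 -> `|t - s| < delta ->
      enorm (gamma t - gamma s) < eps.
Proof.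
move=> ac eps e0; have [d d0 H] := ac _ e0; exists d => //.
have H' s t : 0 <= s -> s <= t -> t <= 1 -> t - s < d -> enorm (gamma t - gamma s) < eps.
  move=> s0 st t1 ts; have := H 1%N (fun=> s) (fun=> t); rewrite !big_ord1; apply => //.
  by move=> i j; rewrite !ord1 eqxx.
move=> s t s0 s1 t0 t1; have [st|/ltW ts] := leP s t.
  by rewrite ger0_norm ?subr_ge0//; exact: H'.
by rewrite ler0_norm ?subr_le0// opprB enorm_distC; exact: H'.
Qed.

Lemma geodesic_length_curve lambda eps gamma a b : geodesic Omega lambda eps gamma ->
  0 <= a -> b <= 1 ->
  length_curve Omega gamma (fun s t => fine (kappa_length_oc Omega gamma s t)) a b.
Proof.
move=> [gO ac geo] a0 b1.
have fin s t : a <= s -> s <= t -> t <= b -> kappa_length_oc Omega gamma s t \is a fin_num.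
  move=> as_ st tb; rewrite ge0_fin_numE ?kappa_length_oc_ge0//.
  apply: (le_lt_trans (kappa_length_oc_le _ _ _ _)).
  apply: (le_lt_trans (geo s t _ st _)); rewrite ?ltry//; first exact: le_trans as_.
  exact: le_trans b1.
have in01 t : a <= t -> t <= b -> 0 <= t <= 1.
  by move=> at_ tb; rewrite (le_trans a0 at_) (le_trans tb b1).
split.
- by move=> t at_ tb; apply/gO/in01.
- move=> s as_ sb e e0; have [d d0 H] := absolutely_continuous_dist ac e0.
  exists d => // t at_ tb ts; apply/ltW.
  by have /andP[? ?] := in01 s as_ sb; have /andP[? ?] := in01 t at_ tb; exact: H.
- by move=> s t as_ st tb; apply/fine_ge0/kappa_length_oc_ge0.
- move=> s t u as_ st tu ub.
  have at_ := le_trans as_ st; have tb := le_trans tu ub.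
  rewrite -lee_fin EFinD !fineK ?fin//; last exact: le_trans tu.
  exact: kappa_length_oc_superadditive.
- move=> s t k x as_ st tb k0 H; rewrite -lee_fin fineK ?fin//.
  apply: kappa_length_oc_ge => //; [exact: le_trans as_|exact: le_trans b1].
Qed.

Lemma length_curve_rev g L a b : length_curve Omega g L a b ->
  length_curve Omega (fun t => g (- t)) (fun s t => L (- t) (- s)) (- b) (- a).
Proof.
move=> [lin lcont l0 ladd llow].
have nb x : - b <= x -> - x <= b by rewrite lerNl.
have na x : x <= - a -> a <= - x by rewrite lerNr.
have nn (x y : R) : x <= y -> - y <= - x by rewrite lerN2.
split.
- by move=> t bt ta; apply: lin; auto.
- move=> s bs sa e e0; have [d d0 H] := lcont (- s) (na _ sa) (nb _ bs) e e0.
  exists d => // t bt ta ts; apply: H; [exact: na|exact: nb|].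
  by rewrite -opprD normrN.
- by move=> s t bs st ta; apply: l0; auto.
- by move=> s t u bs st tu ua; rewrite addrC; apply: ladd; auto.
- move=> s t k x bs st ta k0 H; rewrite distrC; apply: llow; auto.
  by move=> u v tu us; rewrite -[u]opprK; apply: H; rewrite ?lerN2 1?lerNr// lerNl.
Qed.

Lemma length_curve_sub g L a b a' b' : length_curve Omega g L a b -> a <= a' -> b' <= b ->
  length_curve Omega g L a' b'.
Proof.
move=> [lin lcont l0 ladd llow] aa bb.
have ge_a x : a' <= x -> a <= x by exact: le_trans.
have le_b x : x <= b' -> x <= b by move/le_trans; apply.
split.
- by move=> *; apply: lin; auto.
- move=> s as_ sb e e0; have [d d0 H] := lcont _ (ge_a _ as_) (le_b _ sb) _ e0.
  by exists d => // *; apply: H; auto.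
- by move=> *; apply: l0; auto.
- by move=> *; apply: ladd; auto.
- by move=> *; apply: llow; auto.
Qed.

(** The compact set in the definition of visibility is taken to consist of the points of the ball of
    radius [R0] whose boundary distance is at least [h]: a geodesic that misses it stays close to
    the boundary until it first leaves the ball. *)
Lemma thin_geodesics p q eps R0 h sigma : ~ visible_pair Omega 1 eps p q ->
  0 < sigma -> sigma < R0 -> R0 < enorm (q - p) -> 0 < h ->
  exists gamma b, [/\ geodesic Omega 1 eps gamma, 0 <= b <= 1,
    enorm (gamma 0 - p) < sigma, enorm (gamma b - p) = R0 &
    forall t, 0 <= t -> t <= b -> enorm (gamma t - p) <= R0 /\ bdist Omega (gamma t) <= h].
Proof.
move=> nvis sigma0 sR Rq h0.
pose Up := [set z : 'rV[R[i]]_n | enorm (z - p) < sigma].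
pose Uq := [set z : 'rV[R[i]]_n | enorm (z - q) < enorm (q - p) - R0].
pose K := [set z | [/\ Omega z, enorm (z - p) <= R0 & h <= bdist Omega z]].
have K1 : closure K `<=` Omega.
  move=> z /closure_enormP/(_ _ h0)[w [Ow _ hw] wz].
  by apply: (ball_bdist_sub oO Ow); rewrite enorm_distC; apply: lt_le_trans hw.
have K2 : compact (closure K).
  apply: (@closed_bounded_compact _ _ _ (R0 + 1 + enorm p)); first exact: closed_closure.
  move=> z /closure_enormP/(_ 1 ltr01)[w [_ wR _] wz].
  have -> : z = (w - p) + (z - w) + p by rewrite [_ + (z - w)]addrC subrKA subrK.
  apply: (le_trans (enormD _ _)); rewrite lerD2r; apply: (le_trans (enormD _ _)).
  by rewrite lerD// enorm_distC ltW.
have [gamma [geo g0 g1 nK]] : exists gamma, [/\ geodesic Omega 1 eps gamma,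
    Up (gamma 0), Uq (gamma 1) & forall t, 0 <= t -> t <= 1 -> ~ K (gamma t)].
  apply/not_existsP => H; apply: nvis; exists Up, Uq, K; split => //.
  - by apply/nbhs_enormP; exists sigma.
  - by apply/nbhs_enormP; exists (enorm (q - p) - R0); rewrite ?subr_gt0.
  - move=> gamma geo [_ g0] [_ g1]; apply/not_exists2P => H2; apply: (H gamma); split => //.
    by move=> t t0 t1 Kt; have [] := H2 t; rewrite ?t0.
have [gO ac _] := geo.
have cF : cont_on (fun t => enorm (gamma t - p)) 0 1.
  move=> s s0 s1 e e0; have [d d0 H] := absolutely_continuous_dist ac e0.
  exists d => // t t0 t1 ts; apply/ltW; apply: le_lt_trans (H s t s0 s1 t0 t1 ts).
  rewrite ler_norml; apply/andP; split.
    rewrite lerBrDr addrC lerBlDr; apply: (le_trans (enorm_dist_triangle _ (gamma t) _)).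
    by rewrite addrC [enorm (gamma s - _)]enorm_distC.
  rewrite lerBlDr; exact: enorm_dist_triangle.
have F0 : enorm (gamma 0 - p) < R0 by exact: lt_trans g0 sR.
have F1 : R0 < enorm (gamma 1 - p).
  have := enorm_dist_triangle q (gamma 1) p; rewrite [enorm (q - gamma 1)]enorm_distC.
  move: g1; rewrite /Uq /=; move: (enorm (q - p)) (enorm _) (enorm _) => x y z; lra.
have [H|[b [b0 b1 Fb Hb]]] := first_exit ler01 cF F0.
  by have := H 1 ler01 (lexx _); rewrite leNgt F1.
exists gamma, b; split => //; first by rewrite b0.
move=> t t0 tb; split; first exact: Hb.
rewrite leNgt; apply/negP => ht; apply: (nK t t0 (le_trans tb b1)); split.
- by apply: gO; rewrite t0 (le_trans tb b1).
- exact: Hb.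
- exact: ltW.
Qed.

End Curves.

Section RealDecay.
Variable R : realType.
Implicit Types A C h : R.

(** Solving J / 8 <= C - A ln x - A ln x0 for x, given x <= 2 x0, yields x <=
    [decay_const A C * decay_rate A ^+ J]. *)
Definition decay_const A C : R := expR ((C + A * ln 2) / (2 * A)).
Definition decay_rate A : R := expR (- (16 * A)^-1).

(** One factor [x] is bounded by [h] and the other by the exponential decay; the square is thus
    geometric in [J] with a constant that becomes small with [h]. *)
Lemma peak_decay_real A C h (x x0 : R) (J : nat) : 0 < A -> 0 < x -> 0 < x0 ->
  x <= 2 * x0 -> x <= h -> J%:R * 8^-1 <= C - A * ln x - A * ln x0 ->
  x ^+ 2 <= h * (decay_const A C * decay_rate A ^+ J).
Proof.
move=> A0 x_gt0 x00 xx0 xh HJ.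
have A2 : 0 < 2 * A by rewrite mulr_gt0.
have h1 : ln x <= ln 2 + ln x0.
  by rewrite -lnM ?posrE// ler_ln ?posrE// mulr_gt0.
have h2 : ln x <= (C + A * ln 2) / (2 * A) + (- (16 * A)^-1) * J%:R.
  have -> : - (16 * A)^-1 * J%:R = - (J%:R * 8^-1) / (2 * A).
    by field; rewrite gt_eqF.
  rewrite -mulrDl ler_pdivlMr//.
  have h3 : A * ln x <= A * ln 2 + A * ln x0 by rewrite -mulrDr ler_pM2l.
  have -> : ln x * (2 * A) = A * ln x + A * ln x by ring.
  move: HJ h3; move: (A * ln x) (A * ln x0) (A * ln 2) (_ * 8^-1) => u v w z; lra.
rewrite expr2; apply: ler_pM; rewrite ?(ltW x_gt0)//.
rewrite -[X in X <= _]lnK ?posrE//.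
by rewrite /decay_const /decay_rate -expRM_natr -expRD ler_expR.
Qed.

End RealDecay.

Section PeakDecay.
Variables (R : realType) (n : nat).
Variable Omega : set 'rV[R[i]]_n.
Hypotheses (oO : open Omega) (cO : convex_set Omega) (bO : boundary Omega !=set0).
Implicit Types (v w z p : 'rV[R[i]]_n).
Local Notation len gamma s t := (fine (kappa_length_oc Omega gamma s t)).

(* [t0] almost maximises the boundary distance, so that the upper bound on the
   Kobayashi distance from [gamma t0] only involves [bdist (gamma t)]. *)
Lemma peak_decay o (D A C eps h b : R) gamma : 0 < A ->
  (forall x y, Omega x -> Omega y -> enorm (x - o) <= D -> enorm (y - o) <= D ->
   kobayashi Omega x y <= C - A * ln (bdist Omega x) - A * ln (bdist Omega y)) ->
  geodesic Omega 1 eps gamma -> 0 <= b -> b <= 1 ->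
  (forall t, 0 <= t -> t <= b -> enorm (gamma t - o) <= D /\ bdist Omega (gamma t) <= h) ->
  exists t0 : R, [/\ 0 <= t0, t0 <= b,
    forall (J : nat) t, t0 <= t -> t <= b -> J%:R * 8^-1 <= len gamma t0 t ->
      bdist Omega (gamma t) ^+ 2 <= h * (decay_const A (C + eps) * decay_rate A ^+ J)
    & forall (J : nat) t, 0 <= t -> t <= t0 -> J%:R * 8^-1 <= len gamma t t0 ->
      bdist Omega (gamma t) ^+ 2 <= h * (decay_const A (C + eps) * decay_rate A ^+ J)].
Proof.
move=> A0 kob geo b0 b1 Hb.
have [gO ac glen] := geo.
have Og t : 0 <= t -> t <= b -> Omega (gamma t) by move=> t0 tb; apply: gO; rewrite t0 (le_trans tb).
have lenle s t : 0 <= s -> s <= t -> t <= b ->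
    len gamma s t <= C + eps - A * ln (bdist Omega (gamma s)) - A * ln (bdist Omega (gamma t)).
  move=> s0 st tb.
  have t1 := le_trans tb b1; have t0 := le_trans s0 st; have sb := le_trans st tb.
  have h1 := le_trans (kappa_length_oc_le Omega gamma s t) (glen s t s0 st t1).
  have fin : kappa_length_oc Omega gamma s t \is a fin_num.
    by rewrite ge0_fin_numE ?kappa_length_oc_ge0//; apply: (le_lt_trans h1); rewrite ltry.
  move: h1; rewrite -(fineK fin) lee_fin mul1r => h1; apply: (le_trans h1).
  have := kob _ _ (Og s s0 sb) (Og t t0 tb) (Hb s s0 sb).1 (Hb t t0 tb).1.
  by move: (kobayashi _ _ _) (A * _) (A * _) => x y z; lra.
pose S := [set bdist Omega (gamma t) | t in [set t | 0 <= t /\ t <= b]].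
have hS : has_sup S.
  split; first by exists (bdist Omega (gamma 0)), 0.
  by exists h => _ [t [t0 tb] <-]; have [] := Hb t t0 tb.
have S0 : 0 < sup S.
  apply: (lt_le_trans (bdist_gt0 oO bO (Og 0 (lexx _) b0))).
  by apply: sup_ubound; [case: hS|exists 0].
have [_ [t0 [t00 t0b] <-] Ht0] := sup_adherent (divr_gt0 S0 (ltr0n R 2)) hS.
have half t : 0 <= t -> t <= b -> bdist Omega (gamma t) <= 2 * bdist Omega (gamma t0).
  move=> tt0 tb; have : bdist Omega (gamma t) <= sup S by apply: sup_ubound; [case: hS|exists t].
  by move: Ht0; move: (sup S) (bdist _ _) (bdist _ _) => x y z; lra.
have pos t : 0 <= t -> t <= b -> 0 < bdist Omega (gamma t).
  by move=> tt0 tb; apply: bdist_gt0 => //; exact: Og.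
exists t0; split => // J t.
  move=> t0t tb HJ; have tt0 := le_trans t00 t0t.
  apply: (peak_decay_real A0 (pos t tt0 tb) (pos t0 t00 t0b) (half t tt0 tb)).
    by have [] := Hb t tt0 tb.
  apply: (le_trans HJ); apply: (le_trans (lenle t0 t t00 t0t tb)).
  by move: (A * _) (A * _) => x y; lra.
move=> tt0 t_t0 HJ; have tb := le_trans t_t0 t0b.
apply: (peak_decay_real A0 (pos t tt0 tb) (pos t0 t00 t0b) (half t tt0 tb)).
  by have [] := Hb t tt0 tb.
exact: (le_trans HJ (lenle t t0 tt0 t_t0 t0b)).
Qed.

End PeakDecay.

Section RealDecayBound.
Variable R : realType.
Implicit Types A h x : R.

Lemma decay_bound (M x h B q s : R) (m J : nat) : 0 <= M -> 0 <= x -> 0 <= q -> 0 <= s ->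
  x ^+ 2 <= h * (B * (q ^+ (2 * m)) ^+ J) -> M ^+ 2 * (h * B) <= (s ^+ m) ^+ 2 ->
  M * x <= (s * q ^+ J) ^+ m.
Proof.
move=> M0 x0 q0 s0 H1 H2.
have y0 : 0 <= (s * q ^+ J) ^+ m by rewrite exprn_ge0// mulr_ge0// exprn_ge0.
rewrite -(@ler_pXn2r _ 2)// ?nnegrE ?mulr_ge0// exprMn.
apply: (le_trans (ler_wpM2l (exprn_ge0 _ M0) H1)).
have -> : M ^+ 2 * (h * (B * (q ^+ (2 * m)) ^+ J)) = M ^+ 2 * (h * B) * (q ^+ (2 * m)) ^+ J by ring.
have -> : ((s * q ^+ J) ^+ m) ^+ 2 = (s ^+ m) ^+ 2 * (q ^+ (2 * m)) ^+ J.
  rewrite !exprMn; congr (_ * _); rewrite -!exprM; congr (_ ^+ _).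
  by rewrite mulnC [(m * 2)%N]mulnC.
by rewrite ler_wpM2r// exprn_ge0// exprn_ge0.
Qed.

Lemma normal_sum (E e k r x y z u : R) : 0 <= r -> e <= E -> k <= E ->
  x <= E + E -> y <= k + E -> z <= e -> u <= x + y * r + z -> u <= (3 + 2 * r) * E.
Proof.
move=> r0 eE kE xE yE ze uE.
have : y * r <= (E + E) * r by rewrite ler_wpM2r//; lra.
have -> : (3 + 2 * r) * E = 3 * E + (E + E) * r by ring.
by move: (_ * r) ((E + E) * r) uE => a b; lra.
Qed.

End RealDecayBound.

Section NormalCoordinate.
Variables (R : realType) (n : nat).
Variable Omega : set 'rV[R[i]]_n.
Hypotheses (oO : open Omega) (cO : convex_set Omega).
Implicit Types (v w z p : 'rV[R[i]]_n).

(** The drift estimate is run forwards from the peak of the boundary distance and, on the reversed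
    curve, backwards. This compares the normals along the curve with the one at the peak and,
    through the starting point near [p], with the one at [p]. *)
Lemma normal_coordinate_small (c : 'rV[R[i]]_n -> 'I_n -> R[i]) p (r M K sig0 eps eta : R) (N : nat) :
  boundary Omega p -> 0 < r -> 0 < M -> 0 < K -> 0 < sig0 ->
  (forall x, boundary Omega x -> enorm (x - p) < r ->
     support_form Omega x (c x) /\ forall v, cabs (cform (c x) v) <= M * enorm v) ->
  (forall x y, boundary Omega x -> boundary Omega y ->
      enorm (x - p) < r -> enorm (y - p) < r ->
      forall s, 0 < s -> s <= sig0 ->
      complex.Re (cform (c x) (y - x)) <= s ^+ N.+1 ->
      forall v, cabs (cform (c x) v - cform (c y) v) <= K * s * enorm v) ->
  0 < eta ->
  exists h sigma, [/\ 0 < h, 0 < sigma & forall gamma b,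
    geodesic Omega 1 eps gamma -> 0 <= b <= 1 -> enorm (gamma 0 - p) < sigma ->
    (forall t, 0 <= t -> t <= b -> enorm (gamma t - p) <= r / 2 /\ bdist Omega (gamma t) <= h) ->
    forall t, 0 <= t -> t <= b -> cabs (cform (c p) (gamma t - p)) <= eta].
Proof.
move=> bp r0 M0 K0 sig00 frame jump eta0.
have bO : boundary Omega !=set0 by exists p.
have [z0 Oz0 _] := (closure_enormP Omega p).1 (boundary_closure bp) 1 ltr01.
have [C [A [A0 kob]]] := kobayashi_upper_bound oO cO bO (r / 2 + enorm (p - z0)) Oz0.
pose B := decay_const A (C + eps).
have B0 : 0 < B by exact: expR_gt0.
(* Chosen with q ^ (2 (N + 1)) = [decay_rate A]: the decay is that of the squared distance, and the
   jump estimate involves the power N + 1. *)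
pose q := expR (- (16 * A)^-1 / (2 * N.+1)%:R).
have q0 : 0 < q by exact: expR_gt0.
have q1 : q < 1.
  by rewrite /q expR_lt1 mulNr oppr_lt0 divr_gt0 ?ltr0n// invr_gt0 mulr_gt0.
have qE : q ^+ (2 * N.+1) = decay_rate A.
  by rewrite /q -expRM_natr divfK// pnatr_eq0.
pose W := 1 + n%:R * K * (1 + r).
have W0 : 0 < W by rewrite ltr_wpDr// !mulr_ge0// ?ltW// addr_gt0.
have p1 : 0 < 1 - q by rewrite subr_gt0.
have p3 : 0 < 3 + 2 * r by rewrite addr_gt0// mulr_gt0.
have W3 : 0 < W * (3 + 2 * r) by exact: mulr_gt0.
(* The final error is (3 + 2 r) W sig / (1 - q), which the last entry keeps below [eta]. *)
pose sig := Num.min (Num.min sig0 1) (eta * (1 - q) / (W * (3 + 2 * r))).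
have sig_gt0 : 0 < sig by rewrite !lt_min sig00 ltr01/= divr_gt0// mulr_gt0.
have [sigs0 sig1 sigE] : [/\ sig <= sig0, sig <= 1 & sig <= eta * (1 - q) / (W * (3 + 2 * r))].
  by rewrite /sig !ge_min !lexx/= !orbT.
clearbody sig.
have S0 : 0 < sig ^+ N.+1 by rewrite exprn_gt0.
(* In order, the entries bring [pi 0] close enough to [p] for the jump estimate, keep every [pi t]
   within [r] of [p], and start the geometric decay below the drift thresholds. *)
pose h := Num.min (Num.min (sig ^+ N.+1 / (4 * M)) (r / 8)) ((sig ^+ N.+1) ^+ 2 / ((6 * M) ^+ 2 * B)).
have M40 : 0 < 4 * M by rewrite mulr_gt0.
have M60 : 0 < (6 * M) ^+ 2 * B by rewrite mulr_gt0// exprn_gt0// mulr_gt0.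
have h_gt0 : 0 < h by rewrite !lt_min !divr_gt0// exprn_gt0.
have [h1 h2 h3] : [/\ h <= sig ^+ N.+1 / (4 * M), h <= r / 8 &
    h <= (sig ^+ N.+1) ^+ 2 / ((6 * M) ^+ 2 * B)].
  by rewrite /h !ge_min !lexx/= !orbT.
clearbody h.
pose sigma := sig ^+ N.+1 / (2 * M).
have M20 : 0 < 2 * M by rewrite mulr_gt0.
have sigma0 : 0 < sigma by rewrite divr_gt0.
have Msigma : M * sigma = sig ^+ N.+1 / 2 by rewrite /sigma; field; rewrite gt_eqF.
have Mh : M * h <= sig ^+ N.+1 / 4.
  apply: (@le_trans _ _ (M * (sig ^+ N.+1 / (4 * M)))); first by rewrite ler_pM2l.
  by rewrite le_eqVlt; apply/orP; left; apply/eqP; field; rewrite gt_eqF.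
clearbody sigma.
exists h, sigma; split => // gamma b geo /andP[b0 b1] g0p Hb.
have [gO ac glen] := geo.
have Hb' t : 0 <= t -> t <= b -> enorm (gamma t - z0) <= r / 2 + enorm (p - z0) /\
    bdist Omega (gamma t) <= h.
  move=> t0 tb; have [g1 g2] := Hb t t0 tb; split => //.
  by apply: (le_trans (enorm_dist_triangle _ p _)); rewrite lerD2r.
have [t0 [t00 t0b fwd bwd]] := peak_decay oO bO A0 kob geo b0 b1 Hb'.
have Og t : 0 <= t -> t <= b -> Omega (gamma t) by move=> tt0 tb; apply: gO; rewrite tt0 (le_trans tb).
(* An almost nearest boundary point suffices, with positivity of the boundary distance as slack;
   outside [0, b] the choice is arbitrary. *)
have Hpi t : exists x, 0 <= t -> t <= b ->
    boundary Omega x /\ enorm (gamma t - x) <= 2 * bdist Omega (gamma t).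
  have [tt0|tt0] := leP 0 t; last by exists p.
  have [tb|tb] := leP t b; last by exists p.
  have d0 : 0 < bdist Omega (gamma t) by apply: (bdist_gt0 oO bO); exact: Og.
  have [x bx dx] := bdist_near bO (gamma t) d0.
  by exists x => *; split => //; apply/ltW; rewrite mulr_natl mulr2n.
have [pi piE] := choice Hpi.
have piP t : 0 <= t -> t <= b -> [/\ boundary Omega (pi t), enorm (pi t - p) < r,
     enorm (gamma t - pi t) <= 2 * bdist Omega (gamma t) & enorm (gamma t - p) <= r / 2].
  move=> tt0 tb; have [g1 g2] := Hb t tt0 tb; have [bx dx] := piE t tt0 tb; split => //.
  apply: (le_lt_trans (enorm_dist_triangle _ (gamma t) _)); rewrite [X in X + _]enorm_distC.
  move: g1 g2 dx; move: (enorm _) (enorm _) (bdist _ _) => x y z.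
  by move: h2 r0; clear; lra.
have bound J t : 0 <= t -> bdist Omega (gamma t) ^+ 2 <= h * (B * decay_rate A ^+ J) ->
    6 * M * bdist Omega (gamma t) <= (sig * q ^+ J) ^+ N.+1.
  move=> tt0; rewrite -qE => H; apply: decay_bound H _; rewrite ?(bdist_ge0 bO)//.
  - by rewrite mulr_ge0// ltW.
  - exact: ltW.
  - exact: ltW.
  - move: h3; rewrite ler_pdivlMr//.
    by rewrite mulrCA mulrA.
have lcg := geodesic_length_curve geo (lexx 0) b1.
pose E := W * sig / (1 - q).
have drift1 t : t0 <= t -> t <= b ->
    cabs (cform (c (pi t0)) (gamma t - gamma t0)) + form_dist (c (pi t0)) (c (pi t)) <= E.
  apply: (normal_drift oO (length_curve_sub lcg t00 (lexx b)) r0 M0 K0 t0b frame jump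
    sig_gt0 sigs0 sig1 q0 q1).
  - by move=> u t0u ub; apply: piP => //; exact: le_trans t0u.
  - move=> J u t0u ub HJ; apply: bound; [exact: le_trans t0u|exact: fwd].
have drift2 t : 0 <= t -> t <= t0 ->
    cabs (cform (c (pi t0)) (gamma t - gamma t0)) + form_dist (c (pi t0)) (c (pi t)) <= E.
  move=> tt0 t_t0.
  have lcr := length_curve_rev (length_curve_sub lcg (lexx 0) t0b).
  have le0 : - t0 <= - 0 by rewrite lerN2.
  have := normal_drift oO lcr (pi := fun t => pi (- t)) r0 M0 K0 le0 frame jump
    sig_gt0 sigs0 sig1 q0 q1.
  rewrite opprK => H.
  have := H _ _ (- t); rewrite opprK; apply.
  - move=> u; rewrite oppr0 lerNl => ut0 u0; apply: piP; first by rewrite lerNr oppr0.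
    exact: le_trans t0b.
  - move=> J u; rewrite oppr0 lerNl => ut0 u0 HJ.
    have u0' : 0 <= - u by rewrite lerNr oppr0.
    by apply: bound => //; apply: bwd.
  - by rewrite lerN2.
  - by rewrite oppr0 lerNl oppr0.
have drift t : 0 <= t -> t <= b ->
    cabs (cform (c (pi t0)) (gamma t - gamma t0)) + form_dist (c (pi t0)) (c (pi t)) <= E.
  by move=> tt0 tb; have [/drift2|/ltW/drift1] := leP t t0; apply.
have [bp0 pp0 dp0 _] := piP 0 (lexx 0) b0.
have pin : enorm (p - p) < r by rewrite subrr enorm0.
have Mp v : cabs (cform (c p) v) <= M * enorm v by exact: (frame p bp pin).2.
have fd0 : form_dist (c p) (c (pi 0)) <= n%:R * (K * sig).
  apply: form_dist_le; apply: jump => //.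
  apply: (le_trans (ler_norm _)); apply: (le_trans (Re_le_cabs _)); apply: (le_trans (Mp _)).
  have : M * enorm (pi 0 - p) <= M * (2 * h + sigma).
    rewrite ler_pM2l//; apply: (le_trans (enorm_dist_triangle _ (gamma 0) _)).
    have [_ g2] := Hb 0 (lexx 0) b0.
    apply: lerD; last exact: ltW.
    by rewrite enorm_distC; apply: (le_trans dp0); rewrite ler_pM2l.
  rewrite mulrDr Msigma mulrCA; move: Mh; move: (M * h) (M * _) (sig ^+ N.+1) => x y z.
  by clear; lra.
have sigW k : 0 <= k -> k <= W -> k * sig <= E.
  move=> k0 kW; rewrite /E ler_pdivlMr//; apply: (@le_trans _ _ (k * sig)).
    by rewrite ler_piMr ?mulr_ge0 ?(ltW sig_gt0)// lerBlDr lerDl ltW.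
  by rewrite ler_pM2r.
have nK0 : 0 <= n%:R * K by rewrite mulr_ge0// ltW.
have nKr : 0 <= n%:R * K * r by rewrite mulr_ge0// ltW.
have sigle : sig <= E.
  by have := sigW 1 ler01; rewrite mul1r; apply; rewrite /W lerDl mulr_ge0// addr_ge0// ltW.
have nKE : n%:R * (K * sig) <= E.
  rewrite mulrA; apply: sigW => //; rewrite /W mulrDr mulr1 addrCA lerDl addr_ge0//.
have Ele : (3 + 2 * r) * E <= eta.
  have -> : (3 + 2 * r) * E = sig * (W * (3 + 2 * r)) / (1 - q) by rewrite /E; ring.
  by rewrite ler_pdivrMr// -ler_pdivlMr.
have S1 : sig ^+ N.+1 <= sig.
  by rewrite exprS ler_piMr ?(ltW sig_gt0)// exprn_ile1// ltW.
clearbody E.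
move=> t tt0 tb; apply: le_trans Ele.
have cut : cabs (cform (c (pi t0)) (gamma t - gamma 0)) <= E + E.
  have -> : gamma t - gamma 0 = (gamma t - gamma t0) - (gamma 0 - gamma t0).
    by rewrite opprB subrKA.
  rewrite cformB; apply: (le_trans (cabsB _ _)); apply: lerD.
    by apply: le_trans (drift t tt0 tb); rewrite lerDl form_dist_ge0.
  by apply: le_trans (drift 0 (lexx 0) b0); rewrite lerDl form_dist_ge0.
have fd : form_dist (c p) (c (pi t0)) <= n%:R * (K * sig) + E.
  apply: (le_trans (form_dist_triangle _ (c (pi 0)) _)); apply: lerD => //.
  by rewrite form_distC; apply: le_trans (drift 0 (lexx 0) b0); rewrite lerDr cabs_ge0.
have gr : enorm (gamma t - gamma 0) <= r.
  have [g1 _] := Hb t tt0 tb; have [g2 _] := Hb 0 (lexx 0) b0.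
  apply: (le_trans (enorm_dist_triangle _ p _)); rewrite [enorm (p - _)]enorm_distC.
  by rewrite [r]splitr; exact: lerD.
have g0 : cabs (cform (c p) (gamma 0 - p)) <= sig.
  apply: (le_trans (Mp _)); apply: le_trans S1.
  apply: (@le_trans _ _ (M * sigma)); first by rewrite ler_pM2l// ltW.
  by rewrite Msigma ler_pdivrMr// ler_peMr ?(ltW S0)// ler1n.
apply: (@normal_sum _ E sig _ r _ _ _ _ (ltW r0) sigle nKE cut fd g0).
have -> : gamma t - p = (gamma t - gamma 0) + (gamma 0 - p) by rewrite subrKA.
rewrite cformD; apply: (le_trans (cabsD _ _)); rewrite lerD2r.
apply: (le_trans (cform_form_dist _ (c (pi t0)) _)); rewrite lerD2l.
by rewrite ler_wpM2l ?form_dist_ge0.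
Qed.

End NormalCoordinate.

Section GoldilocksPoints.
Variables (R : realType) (n : nat).
Variable Omega : set 'rV[R[i]]_n.
Hypotheses (oO : open Omega) (cO : convex_set Omega).
Implicit Types (v w x y z p : 'rV[R[i]]_n).

Lemma enorm_normalize v : v != 0 -> enorm ((enorm v)^-1%:C *: v) = 1.
Proof.
by rewrite -enorm_gt0 => v0; rewrite enormZ cabsR gtr0_norm ?invr_gt0// mulVf ?gt_eqF.
Qed.

(** The [ereal_sup] of an empty set is -oo, so a point of [Omega] near [x] and a unit vector have to
    be exhibited. *)
Lemma goldilocks_M_ge0 x v U r : boundary Omega x -> nbhs x U -> v != 0 -> 0 < r ->
  (0 <= goldilocks_M Omega U r)%E.
Proof.
move=> bx /nbhs_enormP[e e0 He] v0 r0.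
have er : 0 < Num.min e r by rewrite lt_min e0.
have [z Oz] := (closure_enormP Omega x).1 (boundary_closure bx) _ er.
rewrite lt_min => /andP[ze zr].
have bO : boundary Omega !=set0 by exists x.
apply: (@le_trans _ _ ((kobayashi_royden Omega z ((enorm v)^-1%:C *: v))%:E^-1)%E).
  by rewrite inve_ge0 lee_fin kobayashi_royden_ge0.
apply: ereal_sup_ubound; exists z, ((enorm v)^-1%:C *: v); split => //.
- by split => //; apply: He.
- by apply/ltW; apply: le_lt_trans zr; exact: bdist_le.
- exact: enorm_normalize.
Qed.

Lemma dini_goldilocks x v U eps q eta : boundary Omega x -> nbhs x U -> v != 0 -> 0 < eps ->
  (\int[@lebesgue_measure R]_(r in `]0%R, eps]) (goldilocks_M Omega U r * (r^-1)%:E) < +oo)%E ->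
  0 < q -> q < 1 -> 0 < eta ->
  exists m : nat -> R, exists2 d : R, 0 < d &
    [/\ forall J, 0 < m J,
        forall J z w, Omega z -> U z -> bdist Omega z <= d * q ^+ J ->
          enorm w <= m J * kobayashi_royden Omega z w
      & forall k : nat, \sum_(0 <= j < k) m j <= eta].
Proof.
move=> bx Ux v0 e0 int q0 q1 eta0.
have M0 r : 0 < r -> (0 <= goldilocks_M Omega U r)%E.
  by move=> r0; exact: (goldilocks_M_ge0 bx Ux v0 r0).
have [m [d d0 [m0 Mm Sm]]] := dini_tail (@goldilocks_M_le _ _ Omega U) M0 e0 int q0 q1 eta0.
exists m, d => //; split => // J z w Oz Uz dz; have [fin le] := Mm J.
have dq : 0 < d * q ^+ J by rewrite mulr_gt0// exprn_gt0.
apply: (le_trans (goldilocks_M_bound oO w fin (M0 _ dq) Oz Uz dz)).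
by rewrite ler_wpM2r// kobayashi_royden_ge0.
Qed.

(** Pushed towards a point of [Omega], the flat disc becomes an affine disc inside [Omega] whose
    radius is at least half of [rho], so the metric in direction [v] stays bounded up to the
    boundary. All the [m J] are then bounded below, although their sums are at most 1. *)
Lemma disc_non_goldilocks x v (rho : R) : boundary Omega x -> v != 0 -> 0 < rho ->
  (forall w : R[i], cabs w < rho -> closure Omega (x + w *: v)) ->
  non_goldilocks Omega x.
Proof.
move=> bx v0 rho0 disc; split => // -[_ [U [Ux [eps eps0 int] _]]].
have [m [d d0 [m0 kob Sm]]] := @dini_goldilocks x v U eps 2^-1 1 bx Ux v0 eps0 int
  ltac:(by rewrite invr_gt0) ltac:(by rewrite invf_lt1// ltr1n) ltr01.
have [y Oy _] := (closure_enormP Omega x).1 (boundary_closure bx) 1 ltr01.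
have bO : boundary Omega !=set0 by exists x.
have [e e0 He] := (nbhs_enormP _ _).1 Ux.
have v_gt0 : 0 < enorm v by rewrite enorm_gt0.
have N0 : 0 < enorm (y - x) + 1 by rewrite ltr_wpDl// enorm_ge0.
have mJ J : rho / 2 * enorm v <= m J.
  (* The pushed point lies in [U] and within [d * 2^-1 ^+ J] of the boundary; [s <= 2^-1] preserves
     half of the radius. *)
  pose s := Num.min (2^-1) (Num.min e (d * 2^-1 ^+ J) / (enorm (y - x) + 1)).
  have dJ0 : 0 < d * 2^-1 ^+ J by rewrite mulr_gt0// exprn_gt0// invr_gt0.
  have s0 : 0 < s by rewrite lt_min invr_gt0 ltr0n/= divr_gt0// lt_min e0.
  have s2 : s <= 2^-1 by rewrite /s ge_min lexx.
  have sN : s * (enorm (y - x) + 1) <= Num.min e (d * 2^-1 ^+ J).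
    by rewrite -ler_pdivlMr// /s ge_min lexx orbT.
  have zx : enorm (conv_pt x y s - x) < Num.min e (d * 2^-1 ^+ J).
    apply: lt_le_trans sN; rewrite /conv_pt addrC addKr enormZ cabsR gtr0_norm// ltr_pM2l//.
    by rewrite ltrDl.
  clearbody s; move: zx; rewrite lt_min => /andP[ze zd].
  have zE (u : R[i]) : conv_pt (x + u *: v) y s = conv_pt x y s + ((1 - s)%:C * u) *: v.
    by apply/rowP => j; rewrite !mxE raddfB /=; ring.
  have s1 : s < 1 by apply: (le_lt_trans s2); rewrite invf_lt1// ltr1n.
  have inO (u : R[i]) : cabs u < rho -> Omega (conv_pt x y s + ((1 - s)%:C * u) *: v).
    move=> ur; rewrite -zE.
    have -> : conv_pt (x + u *: v) y s = conv_pt y (x + u *: v) (1 - s).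
      by rewrite !conv_ptE opprB addrCA subrr addr0 addrC.
    by apply: closure_conv_in => //; [exact: disc|lra|lra].
  have Oz : Omega (conv_pt x y s).
    by have := inO 0; rewrite cabs0 mulr0 scale0r addr0; apply.
  have : kobayashi_royden Omega (conv_pt x y s) v <= (rho / 2)^-1.
    apply: ge_inf; first by exists 0 => _ [t [t0 _] <-]; rewrite invr_ge0 ltW.
    exists (rho / 2) => //; split; first by rewrite divr_gt0.
    exists (fun t => conv_pt x y s + t *: v); split.
    - move=> t; rewrite ltc_cabs => tr; have [dt _] := derivable_affine (conv_pt x y s) v t; split => //.
      have sC : (1 - s)%:C != 0 :> R[i] by rewrite -cabs_eq0 cabsR normr_eq0 gt_eqF// subr_gt0.
      have := inO (t / (1 - s)%:C); rewrite [_%:C * _]mulrC divfK//; apply.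
      rewrite cabsM cabsV cabsR gtr0_norm ?subr_gt0// ltr_pdivrMr ?subr_gt0//.
      apply: (lt_le_trans tr); rewrite ler_pM2l//; lra.
    - by rewrite scale0r addr0.
    - by have [] := derivable_affine (conv_pt x y s) v 0.
  have dz : bdist Omega (conv_pt x y s) <= d * 2^-1 ^+ J.
    by apply/ltW; apply: le_lt_trans zd; exact: bdist_le.
  have := kob J _ v Oz (He _ ze) dz => k1 k2.
  have := le_trans k1 (ler_wpM2l (ltW (m0 J)) k2).
  by rewrite ler_pdivlMr ?divr_gt0// mulrC.
pose a := rho / 2 * enorm v.
have a0 : 0 < a by rewrite mulr_gt0// divr_gt0.
have H k : a *+ k <= 1.
  apply: le_trans (Sm k); rewrite big_mkord.
  apply: (@le_trans _ _ (\sum_(j < k) a)); first by rewrite sumr_const card_ord.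
  by apply: ler_sum => j _; exact: mJ.
have := H (Num.bound a^-1); rewrite -mulr_natl -ler_pdivlMr// mul1r leNgt.
by rewrite archi_boundP// invr_ge0 ltW.
Qed.

(** On either side of the peak the boundary distance after [J] exits is at most [d * q ^+ J], the
    scale of [dini_goldilocks], so [goldilocks_drift] on the curve and on its reversal gives at most
    [eta / 2] per side. *)
Lemma goldilocks_displacement x v U eps0 p (D eps eta : R) : boundary Omega x -> nbhs x U ->
  v != 0 -> 0 < eps0 ->
  (\int[@lebesgue_measure R]_(r in `]0%R, eps0]) (goldilocks_M Omega U r * (r^-1)%:E) < +oo)%E ->
  0 < eta ->
  exists2 h, 0 < h & forall gamma b, geodesic Omega 1 eps gamma -> 0 <= b -> b <= 1 ->
    (forall t, 0 <= t -> t <= b -> enorm (gamma t - p) <= D /\ bdist Omega (gamma t) <= h) ->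
    forall t1 t2, 0 <= t1 -> t1 <= t2 -> t2 <= b ->
      (forall t, t1 <= t -> t <= t2 -> U (gamma t)) ->
      `|realify (gamma t2 - gamma t1)| <= eta.
Proof.
move=> bx Ux v0 eps00 int eta0.
have bO : boundary Omega !=set0 by exists x.
have [z0 Oz0 _] := (closure_enormP Omega x).1 (boundary_closure bx) 1 ltr01.
have [C [A [A0 kob]]] := kobayashi_upper_bound oO cO bO (D + enorm (p - z0)) Oz0.
pose B := decay_const A (C + eps).
have B0 : 0 < B by exact: expR_gt0.
pose q := expR (- (16 * A)^-1 / 2).
have q0 : 0 < q by exact: expR_gt0.
have q1 : q < 1.
  by rewrite /q expR_lt1 mulNr oppr_lt0 divr_gt0 ?ltr0n// invr_gt0 mulr_gt0.
have qE : q ^+ (2 * 1) = decay_rate A.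
  by rewrite /q -expRM_natr divfK// pnatr_eq0.
have eta20 : 0 < eta / 2 by rewrite divr_gt0.
have [m [d d0 [m0 kr Sm]]] := dini_goldilocks bx Ux v0 eps00 int q0 q1 eta20.
(* With this [h] one has h B = d ^ 2, and the square root of the decay bound is d q ^ J. *)
exists (d ^+ 2 / B); first by rewrite divr_gt0// exprn_gt0.
move=> gamma b geo b0 b1 Hb.
have Hb' t : 0 <= t -> t <= b -> enorm (gamma t - z0) <= D + enorm (p - z0) /\
    bdist Omega (gamma t) <= d ^+ 2 / B.
  move=> t0 tb; have [g1 g2] := Hb t t0 tb; split => //.
  by apply: (le_trans (enorm_dist_triangle _ p _)); rewrite lerD2r.
have [t0 [t00 t0b fwd bwd]] := peak_decay oO bO A0 kob geo b0 b1 Hb'.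
have bound (J : nat) t : bdist Omega (gamma t) ^+ 2 <= d ^+ 2 / B * (B * decay_rate A ^+ J) ->
    bdist Omega (gamma t) <= d * q ^+ J.
  rewrite -qE => H; rewrite -[leLHS]mul1r -[leRHS]expr1.
  apply: decay_bound H _; rewrite ?(bdist_ge0 bO) ?(ltW q0) ?(ltW d0) ?ler01//.
  by rewrite expr1n mul1r divfK ?gt_eqF// expr1.
have lcg := geodesic_length_curve geo (lexx 0) b1.
have fwd_drift t1 t2 : t0 <= t1 -> t1 <= t2 -> t2 <= b ->
    (forall t, t1 <= t -> t <= t2 -> U (gamma t)) ->
    `|realify (gamma t2 - gamma t1)| <= eta / 2.
  move=> t01 t12 t2b Ug.
  have lc := length_curve_sub lcg t00 t2b.
  have [k Hk] := goldilocks_drift lc t01 t12 m0 Ug kr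
    (fun J t h1 h2 h3 => bound J t (fwd J t h1 (le_trans h2 t2b) h3)).
  exact: le_trans (Hk t2 t12 (lexx _)) (Sm k).
have bwd_drift t1 t2 : 0 <= t1 -> t1 <= t2 -> t2 <= t0 ->
    (forall t, t1 <= t -> t <= t2 -> U (gamma t)) ->
    `|realify (gamma t2 - gamma t1)| <= eta / 2.
  move=> t10 t12 t20 Ug.
  have lc := length_curve_rev (length_curve_sub lcg t10 t0b).
  have Ug' t : - t2 <= t -> t <= - t1 -> U (gamma (- t)).
    by move=> h1 h2; apply: Ug; [rewrite lerNr|rewrite lerNl].
  have lt0 : - t0 <= - t2 by rewrite lerN2.
  have l12 : - t2 <= - t1 by rewrite lerN2.
  have dg (J : nat) t : - t0 <= t -> t <= - t1 ->
      J%:R * 8^-1 <= fine (kappa_length_oc Omega gamma (- t) (- - t0)) ->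
      bdist Omega (gamma (- t)) <= d * q ^+ J.
    move=> h1 h2; rewrite opprK => h3; apply: bound; apply: bwd => //.
      by rewrite lerNr; apply: (le_trans h2); rewrite oppr0 oppr_le0.
    by rewrite lerNl.
  have [k Hk] := goldilocks_drift lc lt0 l12 m0 Ug' kr dg.
  have := Hk (- t1) l12 (lexx _); rewrite !opprK realifyB distrC -realifyB => H.
  exact: le_trans H (Sm k).
move=> t1 t2 t10 t12 t2b Ug.
have half : eta / 2 <= eta by rewrite ler_pdivrMr// ler_peMr ?(ltW eta0)// ler1n.
have [t01|t10'] := leP t0 t1; first exact: le_trans (fwd_drift t1 t2 t01 t12 t2b Ug) half.
have [t20|t02] := leP t2 t0; first exact: le_trans (bwd_drift t1 t2 t10 t12 t20 Ug) half.
have -> : gamma t2 - gamma t1 = (gamma t2 - gamma t0) + (gamma t0 - gamma t1) by rewrite subrKA.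
rewrite realifyD; apply: (le_trans (ler_normD _ _)); rewrite [eta]splitr; apply: lerD.
- apply: fwd_drift => //; first exact: ltW.
  by move=> t h1 h2; apply: Ug => //; apply: le_trans h1; exact: ltW.
- apply: bwd_drift => //; first exact: ltW.
  by move=> t h1 h2; apply: Ug => //; apply: (le_trans h2); exact: ltW.
Qed.

End GoldilocksPoints.

(** * Faces of the boundary *)

Section Face.
Variables (R : realType) (n : nat).
Variable Omega : set 'rV[R[i]]_n.
Hypotheses (oO : open Omega) (cO : convex_set Omega).
Implicit Types (v w x y z : 'rV[R[i]]_n).

Lemma conv_pt_dist x y x' y' (t : R) : 0 <= t -> t <= 1 ->
  enorm (conv_pt x y t - conv_pt x' y' t) <= Num.max (enorm (x - x')) (enorm (y - y')).
Proof.
move=> t0 t1; rewrite !conv_ptE opprD addrACA -!scalerBr.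
apply: (le_trans (enormD _ _)); rewrite !enormZ !cabsR !ger0_norm ?subr_ge0//.
set m := Num.max _ _.
have h1 : (1 - t) * enorm (x - x') <= (1 - t) * m by rewrite ler_wpM2l ?subr_ge0// le_max lexx.
have h2 : t * enorm (y - y') <= t * m by rewrite ler_wpM2l// le_max lexx orbT.
by apply: (le_trans (lerD h1 h2)); rewrite -mulrDl subrK mul1r.
Qed.

Lemma conv_pt_line x v (t : R) : conv_pt x (x + v) t = x + t%:C *: v.
Proof. by rewrite /conv_pt [x + v - x]addrC addKr. Qed.

Lemma closure_conv x y (t : R) : closure Omega x -> closure Omega y -> 0 <= t -> t <= 1 ->
  closure Omega (conv_pt x y t).
Proof.
move=> cx cy t0 t1; apply/closure_enormP => e e0.
have [x' Ox' xe] := (closure_enormP Omega x).1 cx e e0.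
have [y' Oy' ye] := (closure_enormP Omega y).1 cy e e0.
exists (conv_pt x' y' t); first exact: conv_ptP.
by apply: (le_lt_trans (conv_pt_dist _ _ _ _ t0 t1)); rewrite gt_max xe ye.
Qed.

Variables (p : 'rV[R[i]]_n) (c : 'I_n -> R[i]) (e0 : 'rV[R[i]]_n).
Hypotheses (bp : boundary Omega p) (sc : support_form Omega p c).
Hypothesis ce0 : complex.Re (cform c e0) = 1.

(** The whole complex number has to vanish, not only its real part: this is the face in the complex
    tangent hyperplane rather than in the real one. *)
Definition face : set 'rV[R[i]]_n := [set z | closure Omega z /\ cform c (z - p) = 0].

Lemma face_base : face p.
Proof. by split; [exact: boundary_closure|rewrite subrr /cform big1// => j _; rewrite mxE mul0r]. Qed.

(** From a point of [Omega] one could move by a small multiple of [- e0] and make the supporting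
    functional negative. *)
Lemma face_boundary z : face z -> boundary Omega z.
Proof.
move=> [cz fz]; apply: boundaryP => // Oz.
have [e e_gt0 He] := (nbhs_enormP _ _).1 (open_nbhs_nbhs (conj oO Oz)).
have N0 : 0 < enorm e0 + 1 by rewrite ltr_wpDl// enorm_ge0.
pose s := e / (enorm e0 + 1).
have s0 : 0 < s by rewrite divr_gt0.
have : Omega (z - s%:C *: e0).
  apply: He; rewrite addrC addKr enormN enormZ cabsR gtr0_norm//.
  by rewrite /s mulrAC ltr_pdivrMr// ltr_pM2l// ltrDl.
move=> /sc; have -> : complex.Re (cform c (z - s%:C *: e0 - p)) = - s.
  rewrite addrAC cformB fz cformZ sub0r.
  by case: (cform c e0) ce0 => a b /= ->; rewrite mulr1 mul0r subr0.
rewrite oppr_ge0.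
by rewrite leNgt s0.
Qed.

Lemma face_support z : face z -> support_form Omega z c.
Proof.
move=> [cz fz] w Ow; have -> : w - z = (w - p) - (z - p) by rewrite opprB subrKA.
by rewrite cformB fz subr0; exact: sc.
Qed.

Lemma face_conv x y (t : R) : face x -> face y -> 0 <= t -> t <= 1 -> face (conv_pt x y t).
Proof.
move=> [cx fx] [cy fy] t0 t1; split; first exact: closure_conv.
have -> : conv_pt x y t - p = (1 - t)%:C *: (x - p) + t%:C *: (y - p).
  rewrite conv_ptE !scalerBr addrACA -opprD -scalerDl -rmorphD/= subrK.
  by rewrite scale1r.
by rewrite cformD !cformZ fx fy !mulr0 addr0.
Qed.

Lemma segmentE x y : segment x y = [set conv_pt x y t | t in [set t : R | 0 <= t <= 1]].
Proof.
apply/seteqP; split => z [t /= ht <-].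
  by exists t; rewrite /= ?conv_ptE//; move: ht; rewrite in_itv.
by exists t; rewrite /= ?in_itv// -conv_ptE.
Qed.

Lemma face_segment x y : face x -> face y -> segment x y `<=` face.
Proof. by move=> fx fy; rewrite segmentE => _ [t /andP[t0 t1] <-]; exact: face_conv. Qed.

(** [cform c] vanishes on differences of face points and on their multiples by [i], and each face
    point is supported by the same [c], so these vectors are real tangent there. *)
Lemma face_tangential_segment alpha x y : C1alpha_boundary Omega alpha ->
  face x -> face y -> x != y -> complex_tangential_segment Omega (segment x y).
Proof.
move=> smooth fx fy xy; have sub := face_segment fx fy; split.
- by exists x, y.
- by move=> z /sub/face_boundary.
- move=> s /sub fs z /sub fz.
  have zs : cform c (z - s) = 0.
    have -> : z - s = (z - p) - (s - p) by rewrite opprB subrKA.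
    by rewrite cformB fz.2 fs.2 subr0.
  have bs := face_boundary fs.
  have def : exists rho, defining_function Omega s rho by have [rho [h _]] := smooth s bs; exists rho.
  have tang v : cform c v = 0 -> real_tangent Omega s v.
    move=> cv; apply: (support_real_tangent oO cO bs (face_support fs) (e0 := e0)) => //.
      by rewrite ce0.
    by rewrite cv.
  exists (z - s); last by rewrite addrC subrK.
  split; first exact: tang.
  exists (- 'i *: (z - s)); first by apply: tang; rewrite cformZ zs mulr0.
  by rewrite scalerA mulrN -expr2 sqr_i opprK scale1r.
Qed.

End Face.

Section Plane.
Variable R : realType.

(** Dimension two enters here: the kernel of a nonzero form is a complex line, so the face lies in
    one. Proportionality is the vanishing of the determinant of [v] and [w]. *)
Lemma cform_ker_line (c : 'I_2 -> R[i]) (e0 v w : 'rV[R[i]]_2) : cform c e0 != 0 ->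
  v != 0 -> cform c v = 0 -> cform c w = 0 -> exists a : R[i], w = a *: v.
Proof.
move=> ce0 v0; rewrite /cform !big_ord_recl !big_ord0 !addr0.
set c0 := c _; set c1 := c _; set j0 := ord0; set j1 := lift _ _.
move=> cv cw.
have det : w 0 j0 * v 0 j1 = w 0 j1 * v 0 j0.
  have : (c0 != 0) || (c1 != 0).
    apply: contraNT ce0; rewrite negb_or !negbK => /andP[/eqP h0 /eqP h1].
    by rewrite /cform !big_ord_recl big_ord0 -/c0 -/c1 h0 h1 !mulr0 !addr0.
  have E0 : (w 0 j0 * v 0 j1 - w 0 j1 * v 0 j0) * c0 =
      v 0 j1 * (w 0 j0 * c0 + w 0 j1 * c1) - w 0 j1 * (v 0 j0 * c0 + v 0 j1 * c1) by ring.
  have E1 : (w 0 j0 * v 0 j1 - w 0 j1 * v 0 j0) * c1 =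
      w 0 j0 * (v 0 j0 * c0 + v 0 j1 * c1) - v 0 j0 * (w 0 j0 * c0 + w 0 j1 * c1) by ring.
  rewrite cv cw !mulr0 subrr in E0 E1.
  move=> c01; apply/subr0_eq/eqP.
  by case/orP: c01 => h; [move/eqP: E0|move/eqP: E1]; rewrite mulf_eq0 (negbTE h) orbF.
have ordE (j : 'I_2) : j = j0 \/ j = j1.
  by case: j => -[|[|//]] h; [left|right]; exact: val_inj.
have [v00|v00] := eqVneq (v 0 j0) 0.
  have v10 : v 0 j1 != 0.
    apply: contra_neq v0 => v10; apply/rowP => j; rewrite mxE.
    by have [->|->] := ordE j.
  exists (w 0 j1 / v 0 j1); apply/rowP => j; rewrite mxE.
  have [->|->] := ordE j; last by rewrite divfK.
  by rewrite v00 mulr0; move/eqP: det; rewrite v00 mulr0 mulf_eq0 (negbTE v10) orbF => /eqP.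
exists (w 0 j0 / v 0 j0); apply/rowP => j; rewrite mxE.
have [->|->] := ordE j; first by rewrite divfK.
by rewrite mulrAC det mulfK.
Qed.

Lemma dual_form n (v : 'rV[R[i]]_n) : v != 0 -> exists d : 'I_n -> R[i], cform d v = 1.
Proof.
move=> v0; have [j vj] : exists j, v 0 j != 0.
  apply/not_existsP => H; move/eqP: v0; apply; apply/rowP => j; rewrite mxE.
  by apply/eqP/negPn/negP => h; apply: (H j).
exists (fun k => if k == j then (v 0 j)^-1 else 0).
rewrite /cform (bigD1 j)//= eqxx mulfV// big1 ?addr0// => k kj.
by rewrite (negbTE kj) mulr0.
Qed.

End Plane.

Section Crossing.
Variable R : realType.

(** [t2] is an exit of [F] through [w]; going back from it, [t1] is an exit of the reversed function
    through [u]. *)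
Lemma crossing (F : R -> R) (b u w : R) : 0 <= b -> cont_on F 0 b -> F 0 < u -> u < w -> w < F b ->
  exists t1 t2, [/\ 0 <= t1, t1 <= t2, t2 <= b & [/\ F t1 = u, F t2 = w &
    forall t, t1 <= t -> t <= t2 -> u <= F t /\ F t <= w]].
Proof.
move=> b0 cF Fu uw Fw.
have [H|[t2 [t20 t2b Ft2 H2]]] := first_exit b0 cF (lt_trans Fu uw).
  by have := H b b0 (lexx _); rewrite leNgt Fw.
pose G s := - F (- s).
have le0 : - t2 <= 0 by rewrite oppr_le0.
have cG : cont_on G (- t2) 0.
  move=> x x1 x2 e e0.
  have x1' : - x <= b by rewrite lerNl; apply: le_trans x1; rewrite lerN2.
  have x2' : 0 <= - x by rewrite oppr_ge0.
  have [d d0 H] := cF (- x) x2' x1' e e0.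
  exists d => // y y1 y2 yx; rewrite /G -opprD normrN.
  apply: H; first by rewrite oppr_ge0.
    by rewrite lerNl; apply: le_trans y1; rewrite lerN2.
  by rewrite -opprD normrN.
have G0 : G (- t2) < - u by rewrite /G opprK Ft2 ltrN2.
have [H|[s [s1 s2 Gs Hs]]] := first_exit le0 cG G0.
  by have := H 0 le0 (lexx _); rewrite /G oppr0 lerN2 leNgt Fu.
exists (- s), t2; split => //; first by rewrite oppr_ge0.
  by rewrite lerNl.
split => //; first by apply/eqP; rewrite -eqr_opp -Gs.
move=> t h1 h2; split.
  have := Hs (- t); rewrite /G opprK lerN2 lerN2 lerNl; exact.
by apply: H2 => //; apply: le_trans h1; rewrite oppr_ge0.
Qed.

End Crossing.

Section TriangleDisc.
Variables (R : realType) (n : nat).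
Variable Omega : set 'rV[R[i]]_n.
Hypotheses (cO : convex_set Omega).
Variables (p : 'rV[R[i]]_n) (c : 'I_n -> R[i]).

Lemma barycentric_bounds (a b x y rho : R) : b != 0 -> `|x| <= rho -> `|y| <= rho ->
  rho <= `|b| / 6 -> rho * (1 + `|a| / `|b|) <= 6^-1 ->
  `|y / b| <= 6^-1 /\ `|x - y / b * a| <= 6^-1.
Proof.
move=> b0 xr yr rb ra.
have b_gt0 : 0 < `|b| by rewrite normr_gt0.
have r0 : 0 <= rho by apply: le_trans xr.
have yb : `|y / b| <= rho / `|b| by rewrite normrM normfV ler_pM2r ?invr_gt0.
split; first by apply: (le_trans yb); rewrite ler_pdivrMr// mulrC.
apply: le_trans ra; rewrite mulrDr mulr1; apply: (le_trans (ler_normB _ _)); apply: lerD => //.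
rewrite normrM; apply: (le_trans (ler_wpM2r (normr_ge0 a) yb)).
by rewrite -mulrA [_^-1 * _]mulrC.
Qed.

(** The three face points span a nondegenerate triangle in a complex line, and a disc about its
    centroid lies inside. *)
Lemma triangle_disc v (l : R[i]) : face Omega p c p -> face Omega p c (p + v) ->
  face Omega p c (p + l *: v) -> complex.Im l != 0 ->
  exists z0 (rho : R), 0 < rho /\ forall w : R[i], cabs w < rho -> face Omega p c (z0 + w *: v).
Proof.
move=> fp fv fl l0.
case: l fl l0 => a b fl /= b0.
have b_gt0 : 0 < `|b| by rewrite normr_gt0.
have N0 : 0 < 1 + `|a| / `|b| by rewrite ltr_pwDl// divr_ge0.
pose rho := Num.min (`|b| / 6) (6^-1 / (1 + `|a| / `|b|)).
exists (p + ((1 + (a +i* b)) / 3) *: v), rho; split.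
  by rewrite lt_min !divr_gt0.
move=> [x y] wr.
have [h1 h2] : `|y / b| <= 6^-1 /\ `|x - y / b * a| <= 6^-1.
  apply: (@barycentric_bounds a b x y rho) => //.
  - by apply: le_trans (Re_le_cabs _) (ltW wr).
  - by apply: le_trans (Im_le_cabs _) (ltW wr).
  - by rewrite /rho ge_min lexx.
  - by rewrite -ler_pdivlMr// /rho ge_min lexx orbT.
(* Barycentric weights at [p + l *: v] and [p + v]: each differs from 1/3 by at most 1/6, so both
   are positive and their sum is at most 1. *)
pose t : R := 3^-1 + y / b; pose s : R := 3^-1 + (x - y / b * a).
have [t0 s0 st1] : [/\ 0 < t, 0 < s & s + t <= 1].
  move: h1 h2; rewrite !ler_norml /t /s => /andP[h1 h2] /andP[h3 h4].
  move: h1 h2 h3 h4; move: (y / b) => k; move: (x - k * a) => j.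
  by clear; move=> *; split; lra.
have st0 : 0 < s + t by exact: addr_gt0.
have fm : face Omega p c (conv_pt (p + v) (p + (a +i* b) *: v) (t / (s + t))).
  apply: face_conv => //; first by rewrite divr_ge0// ltW.
  by rewrite ler_pdivrMr// mul1r lerDr ltW.
have := face_conv cO fp fm (ltW st0) st1.
suff -> : conv_pt p (conv_pt (p + v) (p + (a +i* b) *: v) (t / (s + t))) (s + t) =
  p + ((1 + (a +i* b)) / 3) *: v + (x +i* y) *: v by [].
have E1 : (s + t)%:C * (t / (s + t))%:C = t%:C :> R[i].
  by rewrite -rmorphM/= mulrCA divff ?mulr1// gt_eqF.
rewrite /conv_pt [p + v + _ - p]addrAC [p + v - p]addrC addKr.
have -> : p + (a +i* b) *: v - (p + v) = ((a +i* b) - 1) *: v.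
  by rewrite opprD addrACA subrr add0r scalerBl scale1r.
have -> : v + (t / (s + t))%:C *: (((a +i* b) - 1) *: v) = (1 + (t / (s + t))%:C * ((a +i* b) - 1)) *: v.
  by rewrite scalerA scalerDl scale1r.
rewrite scalerA -[RHS]addrA -scalerDl; congr (_ + _ *: _).
rewrite mulrDr mulr1 mulrA E1 mulrBr mulr1.
rewrite /s /t; apply/eqP; rewrite eq_complex /=; apply/andP; split; apply/eqP; field; exact: b0.
Qed.

End TriangleDisc.

Section Cluster.
Variables (R : realType) (n : nat).
Implicit Types (z w x : 'rV[R[i]]_n).

Lemma cluster_le (Q : R -> set 'rV[R[i]]_n) z (psi : 'rV[R[i]]_n -> R) (k a : R) :
  0 <= k -> (forall x y, `|psi x - psi y| <= k * enorm (x - y)) ->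
  (forall e d, 0 < e -> 0 < d -> exists2 w, Q e w & enorm (w - z) < d) ->
  (forall e w, 0 < e -> Q e w -> psi w <= a + e) -> psi z <= a.
Proof.
move=> k0 lip cl H; apply/ler_addgt0Pr => e e0.
have e20 : 0 < e / 2 by rewrite divr_gt0.
have k1 : 0 < k + 1 by rewrite ltr_wpDl.
have [w Qw wz] := cl (e / 2) (e / 2 / (k + 1)) e20 (divr_gt0 e20 k1).
have := H _ _ e20 Qw; have := lip z w; rewrite enorm_distC ler_norml => /andP[_ h1] h2.
have h3 : k * enorm (w - z) <= e / 2.
  have : enorm (w - z) * (k + 1) <= e / 2 by rewrite -ler_pdivlMr// ltW.
  by apply: le_trans; rewrite mulrC ler_wpM2l ?enorm_ge0// lerDl.
have := splitr e; move: h1 h2 h3; move: (k * _) (psi z) (psi w) (e / 2) => x1 x2 x3 x4.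
by clear; lra.
Qed.

Lemma enorm_lip p x y : `|enorm (x - p) - enorm (y - p)| <= enorm (x - y).
Proof.
have h1 := enorm_dist_triangle x y p; have h2 := enorm_dist_triangle y x p.
apply: (dist_le_of_triangle (lexx _)); first by rewrite [leRHS]addrC.
by rewrite [leRHS]addrC [enorm (x - y)]enorm_distC.
Qed.

Lemma cform_lip (c : 'I_n -> R[i]) p x y :
  `|cabs (cform c (x - p)) - cabs (cform c (y - p))| <= (\sum_j cabs (c j)) * enorm (x - y).
Proof.
have D u v : cabs (cform c (u - p)) <= cabs (cform c (v - p)) + (\sum_j cabs (c j)) * enorm (u - v).
  have -> : u - p = (v - p) + (u - v) by rewrite [RHS]addrC subrKA.
  by rewrite cformD; apply: (le_trans (cabsD _ _)); rewrite lerD2l cabs_cform_le.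
apply: (dist_le_of_triangle (lexx _)); first exact: D.
rewrite [enorm (x - y)]enorm_distC; exact: D.
Qed.

Lemma Re_cform_lip (d : 'I_n -> R[i]) p x y :
  `|complex.Re (cform d (x - p)) - complex.Re (cform d (y - p))| <=
  (\sum_j cabs (d j)) * enorm (x - y).
Proof.
have -> : complex.Re (cform d (x - p)) - complex.Re (cform d (y - p)) = complex.Re (cform d (x - y)).
  have -> : x - y = (x - p) - (y - p) by rewrite opprB subrKA.
  by rewrite [in RHS]cformB; case: (cform d (x - p)) => ? ?; case: (cform d (y - p)).
by apply: (le_trans (Re_le_cabs _)); exact: cabs_cform_le.
Qed.

Variable Omega : set 'rV[R[i]]_n.

(** By compactness: were every [e] to fail, counterexamples would accumulate at a face point whose
    coordinate is in [tau, tau + om] and whose distance from the base point is at least [rho]. But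
    the face lies on a real line, where that distance is at most [om * enorm v]. *)
Lemma flat_face_window p v (c d : 'I_n -> R[i]) (R0 tau om rho : R) : cform d v = 1 ->
  (forall z, face Omega p c z -> exists l : R, z = p + l%:C *: v) ->
  0 <= om -> om * enorm v < rho ->
  exists2 e, 0 < e & forall z, Omega z -> enorm (z - p) <= R0 -> cabs (cform c (z - p)) <= e ->
    tau <= complex.Re (cform d (z - p)) -> complex.Re (cform d (z - p)) <= tau + om ->
    enorm (z - (p + tau%:C *: v)) < rho.
Proof.
move=> dv line om0 omr; set x := p + tau%:C *: v.
pose f z := complex.Re (cform d (z - p)).
pose Q e := [set z | [/\ Omega z, enorm (z - p) <= R0, cabs (cform c (z - p)) <= e &
  [/\ tau <= f z, f z <= tau + om & rho <= enorm (z - x)]]].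
have [H|H] := pselect (exists e, 0 < e /\ Q e = set0).
  have [e [e0 Qe]] := H; exists e => // z Oz zp cz f1 f2.
  rewrite ltNge; apply/negP => h; have : Q e z by split.
  by rewrite Qe.
exfalso.
have [z Hz] : exists z, forall e d, 0 < e -> 0 < d -> exists2 w, Q e w & enorm (w - z) < d.
  apply: (@cluster_point _ _ Q (R0 + enorm p)).
  - by move=> e e0; apply/set0P/eqP => Qe; apply: H; exists e.
  - by move=> e e' ee z [h1 h2 h3 h4]; split => //; exact: le_trans ee.
  - move=> e z [_ zp _ _]; rewrite -[z](subrK p).
    by apply: (le_trans (enormD _ _)); rewrite lerD2r.
have S0 (g : 'I_n -> R[i]) : 0 <= \sum_j cabs (g j) by apply: sumr_ge0 => j _; exact: cabs_ge0.
have fz : face Omega p c z.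
  split.
    apply/closure_enormP => e e0; have [w [Ow _ _ _] wz] := Hz 1 e ltr01 e0.
    by exists w.
  apply/eqP; rewrite -cabs_eq0 eq_le cabs_ge0 andbT.
  apply: (cluster_le (psi := fun z => cabs (cform c (z - p))) (S0 c) _ Hz); first exact: cform_lip.
  by move=> e w _ [_ _ h _]; rewrite add0r.
have [l zl] := line z fz.
have fl : f z = l.
  by rewrite /f zl addrC addKr cformZ dv mulr1.
have l1 : tau <= l.
  rewrite -fl -lerN2; apply: (cluster_le (psi := fun z => - f z) (S0 d) _ Hz).
    by move=> u w; rewrite -opprD normrN; exact: Re_cform_lip.
  by move=> e w e0 [_ _ _ [h _ _]]; rewrite -[leLHS]addr0 lerD ?lerN2// ltW.
have l2 : l <= tau + om.
  rewrite -fl; apply: (cluster_le (psi := f) (S0 d) _ Hz); first exact: Re_cform_lip.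
  by move=> e w e0 [_ _ _ [_ h _]]; rewrite -[leLHS]addr0 lerD// ltW.
have l3 : rho <= enorm (z - x).
  rewrite -lerN2; apply: (cluster_le (k := 1) (psi := fun z => - enorm (z - x)) ler01 _ Hz).
    by move=> u w; rewrite -opprD normrN mul1r; exact: enorm_lip.
  by move=> e w e0 [_ _ _ [_ _ h]]; rewrite -[leLHS]addr0 lerD ?lerN2// ltW.
move: l3; rewrite zl /x opprD addrACA subrr add0r -scalerBl -rmorphB enormZ cabsR.
rewrite ger0_norm ?subr_ge0// leNgt => /negP; apply; apply: le_lt_trans omr.
by rewrite ler_wpM2r ?enorm_ge0// lerBlDr addrC.
Qed.

End Cluster.

Section FlatFace.
Variables (R : realType) (n : nat).
Variable Omega : set 'rV[R[i]]_n.
Hypotheses (oO : open Omega) (cO : convex_set Omega).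
Implicit Types (v w x y z p : 'rV[R[i]]_n).

Definition thin_curve (c : 'I_n -> R[i]) p (R0 eps e : R) (gamma : R -> 'rV[R[i]]_n) (b : R) :=
  [/\ geodesic Omega 1 eps gamma, 0 <= b <= 1,
    enorm (gamma 0 - p) < e, enorm (gamma b - p) = R0 &
    forall t, 0 <= t -> t <= b -> [/\ enorm (gamma t - p) <= R0, bdist Omega (gamma t) <= e &
      cabs (cform c (gamma t - p)) <= e]].

(** The geodesics run from near [p] to near [p + v], so their [d]-coordinate crosses
    [tau, tau + om], and during the crossing they stay in [U]. The resulting displacement is too
    large for [goldilocks_displacement]. *)
Lemma flat_face_non_goldilocks (c : 'I_n -> R[i]) e0 p v (R0 eps tau : R) :
  boundary Omega p -> support_form Omega p c -> complex.Re (cform c e0) = 1 ->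
  v != 0 -> face Omega p c (p + v) ->
  (forall z, face Omega p c z -> exists l : R, z = p + l%:C *: v) ->
  (forall e d, 0 < e -> 0 < d -> exists gamma b, thin_curve c p R0 eps e gamma b /\
     enorm (gamma b - (p + v)) < d) ->
  3^-1 <= tau -> tau <= 2 / 3 -> non_goldilocks Omega (p + tau%:C *: v).
Proof.
move=> bp sc ce0 v0 fv line curves tau1 tau2.
have fp := face_base c bp.
set x := p + tau%:C *: v.
have fx : face Omega p c x.
  have -> : x = conv_pt p (p + v) tau by rewrite conv_pt_line.
  by apply: face_conv => //; lra.
have bx : boundary Omega x by exact: (face_boundary oO sc ce0 fx).
split => // -[_ [U [Ux [eps0 eps00 int] _]]].
have [rho rho0 Hrho] := (nbhs_enormP _ _).1 Ux.
have [d dv] := dual_form v0.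
have v_gt0 : 0 < enorm v by rewrite enorm_gt0.
pose k := \sum_j cabs (d j) + 1.
have k0 : 0 < k by rewrite ltr_wpDl// sumr_ge0// => j _; exact: cabs_ge0.
have kP w : cabs (cform d w) <= k * enorm w.
  by apply: (le_trans (cabs_cform_le _ _)); rewrite ler_wpM2r ?enorm_ge0// lerDl.
pose N := (n + n)%:R + 1 : R.
have N0 : 0 < N by rewrite ltr_wpDl.
(* At most 1/6, so that [tau + om] is at most 5/6 while the end points of the geodesic have
   coordinates within 1/12 of 0 and 1; and short enough for the window to fit in [U]. *)
pose om := Num.min 6^-1 (rho / (2 * enorm v)).
have v20 : 0 < 2 * enorm v by rewrite mulr_gt0.
have om0 : 0 < om by rewrite lt_min invr_gt0 ltr0n divr_gt0.
have om6 : om <= 6^-1 by rewrite /om ge_min lexx.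
have omr : om * enorm v < rho.
  have : om * (2 * enorm v) <= rho by rewrite -ler_pdivlMr// /om ge_min lexx orbT.
  by rewrite mulrCA; have := mulr_gt0 om0 v_gt0; move: (om * _) => y; lra.
have nN : (n + n)%:R <= N by rewrite lerDl.
clearbody om k N.
have [e1 e10 window] := flat_face_window R0 tau dv line (ltW om0) omr.
(* Converted to the Euclidean norm (factor [N]) and to the [d]-coordinate (factor [k]), this
   displacement accounts for only [om / 2]. *)
have eta0 : 0 < om / (2 * (k * N)) by rewrite divr_gt0// !mulr_gt0.
have [h h0 disp] := goldilocks_displacement oO cO p R0 eps bx Ux v0 eps00 int eta0.
pose e := Num.min e1 (Num.min h (12 * k)^-1).
have k12 : 0 < 12 * k by rewrite mulr_gt0.
have e_gt0 : 0 < e by rewrite !lt_min e10 h0 invr_gt0.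
have [ee1 eh ek] : [/\ e <= e1, e <= h & e <= (12 * k)^-1].
  by rewrite /e !ge_min !lexx /= !orbT.
clearbody e.
have ke : k * e <= 12^-1.
  have : k * e <= k * (12 * k)^-1 by rewrite ler_pM2l.
  by rewrite invfM mulrCA divff ?mulr1// gt_eqF.
have [gamma [b [[geo /andP[b0 b1] g0 gb Hg] gq]]] := curves e e e_gt0 e_gt0.
have [gO ac _] := geo.
pose f t := complex.Re (cform d (gamma t - p)).
have cf : cont_on f 0 b.
  move=> s s0 sb e' e'0; have [dl dl0 H] := absolutely_continuous_dist ac (divr_gt0 e'0 k0).
  exists dl => // t t0 tb ts.
  have s1 := le_trans sb b1; have t1 := le_trans tb b1.
  have := H s t s0 s1 t0 t1 ts; rewrite ltr_pdivlMr// mulrC => /ltW; apply: le_trans.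
  have -> : f t - f s = complex.Re (cform d (gamma t - gamma s)).
    have -> : gamma t - gamma s = (gamma t - p) - (gamma s - p) by rewrite opprB subrKA.
    by rewrite [in RHS]cformB /f; case: (cform d (gamma t - p)) => ? ?; case: (cform d _).
  exact: le_trans (Re_le_cabs _) (kP _).
have f0 : f 0 < tau.
  have : f 0 <= k * e.
    apply: (le_trans (ler_norm _)); apply: (le_trans (Re_le_cabs _)); apply: (le_trans (kP _)).
    by rewrite ler_pM2l// ltW.
  move: ke tau1; move: (f 0) (k * e) => u1 u2; lra.
have fb : tau + om < f b.
  have fbE : complex.Re (cform d (gamma b - (p + v))) = f b - 1.
    have -> : gamma b - (p + v) = (gamma b - p) - v by rewrite opprD addrA.
    by rewrite [in LHS]cformB dv /f; case: (cform d _).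
  have : `|f b - 1| <= k * e.
    rewrite -fbE; apply: (le_trans (Re_le_cabs _)); apply: (le_trans (kP _)).
    by rewrite ler_pM2l// ltW.
  rewrite ler_norml => /andP[]; move: ke tau2 om6; move: (f b) (k * e) => u1 u2; lra.
have tom : tau < tau + om by rewrite ltrDl.
have [t1 [t2 [t10 t12 t2b [ft1 ft2 ft]]]] := crossing b0 cf f0 tom fb.
have gU t : t1 <= t -> t <= t2 -> U (gamma t).
  move=> h1 h2; have t0 := le_trans t10 h1; have tb := le_trans h2 t2b.
  have [g1 g2 g3] := Hg t t0 tb; have [k1 k2] := ft t h1 h2.
  apply: Hrho; apply: window => //; last exact: le_trans ee1.
  by apply: gO; rewrite t0 (le_trans tb b1).
have Hg' t : 0 <= t -> t <= b -> enorm (gamma t - p) <= R0 /\ bdist Omega (gamma t) <= h.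
  by move=> t0 tb; have [g1 g2 g3] := Hg t t0 tb; split => //; exact: le_trans eh.
have D := disp gamma b geo b0 b1 Hg' t1 t2 t10 t12 t2b gU.
have : om <= k * (N * (om / (2 * (k * N)))).
  have {1}-> : om = complex.Re (cform d (gamma t2 - gamma t1)).
    have -> : gamma t2 - gamma t1 = (gamma t2 - p) - (gamma t1 - p) by rewrite opprB subrKA.
    have -> : om = f t2 - f t1 by rewrite ft1 ft2 addrC addKr.
    by rewrite [in RHS]cformB /f; case: (cform d (gamma t2 - p)) => ? ?; case: (cform d _).
  apply: (le_trans (ler_norm _)); apply: (le_trans (Re_le_cabs _)); apply: (le_trans (kP _)).
  rewrite ler_pM2l//; apply: (le_trans (enorm_le_realify _)).
  exact: ler_pM.
have -> : k * (N * (om / (2 * (k * N)))) = om / 2 by field; rewrite !gt_eqF.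
by rewrite leNgt ltr_pdivrMr// ltr_pMr// ltr1n.
Qed.

End FlatFace.

Theorem corollary12 (R : realType) (Omega : set 'rV[R[i]]_2) (alpha : R)
    (Omega_domain : domain Omega)
    (Omega_convex : convex_set Omega)
    (Omega_no_line : ~ contains_complex_line Omega)
    (alpha_gt0 : 0 < alpha)
    (Omega_smooth : C1alpha_boundary Omega alpha)
    (Omega_not_visible : ~ weak_visibility Omega) :
  exists S : set 'rV[R[i]]_2,
    complex_tangential_segment Omega S /\ S `<=` non_goldilocks Omega.
Proof.
have [_ oO _] := Omega_domain.
have [p [q [eps [bp bq pq nvis]]]] : exists p q eps, [/\ boundary Omega p, boundary Omega q,
    p != q & ~ visible_pair Omega 1 eps p q].
  apply: contrapT => H; apply: Omega_not_visible => p q bp bq pq eps _.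
  by apply: contrapT => nvis; apply: H; exists p, q, eps.
have bO : boundary Omega !=set0 by exists p.
have [c [r [M [K [s0 [N [e0 [[r0 M0 K0 s00] frame jump]]]]]]]] :=
  local_frame oO Omega_convex alpha_gt0 bp (Omega_smooth p bp).
have pin : enorm (p - p) < r by rewrite subrr enorm0.
have [sc _ ce0] := frame p bp pin.
have frame' x : boundary Omega x -> enorm (x - p) < r ->
     support_form Omega x (c x) /\ forall v, cabs (cform (c x) v) <= M * enorm v.
  by move=> bx xr; have [] := frame x bx xr.
have qp0 : 0 < enorm (q - p) by rewrite enorm_gt0 subr_eq0 eq_sym.
(* The ball of radius [R0] lies where the local frame is valid and does not reach [q]. *)
pose R0 := Num.min (r / 2) (enorm (q - p) / 2).
have R00 : 0 < R0 by rewrite lt_min !divr_gt0.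
have R0r : R0 <= r / 2 by rewrite /R0 ge_min lexx.
have R0q : R0 < enorm (q - p).
  have : R0 <= enorm (q - p) / 2 by rewrite /R0 ge_min lexx orbT.
  by move/le_lt_trans; apply; rewrite ltr_pdivrMr// ltr_pMr// ltr1n.
clearbody R0.
have thin e : 0 < e -> exists gamma b, thin_curve Omega (c p) p R0 eps e gamma b.
  move=> e_gt0.
  have [h [sigma [h0 sigma0 H]]] := normal_coordinate_small oO Omega_convex eps bp r0 M0 K0 s00
    frame' jump e_gt0.
  pose s := Num.min (Num.min sigma e) (R0 / 2).
  have s_gt0 : 0 < s by rewrite !lt_min sigma0 e_gt0 divr_gt0.
  have sR : s < R0.
    have : s <= R0 / 2 by rewrite /s ge_min lexx orbT.
    by move/le_lt_trans; apply; rewrite ltr_pdivrMr// ltr_pMr// ltr1n.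
  have he : 0 < Num.min h e by rewrite lt_min h0.
  have [gamma [b [geo b01 g0 gb Hg]]] := thin_geodesics oO nvis s_gt0 sR R0q he.
  move: g0; rewrite /s !lt_min => /andP[/andP[g1 g2] _].
  exists gamma, b; split => // t t0 tb.
  have [k1] := Hg t t0 tb; rewrite le_min => /andP[k2 k3]; split => //.
  apply: (H gamma b) => // u u0 ub; have [j1] := Hg u u0 ub; rewrite le_min => /andP[j2 _].
  by split => //; exact: le_trans R0r.
(* An accumulation point, as the thinness tends to 0, of the points where the curves reach the
   sphere of radius [R0]; it is the second point of the face. *)
have [q' Hq'] : exists z, forall e d, 0 < e -> 0 < d ->
    exists2 w, (exists gamma b, thin_curve Omega (c p) p R0 eps e gamma b /\ w = gamma b) &
      enorm (w - z) < d.
  apply: (@cluster_point _ _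
    (fun e => [set w | exists gamma b, thin_curve Omega (c p) p R0 eps e gamma b /\ w = gamma b])
    (R0 + enorm p)).
  - by move=> e /thin[gamma [b H]]; exists (gamma b), gamma, b.
  - move=> e e' ee w [gamma [b [[h1 h2 h3 h4 h5] wE]]]; exists gamma, b; split => //; split => //.
      exact: lt_le_trans ee.
    by move=> t t0 tb; have [k1 k2 k3] := h5 t t0 tb; split => //; exact: le_trans ee.
  - move=> e w [gamma [b [[_ _ _ gb _] ->]]]; rewrite -[gamma b](subrK p).
    by apply: (le_trans (enormD _ _)); rewrite gb.
have curves e d : 0 < e -> 0 < d -> exists gamma b, thin_curve Omega (c p) p R0 eps e gamma b /\
    enorm (gamma b - q') < d.
  move=> e_gt0 d0; have [w [gamma [b [th wE]]] wd] := Hq' e d e_gt0 d0.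
  by exists gamma, b; rewrite -wE.
pose v := q' - p.
have q'E : p + v = q' by rewrite addrC subrK.
have S0 (g : 'I_2 -> R[i]) : 0 <= \sum_j cabs (g j) by apply: sumr_ge0 => j _; exact: cabs_ge0.
have v0 : v != 0.
  rewrite -enorm_gt0 (lt_le_trans R00)// -lerN2.
  apply: (cluster_le (k := 1) (psi := fun z => - enorm (z - p)) ler01 _ Hq').
    by move=> x y; rewrite -opprD normrN mul1r; exact: enorm_lip.
  by move=> e w e_gt0 [gamma [b [[_ _ _ gb _] ->]]]; rewrite gb lerDl ltW.
have fv : face Omega p (c p) (p + v).
  rewrite q'E; split.
    apply/closure_enormP => e e_gt0; have [gamma [b [[geo b01 _ _ _] gq]]] := curves e e e_gt0 e_gt0.
    by exists (gamma b) => //; have [gO _ _] := geo; exact: gO.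
  apply/eqP; rewrite -cabs_eq0 eq_le cabs_ge0 andbT.
  apply: (cluster_le (psi := fun z => cabs (cform (c p) (z - p))) (S0 (c p)) _ Hq').
    exact: cform_lip.
  move=> e w _ [gamma [b [[_ /andP[b0 _] _ _ Hg] ->]]]; rewrite add0r.
  by have [] := Hg b b0 (lexx _).
have fp := face_base (c p) bp.
have cv : cform (c p) v = 0 by have := fv.2; rewrite [p + v - p]addrC addKr.
have c0 : cform (c p) e0 != 0.
  by apply/eqP => h; move: ce0; rewrite h /= => /eqP; rewrite eq_sym oner_eq0.
have coord z : face Omega p (c p) z -> exists a : R[i], z = p + a *: v.
  move=> [_ cz]; have [a aE] := cform_ker_line c0 v0 cv cz.
  by exists a; rewrite -aE addrC subrK.
(* A non-real coefficient gives a nondegenerate triangle in the face, hence a disc; otherwise the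
   face lies on the real line through [p] and [q']. *)
have [[a [fa a0]]|flat] := pselect (exists a : R[i], face Omega p (c p) (p + a *: v) /\
    complex.Im a != 0).
  have [z0 [rho [rho0 disc]]] := triangle_disc Omega_convex fp fv fa a0.
  have rho2 : 0 < rho / 2 by rewrite divr_gt0.
  have f0 : face Omega p (c p) z0.
    by have := disc 0; rewrite cabs0 scale0r addr0; apply.
  have f1 : face Omega p (c p) (z0 + (rho / 2)%:C *: v).
    by apply: disc; rewrite cabsR gtr0_norm// ltr_pdivrMr// ltr_pMr// ltr1n.
  have rC : (rho / 2)%:C != 0 :> R[i] by rewrite -cabs_eq0 cabsR normr_eq0 gt_eqF.
  exists (segment z0 (z0 + (rho / 2)%:C *: v)); split.
    apply: (face_tangential_segment oO Omega_convex sc ce0 Omega_smooth f0 f1).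
    by rewrite -subr_eq0 opprD addrA subrr sub0r oppr_eq0 scaler_eq0 negb_or rC.
  move=> x Sx; have fx := face_segment Omega_convex f0 f1 Sx.
  (* The segment is a radius of the disc of half the size, so discs of radius [rho / 2] about its
     points stay in the large disc. *)
  apply: (disc_non_goldilocks oO Omega_convex (face_boundary oO sc ce0 fx) v0 rho2) => w wr.
  move: Sx; rewrite segmentE => -[t /andP[t0 t1] <-].
  have -> : conv_pt z0 (z0 + (rho / 2)%:C *: v) t + w *: v = z0 + ((t * (rho / 2))%:C + w) *: v.
    by rewrite conv_pt_line scalerA -rmorphM -addrA -scalerDl.
  suff /disc[] : cabs ((t * (rho / 2))%:C + w) < rho by [].
  apply: (le_lt_trans (cabsD _ _)); rewrite cabsR ger0_norm; last by apply: mulr_ge0 => //; exact: ltW.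
  by rewrite [ltRHS]splitr; apply: ler_ltD => //; rewrite ler_piMl// ltW.
have line z : face Omega p (c p) z -> exists l : R, z = p + l%:C *: v.
  move=> fz; have [l zE] := coord z fz; exists (complex.Re l).
  have [l0|l0] := eqVneq (complex.Im l) 0; last by exfalso; apply: flat; exists l; rewrite -zE.
  by rewrite zE; congr (_ + _ *: _); apply/eqP; rewrite eq_complex /= l0 !eqxx.
have curves' e d : 0 < e -> 0 < d -> exists gamma b, thin_curve Omega (c p) p R0 eps e gamma b /\
    enorm (gamma b - (p + v)) < d by rewrite q'E; exact: curves.
have ptE (t : R) : p + t%:C *: v = conv_pt p (p + v) t by rewrite conv_pt_line.
(* The middle third stays away from [p] and [p + v], near which the geodesics start and end. *)
pose x1 := p + (3^-1 : R)%:C *: v; pose x2 := p + (2 / 3 : R)%:C *: v.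
have fx1 : face Omega p (c p) x1 by rewrite /x1 ptE; apply: face_conv => //; lra.
have fx2 : face Omega p (c p) x2 by rewrite /x2 ptE; apply: face_conv => //; lra.
exists (segment x1 x2); split.
  apply: (face_tangential_segment oO Omega_convex sc ce0 Omega_smooth fx1 fx2).
  rewrite -subr_eq0 /x1 /x2 opprD addrACA subrr add0r -scalerBl -rmorphB scaler_eq0 negb_or v0 andbT.
  by rewrite -cabs_eq0 cabsR normr_eq0; lra.
rewrite segmentE => _ [t /andP[t0 t1] <-].
have -> : conv_pt x1 x2 t = p + (3^-1 + t / 3)%:C *: v.
  rewrite /conv_pt /x1 /x2 opprD addrACA subrr add0r -scalerBl -rmorphB scalerA -rmorphM -addrA -scalerDl.
  by rewrite -rmorphD /=; congr (_ + (_)%:C *: _); field.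
by apply: (flat_face_non_goldilocks oO Omega_convex bp sc ce0 v0 fv line curves'); lra.
Qed.
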